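(* Let $Q=\widetilde{A_{n-1}}$, $A=\Pi_Q(k)$ and let $G$ be a finite subgroup of $\operatorname{Aut}_{\mathrm{gr}}(A)$ such that $g(e_i)=e_i$ for all $g\in G$ and all $i=1,\dots,n$. Then the following conditions are equivalent: (1) $\operatorname{gl.dim}(A^G)=\operatorname{gl.dim}(A)$ (i.e. $\operatorname{gl.dim}(A^G)=2$). (2) $A^G$ is twisted Calabi-Yau. (3) $A$ is a projective right $A^G$-module.
   Context: $k$ is an algebraically closed field of characteristic $0$. Let $n\ge 3$ and let $Q=\widetilde{A_{n-1}}$ be the quiver with vertices $e_1,\dots,e_n$ and one arrow $\alpha_i$ from $e_i$ to $e_{i+1}$ for each $i=1,\dots,n$ (indices modulo $n$). Its double $\bar Q$ has the same vertices, the arrows $\alpha_i$, and additional arrows $\alpha_i^\ast$ from $e_{i+1}$ to $e_i$. Paths are composed left to right ($\alpha\beta$ means first $\alpha$, then $\beta$), and $e_i$ also denotes the trivial path at the vertex $e_i$. The preprojective algebra is $A=\Pi_Q(k)=k\bar Q/\left(\sum_i\alpha_i\alpha_i^\ast-\sum_i\alpha_i^\ast\alpha_i\right)$, i.e. $k\bar Q$ modulo the relations $\alpha_i\alpha_i^\ast=\alpha_{i-1}^\ast\alpha_{i-1}$, graded by path length. A graded automorphism is an algebra automorphism $g$ with $g(A_j)=A_j$ for all $j$; these form $\operatorname{Aut}_{\mathrm{gr}}(A)$. The fixed ring is $A^G=\{a\in A\mid g(a)=a\text{ for all }g\in G\}$. Twisted Calabi-Yau: for a $k$-algebra $B$ put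 $B^e=B\otimes_k B^{\mathrm{op}}$. $B$ is twisted Calabi-Yau of dimension $d$ if (CY1) $B$ has a finite-length resolution by finitely generated projective $(B,B)$-bimodules, and (CY2) there is an invertible $k$-central $(B,B)$-bimodule $U$ such that, as $(B,B)$-bimodules, $\operatorname{Ext}^i_{B^e}(B,B^e)=0$ for $i\ne d$ and $\operatorname{Ext}^d_{B^e}(B,B^e)\cong U$ (each $\operatorname{Ext}$ regarded as a right $B^e$-module via the inner right $B^e$-structure of $B^e$). ''Twisted Calabi-Yau'' without a dimension means twisted Calabi-Yau of some dimension $d$. *)

(* Defs.v *)
From HB Require Import structures.
From mathcomp Require Import all_boot all_algebra.
From mathcomp Require Import generic_quotient ring_quotient finmap.
From mathcomp.multinomials Require Import monalg.
From mathcomp Require Import boolp classical_sets functions cardinality.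

Set Implicit Arguments.
Unset Strict Implicit.
Unset Printing Implicit Defensive.

Import GRing.Theory.
Local Open Scope ring_scope.

(* Linear extension to the free module {malg R[K]} of a map defined on K. *)
Section LinearExtension.
Variables (R : nzRingType) (K : choiceType) (V : lmodType R) (h : K -> V).

Definition lext (f : {malg R[K]}) : V := \sum_(x <- msupp f) f@_x *: h x.

Lemma lextw (D : {fset K}) f :
  (msupp f `<=` D)%fset -> lext f = \sum_(x <- D) f@_x *: h x.
Proof.
move=> fD; rewrite /lext (big_fset_incl _ fD) // => x _ /mcoeff_outdom ->.
by rewrite scale0r.
Qed.

Lemma lext_linear : linear lext.
Proof.
move=> a f g; pose D := (msupp f `|` msupp g)%fset.
have fD : (msupp f `<=` D)%fset by apply: fsubsetUl.
have gD : (msupp g `<=` D)%fset by apply: fsubsetUr.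
have aD : (msupp (a *: f + g) `<=` D)%fset.
  apply: fsubset_trans (msuppD_le _ _) _; apply: fsetUSS => //.
  exact: msuppZ_le.
rewrite (lextw aD) (lextw fD) (lextw gD) scaler_sumr -big_split /=.
by apply: eq_bigr => x _; rewrite mcoeffD mcoeffZ scalerDl scalerA.
Qed.

HB.instance Definition _ :=
  GRing.isLinear.Build R {malg R[K]} V *:%R lext lext_linear.

Lemma lextU x : lext << x >> = h x.
Proof. by rewrite /lext msuppU oner_eq0 big_seq_fset1 mcoeffUU scale1r. Qed.

Lemma malg_span (f : {malg R[K]}) : f = \sum_(x <- msupp f) f@_x *: << x >>.
Proof.
rewrite {1}[f]monalgE; apply: eq_bigr => x _; apply/malgP => y.
by rewrite mcoeffZ !mcoeffU mulrnAr mulr1.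
Qed.

Lemma malg_ind (P : {malg R[K]} -> Prop) :
  P 0 -> (forall a f g, P f -> P g -> P (a *: f + g)) ->
  (forall x, P << x >>) -> forall f, P f.
Proof.
move=> P0 PD PU f; rewrite [f]malg_span.
by elim/big_rec: _ => // x g _; apply: PD.
Qed.

End LinearExtension.

Section Quotients.
Variable R : pzRingType.

Record submodule (V : lmodType R) := Submodule {
  submod_pred :> {pred V};
  submod0 : 0 \in submod_pred;
  submodP : forall a x y,
    x \in submod_pred -> y \in submod_pred -> a *: x + y \in submod_pred }.

Fact submod_zmod_closed V (I : submodule V) : zmod_closed I.
Proof.
split=> [|x y Ix Iy]; first exact: submod0.
by rewrite addrC -scaleN1r; apply: submodP.
Qed.

HB.instance Definition _ V (I : submodule V) :=
  GRing.isZmodClosed.Build V (submod_pred I) (submod_zmod_closed I).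

Section QuotientModule.
Variables (V : lmodType R) (I : submodule V).

Definition quotmod := Quotient.quot (submod_pred I).
HB.instance Definition _ := GRing.Zmodule.on quotmod.

Definition qpi (x : V) : quotmod := \pi_(Quotient.quot (submod_pred I))%qT x.
Definition qrepr (z : quotmod) : V := generic_quotient.repr z.

Lemma qreprK z : qpi (qrepr z) = z. Proof. exact: reprK. Qed.

Lemma qpi_eq x y : qpi x = qpi y <-> x - y \in submod_pred I.
Proof.
rewrite (Quotient.idealrBE (submod_pred I)); split; first by move/eqP.
by move/eqP.
Qed.

Lemma qpiB : zmod_morphism qpi.
Proof. by move=> x y; rewrite /qpi !piE. Qed.

HB.instance Definition _ := GRing.isZmodMorphism.Build V quotmod qpi qpiB.

Definition qscale a z := qpi (a *: qrepr z).

Lemma qscaleE a x : qscale a (qpi x) = qpi (a *: x).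
Proof.
apply/qpi_eq; rewrite -scalerBr -[_ *: _]addr0.
by apply: submodP; rewrite ?submod0 //; apply/qpi_eq; rewrite qreprK.
Qed.

Fact qscaleA a b z : qscale a (qscale b z) = qscale (a * b) z.
Proof. by rewrite -[z]qreprK !qscaleE scalerA. Qed.
Fact qscale1 : left_id 1 qscale.
Proof. by move=> z; rewrite -[z]qreprK qscaleE scale1r. Qed.
Fact qscaleDr : right_distributive qscale +%R.
Proof.
move=> a z t; rewrite -[z]qreprK -[t]qreprK -raddfD !qscaleE -raddfD.
by rewrite scalerDr.
Qed.
Fact qscaleDl z : {morph qscale^~ z : a b / a + b}.
Proof. by move=> a b; rewrite -[z]qreprK !qscaleE scalerDl raddfD. Qed.

HB.instance Definition _ := GRing.Zmodule_isLmodule.Build R quotmod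
  qscaleA qscale1 qscaleDr qscaleDl.

Lemma qpiZ : scalable qpi.
Proof. by move=> a x; rewrite -qscaleE. Qed.

HB.instance Definition _ := GRing.isScalable.Build R V quotmod *:%R qpi qpiZ.

End QuotientModule.
End Quotients.

Section QuotientAlgebra.
Variables (k : comNzRingType) (A : algType k).

Record ideal := Ideal {
  ideal_submod :> submodule A;
  idealMl : forall a x, x \in submod_pred ideal_submod ->
    a * x \in submod_pred ideal_submod;
  idealMr : forall a x, x \in submod_pred ideal_submod ->
    x * a \in submod_pred ideal_submod;
  ideal_proper : 1 \notin submod_pred ideal_submod }.

Variable I : ideal.

Definition quotalg := quotmod I.
HB.instance Definition _ := GRing.Lmodule.on quotalg.

Definition quotalg_pi : A -> quotalg := qpi I.
Local Notation pi := quotalg_pi.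

Lemma quotalg_piB : zmod_morphism pi. Proof. exact: qpiB. Qed.
Lemma quotalg_piZ : scalable pi. Proof. exact: qpiZ. Qed.

HB.instance Definition _ :=
  GRing.isZmodMorphism.Build A quotalg pi quotalg_piB.
HB.instance Definition _ :=
  GRing.isScalable.Build k A quotalg *:%R pi quotalg_piZ.

Lemma quotalg_surj z : pi (qrepr z) = z. Proof. exact: qreprK. Qed.

Definition qmul (z t : quotalg) : quotalg := pi (qrepr z * qrepr t).

Lemma qmulE x y : qmul (pi x) (pi y) = pi (x * y).
Proof.
apply/qpi_eq; set x' := qrepr _; set y' := qrepr _.
have -> : x' * y' - x * y = 1 *: ((x' - x) * y') + x * (y' - y).
  by rewrite scale1r mulrBl mulrBr addrA subrK.
by apply: submodP; [apply: idealMr | apply: idealMl]; apply/qpi_eq;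
  rewrite qreprK.
Qed.

Fact qmulA : associative qmul.
Proof.
by move=> x y z; rewrite -[x]quotalg_surj -[y]quotalg_surj -[z]quotalg_surj !qmulE mulrA.
Qed.
Fact qmul1l : left_id (pi 1) qmul.
Proof. by move=> x; rewrite -[x]quotalg_surj qmulE mul1r. Qed.
Fact qmul1r : right_id (pi 1) qmul.
Proof. by move=> x; rewrite -[x]quotalg_surj qmulE mulr1. Qed.
Fact qmulDl : left_distributive qmul +%R.
Proof.
move=> x y z; rewrite -[x]quotalg_surj -[y]quotalg_surj -[z]quotalg_surj -raddfD !qmulE.
by rewrite -raddfD mulrDl.
Qed.
Fact qmulDr : right_distributive qmul +%R.
Proof.
move=> x y z; rewrite -[x]quotalg_surj -[y]quotalg_surj -[z]quotalg_surj -raddfD !qmulE.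
by rewrite -raddfD mulrDr.
Qed.
Fact qone_neq0 : pi 1 != 0.
Proof.
apply/eqP; rewrite -(raddf0 pi) => /qpi_eq; rewrite subr0.
by apply/negP; apply: ideal_proper.
Qed.

HB.instance Definition _ := GRing.Zmodule_isNzRing.Build quotalg
  qmulA qmul1l qmul1r qmulDl qmulDr qone_neq0.

Lemma quotalg_piM x y : pi x * pi y = pi (x * y).
Proof. exact: qmulE. Qed.

Lemma quotalg_pi_monoid_morphism : monoid_morphism pi.
Proof. by split=> // x y; rewrite quotalg_piM. Qed.

HB.instance Definition _ :=
  GRing.isMonoidMorphism.Build A quotalg pi quotalg_pi_monoid_morphism.

Fact qscaleAl a (x y : quotalg) : a *: (x * y) = a *: x * y.
Proof.
rewrite -[x]quotalg_surj -[y]quotalg_surj.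
by rewrite -(quotalg_piZ a (qrepr x)) !quotalg_piM -(quotalg_piZ a (_ * _)) scalerAl.
Qed.
HB.instance Definition _ :=
  GRing.Lmodule_isLalgebra.Build k quotalg qscaleAl.

Fact qscaleAr a (x y : quotalg) : a *: (x * y) = x * (a *: y).
Proof.
rewrite -[x]quotalg_surj -[y]quotalg_surj.
by rewrite -(quotalg_piZ a (qrepr y)) !quotalg_piM -(quotalg_piZ a (_ * _)) scalerAr.
Qed.
HB.instance Definition _ := GRing.Lalgebra_isAlgebra.Build k quotalg qscaleAr.

End QuotientAlgebra.

Section GeneratedIdeal.
Variables (k : comNzRingType) (A : algType k) (S : set A).

Definition in_gen_ideal : {pred A} := [pred x | `[<
  forall J : submodule A,
    (forall a y, y \in submod_pred J ->
       a * y \in submod_pred J /\ y * a \in submod_pred J) ->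
    (forall s, S s -> s \in submod_pred J) -> x \in submod_pred J >]].

Fact gen_ideal0 : 0 \in in_gen_ideal.
Proof. by apply/asboolP => J *; apply: submod0. Qed.
Fact gen_idealP a x y :
  x \in in_gen_ideal -> y \in in_gen_ideal -> a *: x + y \in in_gen_ideal.
Proof.
move=> /asboolP Ix /asboolP Iy; apply/asboolP => J JM JS.
by apply: submodP; [apply: Ix | apply: Iy].
Qed.
Fact gen_idealMl a x : x \in in_gen_ideal -> a * x \in in_gen_ideal.
Proof.
by move=> /asboolP Ix; apply/asboolP => J JM JS; apply: (JM _ _ _).1; apply: Ix.
Qed.
Fact gen_idealMr a x : x \in in_gen_ideal -> x * a \in in_gen_ideal.
Proof.
by move=> /asboolP Ix; apply/asboolP => J JM JS; apply: (JM _ _ _).2; apply: Ix.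
Qed.

Hypothesis S_proper : 1 \notin in_gen_ideal.

Definition gen_ideal : ideal A :=
  @Ideal k A (Submodule gen_ideal0 gen_idealP)
    gen_idealMl gen_idealMr S_proper.

Lemma gen_ideal_sub (x : A) : S x -> x \in in_gen_ideal.
Proof. by move=> Sx; apply/asboolP => J _; apply. Qed.

End GeneratedIdeal.

Lemma gen_ideal_properP (k : comNzRingType) (A : algType k) (S : set A)
    (I : ideal A) :
  (forall s, S s -> s \in submod_pred I) -> 1 \notin in_gen_ideal S.
Proof.
move=> SI; apply/negP => /asboolP /(_ I) I1; move/negP: (ideal_proper I); apply.
by apply: I1 => // a y Iy; split; [apply: idealMl | apply: idealMr].
Qed.

(* The algebra spanned by a set K with a partially defined associative product *)
(* (undefined products being 0) and a finite family of local units: both the   *)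
(* path algebra of a quiver with finitely many vertices and the algebra of a   *)
(* monoid are of this form.                                                    *)
Record pmonoid := PMonoid {
  pm_sort :> choiceType;
  pm_mul : pm_sort -> pm_sort -> option pm_sort;
  pm_ones : seq pm_sort;
  pm_mulA : forall x y z,
    obind (pm_mul x) (pm_mul y z) = obind (pm_mul^~ z) (pm_mul x y);
  pm_ones_uniq : uniq pm_ones;
  pm_ones_neq0 : pm_ones != [::];
  pm_mul1 : forall x, exists2 u, u \in pm_ones & pm_mul u x = Some x /\
    {in pm_ones, forall v, v != u -> pm_mul v x = None};
  pm_mulr1 : forall x, exists2 u, u \in pm_ones & pm_mul x u = Some x /\
    {in pm_ones, forall v, v != u -> pm_mul x v = None} }.

Section PMonoidAlgebra.
Variables (k : comNzRingType) (M : pmonoid).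

Definition pmalg : Type := {malg k[M]}.
HB.instance Definition _ := GRing.Lmodule.on pmalg.

(* Basis elements and products are locked, so that unification does not *)
(* unfold them.                                                         *)
Fact pmalg_key : unit. Proof. by []. Qed.
Definition pbas : M -> pmalg := locked_with pmalg_key (fun x => << x >>).
Lemma pbasE x : pbas x = << x >>. Proof. by rewrite /pbas unlock. Qed.
Definition obas (o : option M) : pmalg := if o is Some x then pbas x else 0.

Definition pmalg_one : pmalg := \sum_(u <- pm_ones M) pbas u.
Definition pmalg_mul : pmalg -> pmalg -> pmalg := locked_with pmalg_key
  (fun f g => lext (fun x => lext (fun y => obas (pm_mul x y)) g) f).

Lemma pmalg_mulE f g :
  pmalg_mul f g = lext (fun x => lext (fun y => obas (pm_mul x y)) g) f.
Proof. by rewrite /pmalg_mul unlock. Qed.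

Lemma pmalg_ind (P : pmalg -> Prop) :
  P 0 -> (forall a f g, P f -> P g -> P (a *: f + g)) ->
  (forall x, P (pbas x)) -> forall f, P f.
Proof.
by move=> P0 PD PU; apply: malg_ind => // x; have := PU x; rewrite pbasE.
Qed.

Lemma pmalg_mulPl a f g h :
  pmalg_mul (a *: f + g) h = a *: pmalg_mul f h + pmalg_mul g h.
Proof. by rewrite !pmalg_mulE; apply: linearP. Qed.

Lemma pmalg_mul0l f : pmalg_mul 0 f = 0.
Proof. by rewrite pmalg_mulE; apply: raddf0. Qed.

Lemma pmalg_mulPr a f g h :
  pmalg_mul h (a *: f + g) = a *: pmalg_mul h f + pmalg_mul h g.
Proof.
elim/pmalg_ind: h => [|b u v IHu IHv|x].
- by rewrite !pmalg_mul0l scaler0 addr0.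
- rewrite !pmalg_mulPl IHu IHv !scalerDr !scalerA [b * a]mulrC.
  exact: addrACA.
rewrite !pmalg_mulE !pbasE !lextU; exact: linearP.
Qed.

Lemma pmalg_mul0r f : pmalg_mul f 0 = 0.
Proof.
by have := pmalg_mulPr (-1) 0 0 f; rewrite scaler0 addr0 scaleN1r addNr.
Qed.

Lemma pbasM x y : pmalg_mul (pbas x) (pbas y) = obas (pm_mul x y).
Proof. by rewrite pmalg_mulE !pbasE !lextU. Qed.

Fact pmalg_mulA : associative pmalg_mul.
Proof.
move=> f g h; elim/pmalg_ind: f => [|a f f' IH IH'|x].
- by rewrite !pmalg_mul0l.
- rewrite !pmalg_mulPl IH IH'; reflexivity.
elim/pmalg_ind: g => [|a f f' IH IH'|y].
- by rewrite !(pmalg_mul0l, pmalg_mul0r).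
- rewrite !(pmalg_mulPl, pmalg_mulPr) IH IH'; reflexivity.
elim/pmalg_ind: h => [|a f f' IH IH'|z].
- by rewrite !pmalg_mul0r.
- rewrite !pmalg_mulPr IH IH'; reflexivity.
rewrite !pbasM; have := pm_mulA x y z.
case: (pm_mul y z) => [yz|]; case: (pm_mul x y) => [xy|] /= E.
- rewrite !pbasM E; reflexivity.
- rewrite pbasM E pmalg_mul0l; reflexivity.
- rewrite pbasM -E pmalg_mul0r; reflexivity.
- rewrite pmalg_mul0l pmalg_mul0r; reflexivity.
Qed.

Lemma pmalg_mulDl : left_distributive pmalg_mul +%R.
Proof. by move=> f g h; have := pmalg_mulPl 1 f g h; rewrite !scale1r. Qed.
Lemma pmalg_mulDr : right_distributive pmalg_mul +%R.
Proof. by move=> f g h; have := pmalg_mulPr 1 g h f; rewrite !scale1r. Qed.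

Fact pmalg_mul1 : left_id pmalg_one pmalg_mul.
Proof.
elim/pmalg_ind => [|a f g IH IH'|x]; first by rewrite pmalg_mul0r.
  rewrite pmalg_mulPr IH IH'; reflexivity.
rewrite /pmalg_one (big_morph (pmalg_mul^~ _) (fun f g => pmalg_mulDl f g _)
  (pmalg_mul0l _)).
have [u ones_u [ux uxN]] := pm_mul1 x.
rewrite (bigD1_seq u) ?pm_ones_uniq //= pbasM ux big_seq_cond big1 ?addr0 //.
by move=> v /andP[ones_v vu]; rewrite pbasM uxN.
Qed.

Fact pmalg_mulr1 : right_id pmalg_one pmalg_mul.
Proof.
elim/pmalg_ind => [|a f g IH IH'|x]; first by rewrite pmalg_mul0l.
  rewrite pmalg_mulPl IH IH'; reflexivity.
rewrite /pmalg_one (big_morph (pmalg_mul _) (fun f g => pmalg_mulDr _ f g)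
  (pmalg_mul0r _)).
have [u ones_u [ux uxN]] := pm_mulr1 x.
rewrite (bigD1_seq u) ?pm_ones_uniq //= pbasM ux big_seq_cond big1 ?addr0 //.
by move=> v /andP[ones_v vu]; rewrite pbasM uxN.
Qed.

Fact pmalg_one_neq0 : pmalg_one != 0.
Proof.
have := pm_ones_uniq M; have := pm_ones_neq0 M; rewrite /pmalg_one.
case: (pm_ones M) => // u s _ /= /andP[us _]; apply/eqP => /(congr1 (mcoeff u)).
rewrite big_cons mcoeffD pbasE mcoeffUU raddf_sum big_seq big1 => [|v sv].
  by rewrite mcoeff0 addr0; apply/eqP/oner_neq0.
by rewrite /= pbasE mcoeffU; case: eqP us sv => // <- /negP.
Qed.

HB.instance Definition _ := GRing.Zmodule_isNzRing.Build pmalg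
  pmalg_mulA pmalg_mul1 pmalg_mulr1 pmalg_mulDl pmalg_mulDr pmalg_one_neq0.

Fact pmalg_scaleAl a (f g : pmalg) : a *: (f * g) = a *: f * g.
Proof.
have := pmalg_mulPl a f 0 g; rewrite addr0 pmalg_mul0l addr0 => E.
exact: (esym E).
Qed.
HB.instance Definition _ :=
  GRing.Lmodule_isLalgebra.Build k pmalg pmalg_scaleAl.
Fact pmalg_scaleAr a (f g : pmalg) : a *: (f * g) = f * (a *: g).
Proof.
have := pmalg_mulPr a g 0 f; rewrite addr0 pmalg_mul0r addr0 => E.
exact: (esym E).
Qed.
HB.instance Definition _ :=
  GRing.Lalgebra_isAlgebra.Build k pmalg pmalg_scaleAr.

End PMonoidAlgebra.

Record quiver := Quiver {
  vert : finType;
  arr : finType;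
  src : arr -> vert;
  tgt : arr -> vert;
  vert_gt0 : (0 < #|vert|)%N }.

Section Paths.
Variable Q : quiver.

Fixpoint walk (v : vert Q) (s : seq (arr Q)) : bool :=
  if s is a :: s' then (src a == v) && walk (tgt a) s' else true.
Fixpoint walk_end (v : vert Q) (s : seq (arr Q)) : vert Q :=
  if s is a :: s' then walk_end (tgt a) s' else v.

Lemma walk_cat v s t : walk v (s ++ t) = walk v s && walk (walk_end v s) t.
Proof. by elim: s v => //= a s IH v; rewrite IH andbA. Qed.
Lemma walk_end_cat v s t : walk_end v (s ++ t) = walk_end (walk_end v s) t.
Proof. by elim: s v => //=. Qed.

Definition qpath := {p : vert Q * seq (arr Q) | walk p.1 p.2}.
HB.instance Definition _ := Choice.on qpath.

Definition pstart (p : qpath) : vert Q := (val p).1.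
Definition parrows (p : qpath) : seq (arr Q) := (val p).2.
Definition pend (p : qpath) : vert Q := walk_end (pstart p) (parrows p).

Definition ptriv (v : vert Q) : qpath := exist _ (v, [::]) isT.
Fact parr_subproof (a : arr Q) : walk (src a) [:: a].
Proof. by rewrite /= eqxx. Qed.
Definition parr (a : arr Q) : qpath := exist _ (src a, [:: a]) (parr_subproof a).

(* Paths compose from left to right: first p, then q. *)
Definition pcomp (p q : qpath) : option qpath :=
  if pend p == pstart q
  then (insub (pstart p, parrows p ++ parrows q) : option qpath) else None.

Lemma qpath_inj p q : pstart p = pstart q -> parrows p = parrows q -> p = q.
Proof.
rewrite /pstart /parrows => E F; apply: val_inj.
by rewrite [LHS]surjective_pairing [RHS]surjective_pairing E F.
Qed.

Lemma pcompP p q r : reflect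
  [/\ pend p = pstart q, pstart r = pstart p & parrows r = parrows p ++ parrows q]
  (pcomp p q == Some r).
Proof.
rewrite /pcomp; case: (pend p =P pstart q) => [E|N]; last first.
  by apply: (iffP idP) => // -[].
have W : walk (pstart p) (parrows p ++ parrows q).
  by rewrite walk_cat (valP p) -/(pend p) E (valP q).
rewrite insubT /=; apply: (iffP eqP) => [[<-] //|[_ Es Ea]].
by congr Some; apply: qpath_inj; rewrite ?Es ?Ea.
Qed.

Lemma pcomp_None p q : pend p != pstart q -> pcomp p q = None.
Proof. by rewrite /pcomp => /negbTE ->. Qed.

Lemma pcomp_Some p q : pend p = pstart q -> exists r, pcomp p q = Some r.
Proof.
rewrite /pcomp => E; rewrite E eqxx insubT; last by eexists.
by rewrite /= walk_cat (valP p) -/(pend p) E (valP q).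
Qed.

Lemma pcomp_end p q r : pcomp p q = Some r ->
  [/\ pend p = pstart q, pstart r = pstart p,
      parrows r = parrows p ++ parrows q & pend r = pend q].
Proof.
move=> /eqP /pcompP [E Es Ea]; split=> //.
by rewrite /pend Es Ea walk_end_cat -/(pend p) E.
Qed.

Fact pcompA p q r :
  obind (pcomp p) (pcomp q r) = obind (pcomp^~ r) (pcomp p q).
Proof.
case Eqr: (pcomp q r) => [qr|]; case Epq: (pcomp p q) => [pq|] //=.
- have [E1 E2 E3 _] := pcomp_end Eqr; have [F1 F2 F3 F4] := pcomp_end Epq.
  have [s Es] : exists s, pcomp p qr = Some s by apply: pcomp_Some; rewrite E2.
  rewrite Es; apply/esym/eqP/pcompP.
  have [_ G2 G3 _] := pcomp_end Es.
  by rewrite F4 F2 F3 G2 G3 E3 catA.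
- have [_ E2 _ _] := pcomp_end Eqr.
  apply: pcomp_None; rewrite E2; apply/eqP => /pcomp_Some [t].
  by rewrite Epq.
have [_ _ _ F4] := pcomp_end Epq.
apply/esym; apply: pcomp_None; rewrite F4; apply/eqP => /pcomp_Some [t].
by rewrite Eqr.
Qed.

Definition ptrivs := [seq ptriv v | v <- enum (vert Q)].

Fact ptrivs_uniq : uniq ptrivs.
Proof. by rewrite map_inj_uniq ?enum_uniq // => v w [->]. Qed.
Fact ptrivs_neq0 : ptrivs != [::].
Proof. by rewrite -size_eq0 size_map -cardE -lt0n vert_gt0. Qed.
Fact ptriv_mul p : exists2 u, u \in ptrivs & pcomp u p = Some p /\
  {in ptrivs, forall v, v != u -> pcomp v p = None}.
Proof.
exists (ptriv (pstart p)); first by apply: map_f; rewrite mem_enum.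
split; first by apply/eqP/pcompP.
move=> _ /mapP[v _ ->] N; apply: pcomp_None.
by apply: contraNneq N => <-.
Qed.
Fact mul_ptriv p : exists2 u, u \in ptrivs & pcomp p u = Some p /\
  {in ptrivs, forall v, v != u -> pcomp p v = None}.
Proof.
exists (ptriv (pend p)); first by apply: map_f; rewrite mem_enum.
split; first by apply/eqP/pcompP; rewrite cats0.
move=> _ /mapP[v _ ->] N; apply: pcomp_None.
by apply: contraNneq N => ->.
Qed.

Definition path_pmonoid := @PMonoid qpath pcomp ptrivs pcompA
  ptrivs_uniq ptrivs_neq0 ptriv_mul mul_ptriv.

End Paths.

Section PathAlgebra.
Variables (k : comNzRingType) (Q : quiver).

Definition pathalg : Type := pmalg k (path_pmonoid Q).
HB.instance Definition _ := GRing.Algebra.on pathalg.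

Definition path_el (p : qpath Q) : pathalg := @pbas k (path_pmonoid Q) p.

Lemma pathalg_ind (P : pathalg -> Prop) :
  P 0 -> (forall a f g, P f -> P g -> P (a *: f + g)) ->
  (forall p, P (path_el p)) -> forall f, P f.
Proof. exact: pmalg_ind. Qed.

Lemma path_elM (p q : qpath Q) :
  path_el p * path_el q = if pcomp p q is Some r then path_el r else 0.
Proof. exact: pbasM. Qed.

End PathAlgebra.

Definition double (Q : quiver) : quiver := @Quiver (vert Q) (arr Q * bool)%type
  (fun b => if b.2 then tgt b.1 else src b.1)
  (fun b => if b.2 then src b.1 else tgt b.1) (vert_gt0 Q).

Section Preprojective.
Variables (k : comNzRingType) (Q : quiver).
Local Notation kQQ := (pathalg k (double Q)).

Definition arrow (a : arr Q) : kQQ := path_el k (@parr (double Q) (a, false)).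
Definition arrow_star (a : arr Q) : kQQ :=
  path_el k (@parr (double Q) (a, true)).

Definition preproj_rel : kQQ :=
  \sum_(a : arr Q) arrow a * arrow_star a
    - \sum_(a : arr Q) arrow_star a * arrow a.

Definition path_coef (p : qpath (double Q)) (f : kQQ) : k := mcoeff p f.

Lemma path_coefP p a f g :
  path_coef p (a *: f + g) = a * path_coef p f + path_coef p g.
Proof. by rewrite /path_coef mcoeffD mcoeffZ. Qed.
Lemma path_coef0 p : path_coef p 0 = 0.
Proof. exact: mcoeff0. Qed.
Lemma path_coefU p q : path_coef p (path_el k q) = (q == p)%:R.
Proof. by rewrite /path_coef /path_el pbasE mcoeffU. Qed.

Lemma triv_coefM v (f g : kQQ) : path_coef (ptriv v) (f * g) =
  path_coef (ptriv v) f * path_coef (ptriv v) g.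
Proof.
elim/pathalg_ind: f => [|a f f' IH IH'|p].
- by rewrite mul0r path_coef0 mul0r.
- by rewrite mulrDl -scalerAl !path_coefP IH IH' mulrDl mulrA.
elim/pathalg_ind: g => [|a f f' IH IH'|q].
- by rewrite mulr0 path_coef0 mulr0.
- by rewrite mulrDr -scalerAr !path_coefP IH IH' mulrDr mulrCA.
rewrite path_elM !path_coefU -natrM mulnb; case E: (pcomp p q) => [r|]; last first.
  rewrite path_coef0; case: eqP => [Ep|_] //=; case: eqP => [Eq|_] //=.
  by move: E; rewrite Ep Eq /pcomp eqxx insubT.
rewrite path_coefU; congr (nat_of_bool _)%:R.
have [E1 E2 E3 _] := pcomp_end E.
apply/eqP/andP => [Er|[/eqP Ep /eqP Eq]].
  have : parrows r = [::] by rewrite Er.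
  rewrite E3; case Fp: (parrows p) => //= Fq.
  have Sp : pstart p = v by rewrite -E2 Er.
  split; apply/eqP; apply: qpath_inj => //=.
  by rewrite -E1 /pend Fp /= Sp.
by apply: qpath_inj; rewrite ?E2 ?E3 Ep ?Eq.
Qed.

Fact preproj_proper : 1 \notin in_gen_ideal [set preproj_rel].
Proof.
pose v : vert (double Q) := enum_val (Ordinal (vert_gt0 Q)).
pose P := [pred f : kQQ | path_coef (ptriv v) f == 0].
have P0 : 0 \in P by rewrite inE path_coef0.
have PP a x y : x \in P -> y \in P -> a *: x + y \in P.
  by rewrite !inE path_coefP => /eqP-> /eqP->; rewrite mulr0 addr0.
have PMl a x : x \in P -> a * x \in P.
  by rewrite !inE triv_coefM => /eqP->; rewrite mulr0.
have PMr a x : x \in P -> x * a \in P.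
  by rewrite !inE triv_coefM => /eqP->; rewrite mul0r.
have P1 : 1 \notin P.
  have := triv_coefM v (path_el k (ptriv v)) 1.
  rewrite mulr1 path_coefU eqxx mul1r inE => <-; exact: oner_neq0.
apply: (@gen_ideal_properP k _ _ (@Ideal k _ (Submodule P0 PP) PMl PMr P1)).
move=> _ ->; change (preproj_rel \in P).
have arrP b : path_el k (@parr (double Q) b) \in P.
  rewrite inE path_coefU; case: (parr b =P _) => [E|]; last by rewrite eqxx.
  by have := congr1 (@parrows _) E.
have sumP (F : arr Q -> kQQ) : (forall a, F a \in P) -> \sum_a F a \in P.
  move=> PF; apply: (big_ind (fun x => x \in P)) => // x y Px Py.
  by rewrite -[x]scale1r PP.
rewrite /preproj_rel addrC -scaleN1r.
by apply: PP; apply: sumP => a; apply: PMr; apply: arrP.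
Qed.

Definition preproj_ideal : ideal kQQ := gen_ideal preproj_proper.

Definition preproj : Type := quotalg preproj_ideal.
HB.instance Definition _ := GRing.Algebra.on preproj.

Definition preproj_pi : kQQ -> preproj := @quotalg_pi _ _ preproj_ideal.

Definition vertex_el (v : vert Q) : preproj :=
  preproj_pi (path_el k (@ptriv (double Q) v)).

(* The image of the span of the paths of length j. *)
Definition graded_part (j : nat) : set preproj :=
  preproj_pi @` [set f : kQQ | forall p, p \in msupp f -> size (parrows p) = j].

Definition graded_automorphism (g : {lrmorphism preproj -> preproj}) : Prop :=
  bijective g /\ forall j, (g @` graded_part j = graded_part j)%classic.

Record finite_graded_aut_group
    (G : set {lrmorphism preproj -> preproj}) : Prop := {
  gag_finite : finite_set G;
  gag_graded : forall g, G g -> graded_automorphism g;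
  gag_id : G (idfun : {lrmorphism preproj -> preproj});
  gag_comp : forall g h, G g -> G h ->
    G (g \o h : {lrmorphism preproj -> preproj});
  gag_inv : forall g, G g -> exists2 h, G h & cancel g h /\ cancel h g }.

End Preprojective.

(* The extended Dynkin quiver of type A_m: a cyclically oriented cycle with *)
(* m.+1 vertices, ordS being the successor modulo m.+1.                     *)
Definition Atilde (m : nat) : quiver :=
  @Quiver 'I_m.+1 'I_m.+1 id (@ordS m.+1)
    (eq_ind_r (fun c => (0 < c)%N) (ltn0Sn m) (card_ord m.+1)).

Section FixedRing.
Variables (k : comNzRingType) (A : algType k) (G : set {lrmorphism A -> A}).

Definition fixed_pred : {pred A} := [pred a | `[< forall g, G g -> g a = a >]].

Fact fixed_subalg_closed : subalg_closed fixed_pred.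
Proof.
split=> [|c x y /asboolP Fx /asboolP Fy|x y /asboolP Fx /asboolP Fy];
  apply/asboolP => g Gg.
- by rewrite rmorph1.
- by rewrite linearP; congr (_ *: _ + _); [apply: Fx | apply: Fy].
- by rewrite rmorphM; congr (_ * _); [apply: Fx | apply: Fy].
Qed.

HB.instance Definition _ :=
  GRing.isSubalgClosed.Build k A fixed_pred fixed_subalg_closed.

Definition fixedring := {a : A | a \in fixed_pred}.
HB.instance Definition _ := SubChoice.on fixedring.
HB.instance Definition _ := [SubChoice_isSubAlgebra of fixedring by <:].

End FixedRing.

(* Right R-modules are modules over the converse ring R^c; here A is a right *)
(* B-module through x b = x * f b.                                           *)
Definition right_restr (B A : nzRingType) (f : {rmorphism B -> A}) : Type := A.

Section RestrictionRight.
Variables (B A : nzRingType) (f : {rmorphism B -> A}).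
Local Notation rightres := (right_restr f).

HB.instance Definition _ := GRing.Zmodule.on rightres.

Definition rr_scale (b : B^c) (x : rightres) : rightres := (x : A) * f b.

Fact rr_scaleA a b x : rr_scale a (rr_scale b x) = rr_scale (a * b) x.
Proof. by rewrite /rr_scale -mulrA -rmorphM. Qed.
Fact rr_scale1 : left_id 1 rr_scale.
Proof. by move=> x; rewrite /rr_scale rmorph1 mulr1. Qed.
Fact rr_scaleDr : right_distributive rr_scale +%R.
Proof. by move=> a x y; apply: mulrDl. Qed.
Fact rr_scaleDl x : {morph rr_scale^~ x : a b / a + b}.
Proof. by move=> a b; rewrite /rr_scale rmorphD mulrDr. Qed.

HB.instance Definition _ := GRing.Zmodule_isLmodule.Build B^c rightres
  rr_scaleA rr_scale1 rr_scaleDr rr_scaleDl.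

End RestrictionRight.

Definition over_fixedring (k : comNzRingType) (A : algType k)
    (G : set {lrmorphism A -> A}) : lmodType (fixedring G)^c :=
  @right_restr (fixedring G) A (val : fixedring G -> A).

Section HomologicalAlgebra.
Variable R : nzRingType.

Definition projective (P : lmodType R) : Prop :=
  forall (M N : lmodType R) (g : {linear M -> N}) (f : {linear P -> N}),
    (forall y, exists x, g x = y) ->
    exists h : {linear P -> M}, forall x, g (h x) = f x.

Definition fin_gen (M : lmodType R) : Prop :=
  exists (n : nat) (s : 'I_n -> M),
    forall x, exists c : 'I_n -> R, x = \sum_(i < n) c i *: s i.

Record resolution (M : lmodType R) := Resolution {
  res_term :> nat -> lmodType R;
  res_diff : forall i, {linear res_term i.+1 -> res_term i};
  res_aug : {linear res_term 0 -> M};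
  res_aug_surj : forall y, exists x, res_aug x = y;
  res_exact0 : forall x, res_aug x = 0 <-> exists y, res_diff 0 y = x;
  res_exactS : forall i x,
    res_diff i x = 0 <-> exists y, res_diff i.+1 y = x }.

Definition projective_resolution M (P : resolution M) : Prop :=
  forall i, projective (P i).

Definition res_length_le M (P : resolution M) (d : nat) : Prop :=
  forall i, (d < i)%N -> forall x : P i, x = 0.

Definition pdim_le (M : lmodType R) (d : nat) : Prop :=
  exists2 P : resolution M, projective_resolution P & res_length_le P d.

Section Kernel.
Variables (U V : lmodType R) (f : {linear U -> V}).
Definition ker_pred : {pred U} := [pred x | f x == 0].
Fact ker_submod_closed : submod_closed ker_pred.
Proof.
split=> [|a x y]; rewrite !inE ?raddf0 // => /eqP fx /eqP fy.
by rewrite linearP fx fy scaler0 addr0.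
Qed.
HB.instance Definition _ :=
  GRing.isSubmodClosed.Build R U ker_pred ker_submod_closed.
Definition kermod := {x : U | x \in ker_pred}.
HB.instance Definition _ := SubChoice.on kermod.
HB.instance Definition _ := [SubChoice_isSubLmodule of kermod by <:].
End Kernel.

(* The standard free resolution of M: its i-th term is the free module on the *)
(* set std_syz M i, where std_syz M 0 = M and std_syz M i.+1 is the kernel of *)
(* the canonical surjection {malg R[std_syz M i]} -> std_syz M i.             *)
Definition std_free (N : lmodType R) : lmodType R := {malg R[N]}.
Definition std_cover (N : lmodType R) : {linear std_free N -> N} :=
  @lext R N N id.

Fixpoint std_syz (M : lmodType R) (i : nat) : lmodType R :=
  if i is j.+1 then kermod (std_cover (std_syz M j)) else M.

Definition std_term M i : lmodType R := std_free (std_syz M i).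
Definition std_diff M i : {linear std_term M i.+1 -> std_term M i} :=
  (val : kermod (std_cover (std_syz M i)) -> std_free (std_syz M i))
    \o std_cover (std_syz M i.+1).

(* Ext^i_R(M, R), the cohomology of the complex Hom_R(P, R) for the standard *)
(* free resolution P of M, a right R-module through (f r)(x) = f(x) r.       *)
Section Ext.
Variables (M : lmodType R) (i : nat).
Local Notation P := (std_term M).
Local Notation d := (std_diff M).

Definition cochain (j : nat) : Type := P j -> (R^c)^o.
HB.instance Definition _ j := GRing.Lmodule.on (cochain j).

Lemma cochainE j (r : R^c) (f g : cochain j) (x : P j) :
  (r *: f + g) x = ((f x : R) * (r : R) + (g x : R) : R) :> R.
Proof. by []. Qed.

Definition cocycle_pred : {pred cochain i} := [pred f : P i -> R | `[<
  (forall a x y, f (a *: x + y) = a * f x + f y)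
  /\ forall x, f (d i x) = 0 >]].

Fact cocycle_submod_closed : submod_closed cocycle_pred.
Proof.
split=> [|r f g /asboolP[fL fd] /asboolP[gL gd]]; apply/asboolP; split=> //=.
- by move=> a x y; rewrite mulr0 addr0.
- move=> a x y; rewrite cochainE fL gL !cochainE.
  by rewrite mulrDl mulrDr mulrA addrACA.
- by move=> x; rewrite cochainE fd gd mul0r addr0.
Qed.
HB.instance Definition _ := GRing.isSubmodClosed.Build
  R^c (cochain i) cocycle_pred cocycle_submod_closed.
Definition cocycle := {f : cochain i | f \in cocycle_pred}.
HB.instance Definition _ := SubChoice.on cocycle.
HB.instance Definition _ := [SubChoice_isSubLmodule of cocycle by <:].

Definition is_coboundary (i : nat) : cochain i -> Prop :=
  if i is j.+1 return cochain i -> Prop then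
    fun f => exists2 g : P j -> R,
      (forall a x y, g (a *: x + y) = a * g x + g y) &
      forall x, f x = g (d j x)
  else fun f => f = 0.

Definition coboundary_pred : {pred cocycle} :=
  [pred f | `[< is_coboundary (val f) >]].

Lemma is_coboundary0 j : is_coboundary (0 : cochain j).
Proof.
case: j => // j; exists (fun=> 0) => // a x y.
by rewrite mulr0 addr0.
Qed.

Lemma is_coboundaryP j (r : R^c) (u v : cochain j) :
  is_coboundary u -> is_coboundary v -> is_coboundary (r *: u + v).
Proof.
case: j u v => [|j] u v /=; first by move=> -> ->; rewrite scaler0 addr0.
move=> [u' u'L uE] [v' v'L vE].
exists (fun x => u' x * (r : R) + v' x) => [a x y|x].
  by rewrite u'L v'L mulrDl mulrDr mulrA addrACA.
by rewrite cochainE uE vE.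
Qed.

Fact coboundary0 : 0 \in coboundary_pred.
Proof. by apply/asboolP; rewrite raddf0; apply: is_coboundary0. Qed.

Fact coboundaryP (r : R^c) (f g : cocycle) :
  f \in coboundary_pred -> g \in coboundary_pred ->
  r *: f + g \in coboundary_pred.
Proof.
move=> /asboolP Bf /asboolP Bg; apply/asboolP; rewrite linearP.
exact: is_coboundaryP.
Qed.

Definition coboundary : submodule cocycle := Submodule coboundary0 coboundaryP.

Definition Ext : lmodType R^c := quotmod coboundary.

End Ext.

End HomologicalAlgebra.

Section GlobalDimension.
Variable R : nzRingType.

Definition gldim_le (d : nat) : Prop := forall M : lmodType R^c, pdim_le M d.

(* The global dimension (of the category of right modules), None standing for *)
(* infinity.                                                                  *)
Definition gldim : option nat :=
  if pselect (exists d, `[< gldim_le d >]) is left ex then Some (ex_minn ex)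
  else None.

End GlobalDimension.

Section Enveloping.
Variables (k : comNzRingType) (B : algType k).

(* B (x) B^op is the algebra of the multiplicative monoid B x B^op modulo     *)
(* bilinearity; the ideal generated by the bilinearity relations is their     *)
(* linear span, since they are stable under products with basis elements.     *)
Definition env_mul (p q : B * B) : option (B * B) :=
  Some (p.1 * q.1, q.2 * p.2).

Fact env_mulA p q r :
  obind (env_mul p) (env_mul q r) = obind (env_mul^~ r) (env_mul p q).
Proof. by rewrite /env_mul /= !mulrA. Qed.
Fact env_mul1 p : exists2 u, u \in [:: (1, 1)] & env_mul u p = Some p /\
  {in [:: (1, 1)], forall v, v != u -> env_mul v p = None}.
Proof.
exists (1, 1); rewrite ?mem_head // /env_mul mul1r mulr1; split; first by case: p.
by move=> v; rewrite inE => /eqP-> /eqP.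
Qed.
Fact env_mulr1 p : exists2 u, u \in [:: (1, 1)] & env_mul p u = Some p /\
  {in [:: (1, 1)], forall v, v != u -> env_mul p v = None}.
Proof.
exists (1, 1); rewrite ?mem_head // /env_mul mul1r mulr1; split; first by case: p.
by move=> v; rewrite inE => /eqP-> /eqP.
Qed.

Definition env_pmonoid : pmonoid := @PMonoid (B * B)%type env_mul [:: (1, 1)]
  env_mulA isT isT env_mul1 env_mulr1.

Local Notation free := (pmalg k env_pmonoid).
Definition env_bas (a b : B) : free := @pbas k env_pmonoid (a, b).

Lemma env_basM a b a' b' :
  env_bas a b * env_bas a' b' = env_bas (a * a') (b' * b).
Proof. exact: (@pbasM k env_pmonoid (a, b) (a', b')). Qed.

Variant env_rel : free -> Prop :=
| EnvDl a a' b : env_rel (env_bas (a + a') b - (env_bas a b + env_bas a' b))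
| EnvDr a b b' : env_rel (env_bas a (b + b') - (env_bas a b + env_bas a b'))
| EnvZl c a b : env_rel (env_bas (c *: a) b - c *: env_bas a b)
| EnvZr c a b : env_rel (env_bas a (c *: b) - c *: env_bas a b).

Definition env_act (z : free) (x : B) : B :=
  lext (fun p : B * B => p.1 * x * p.2) z.

Lemma env_actU a b x : env_act (env_bas a b) x = a * x * b.
Proof. by rewrite /env_act /env_bas pbasE lextU. Qed.
Lemma env_actP c z w x : env_act (c *: z + w) x = c *: env_act z x + env_act w x.
Proof. exact: linearP. Qed.
Lemma env_act0 x : env_act 0 x = 0.
Proof. exact: raddf0. Qed.
Lemma env_actD z w x : env_act (z + w) x = env_act z x + env_act w x.
Proof. by have := env_actP 1 z w x; rewrite !scale1r. Qed.
Lemma env_actZ c z x : env_act (c *: z) x = c *: env_act z x.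
Proof. by have := env_actP c z 0 x; rewrite env_act0 !addr0. Qed.
Lemma env_actN z x : env_act (- z) x = - env_act z x.
Proof. by rewrite -scaleN1r env_actZ scaleN1r. Qed.

Lemma env_act_additive z x y : env_act z (x + y) = env_act z x + env_act z y.
Proof.
elim/pmalg_ind: z => [|c z w IHz IHw|[a b]]; rewrite ?env_act0 ?addr0 //.
  by rewrite !env_actP IHz IHw scalerDr addrACA.
by rewrite !(env_actU a b) mulrDr mulrDl.
Qed.
Lemma env_act_scale z c x : env_act z (c *: x) = c *: env_act z x.
Proof.
elim/pmalg_ind: z => [|d z w IHz IHw|[a b]]; rewrite ?env_act0 ?scaler0 //.
  by rewrite !env_actP IHz IHw scalerDr !scalerA [d * c]mulrC.
by rewrite !(env_actU a b) -scalerAr -scalerAl.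
Qed.

Lemma env_actM z w x : env_act (z * w) x = env_act z (env_act w x).
Proof.
elim/pmalg_ind: z => [|c z z' IH IH'|[a b]].
- by rewrite mul0r !env_act0.
- by rewrite mulrDl -scalerAl !env_actP IH IH'.
elim/pmalg_ind: w => [|c w w' IH IH'|[a' b']].
- by rewrite mulr0 !env_act0 (env_actU a b) mulr0 mul0r.
- by rewrite mulrDr -scalerAr !env_actP IH IH' env_act_additive env_act_scale.
by rewrite -!/(env_bas _ _) env_basM !env_actU !mulrA.
Qed.

Lemma env_act1 x : env_act 1 x = x.
Proof.
have -> : 1 = env_bas 1 1 by rewrite /env_bas [LHS]big_seq1.
by rewrite env_actU mul1r mulr1.
Qed.

Definition env_annihilator : {pred free} :=
  [pred z | `[< forall x, env_act z x = 0 >]].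

Fact env_ann0 : 0 \in env_annihilator.
Proof. by apply/asboolP => x; rewrite env_act0. Qed.
Fact env_annP c z w : z \in env_annihilator -> w \in env_annihilator ->
  c *: z + w \in env_annihilator.
Proof.
move=> /asboolP Az /asboolP Aw; apply/asboolP => x.
by rewrite env_actP Az Aw scaler0 addr0.
Qed.
Fact env_annMl z w : w \in env_annihilator -> z * w \in env_annihilator.
Proof.
move=> /asboolP Aw; apply/asboolP => x; rewrite env_actM Aw.
by have := env_act_scale z 0 0; rewrite !scale0r.
Qed.
Fact env_annMr z w : w \in env_annihilator -> w * z \in env_annihilator.
Proof. by move=> /asboolP Aw; apply/asboolP => x; rewrite env_actM. Qed.
Fact env_ann1 : 1 \notin env_annihilator.
Proof.
apply/negP => /asboolP /(_ 1); rewrite env_act1 => /eqP.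
by apply/negP; apply: oner_neq0.
Qed.
Definition env_ann_ideal : ideal free :=
  @Ideal k free (Submodule env_ann0 env_annP) env_annMl env_annMr env_ann1.

Fact env_rel_ann z : env_rel z -> z \in submod_pred env_ann_ideal.
Proof.
case=> *; apply/asboolP => x; apply/eqP;
  rewrite env_actD env_actN ?env_actD ?env_actZ !env_actU subr_eq0; apply/eqP.
- by rewrite !mulrDl.
- by rewrite mulrDr.
- by rewrite -!scalerAl.
- by rewrite -scalerAr.
Qed.

Definition env_ideal : ideal free := gen_ideal (gen_ideal_properP env_rel_ann).

(* B^e = B (x) B^op over k. A k-central (B,B)-bimodule is a left B^e-module, *)
(* with b m b' = (b (x) b') m.                                               *)
Definition env : Type := quotalg env_ideal.
HB.instance Definition _ := GRing.Algebra.on env.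

Definition tens (a b : B) : env := @quotalg_pi _ _ env_ideal (env_bas a b).

Lemma env_act_pi z w :
  quotalg_pi env_ideal z = quotalg_pi env_ideal w -> env_act z =1 env_act w.
Proof.
move=> /qpi_eq /asboolP /(_ env_ann_ideal) H x; apply/eqP.
rewrite -subr_eq0 -env_actN -env_actD; apply/eqP; move: x; apply/asboolP.
apply: H; last exact: env_rel_ann.
by move=> a y Iy; split; [apply: env_annMl | apply: env_annMr].
Qed.

Definition regbim : Type := B.
HB.instance Definition _ := GRing.Zmodule.on regbim.

Definition regbim_scale (z : env) (x : regbim) : regbim := env_act (qrepr z) x.

Lemma regbim_scaleE z x : regbim_scale (quotalg_pi env_ideal z) x = env_act z x.
Proof. by apply: env_act_pi; apply: quotalg_surj. Qed.

Fact regbim_scaleA z w x : regbim_scale z (regbim_scale w x) =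
  regbim_scale (z * w) x.
Proof.
rewrite -[z]quotalg_surj -[w]quotalg_surj -rmorphM !regbim_scaleE.
by rewrite env_actM.
Qed.
Fact regbim_scale1 : left_id 1 regbim_scale.
Proof.
move=> x; rewrite -(rmorph1 (quotalg_pi env_ideal)) regbim_scaleE.
exact: env_act1.
Qed.
Fact regbim_scaleDr : right_distributive regbim_scale +%R.
Proof. by move=> z x y; apply: env_act_additive. Qed.
Fact regbim_scaleDl x : {morph regbim_scale^~ x : z w / z + w}.
Proof.
move=> z w; rewrite -[z]quotalg_surj -[w]quotalg_surj -raddfD !regbim_scaleE.
exact: env_actD.
Qed.

HB.instance Definition _ := GRing.Zmodule_isLmodule.Build env regbim
  regbim_scaleA regbim_scale1 regbim_scaleDr regbim_scaleDl.

Lemma tensM a b a' b' : tens a b * tens a' b' = tens (a * a') (b' * b).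
Proof. by rewrite /tens -env_basM; apply: quotalg_piM. Qed.

Lemma regbim_tens a b (x : regbim) : tens a b *: x = a * (x : B) * b.
Proof. by rewrite -env_actU; apply: regbim_scaleE. Qed.

Definition lact (M : lmodType env) (b : B) (m : M) : M := tens b 1 *: m.
Definition ract (M : lmodType env) (m : M) (b : B) : M := tens 1 b *: m.

Definition biadditive (U V W : zmodType) (t : U -> V -> W) : Prop :=
  (forall u u' v, t (u + u') v = t u v + t u' v) /\
  (forall u v v', t u (v + v') = t u v + t u v').

Definition balanced (U V : lmodType env) (W : zmodType) (t : U -> V -> W)
  : Prop := forall u b v, t (ract u b) v = t u (lact b v).

(* T, with the map t, is the tensor product of the bimodules U and V over B. *)
Record is_tensor (U V T : lmodType env) (t : U -> V -> T) : Prop := {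
  tensor_biadditive : biadditive t;
  tensor_balanced : balanced t;
  tensor_lact : forall b u v, t (lact b u) v = lact b (t u v);
  tensor_ract : forall b u v, t u (ract v b) = ract (t u v) b;
  tensor_univ : forall (W : zmodType) (s : U -> V -> W),
    biadditive s -> balanced s ->
    exists2 f : {additive T -> W}, (forall u v, f (t u v) = s u v) &
      forall f' : {additive T -> W},
        (forall u v, f' (t u v) = s u v) -> f' =1 f }.

Definition invertible_bimodule (U : lmodType env) : Prop :=
  exists V : lmodType env,
    (exists t : U -> V -> regbim, is_tensor t) /\
    (exists t : V -> U -> regbim, is_tensor t).

Definition CY1 : Prop := exists P : resolution (regbim : lmodType env),
  (forall i, projective (P i) /\ fin_gen (P i)) /\
  exists N, res_length_le P N.

(* A right B^e-module E is a bimodule with b e a = e (a (x) b). *)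
Definition right_env_iso (E : lmodType env^c) (U : lmodType env) : Prop :=
  exists f : {additive E -> U}, bijective f /\
    forall (a b : B) (e : E), f ((tens a b : env^c) *: e) = tens b a *: f e.

Definition CY2 (d : nat) : Prop :=
  exists2 U : lmodType env, invertible_bimodule U &
    (forall i, i <> d -> forall e : Ext (regbim : lmodType env) i, e = 0) /\
    right_env_iso (Ext (regbim : lmodType env) d) U.

Definition twistedCY_dim (d : nat) : Prop := CY1 /\ CY2 d.

Definition twistedCY : Prop := exists d, twistedCY_dim d.

End Enveloping.

(* Main.v *)
(* The monomials e_i x^p y^q, where x and y are the sums of the arrows alpha_i   *)
(* and alpha_i^*, form a basis of A, and G acts diagonally on it, so that A^G is *)
(* spanned by the invariant monomials.  Because G is finite, some x^N and y^N    *)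
(* are central and invariant.  Each of the three conditions is equivalent to     *)
(* rectangularity: if e_i x^p y^q is invariant, then so are e_i x^p and e_i y^q. *)
(* If this fails at e_i x^p y^q, explicit relations between invariant monomials  *)
(* produce a second syzygy of A^G that is not projective, and show that A is not *)
(* projective over A^G.  If it holds, then A^G is again an algebra of the same   *)
(* kind, with x and y replaced by first-return monomials, hence has a Koszul     *)
(* bimodule resolution of length 2 with an invertible dualizing bimodule, and A  *)
(* is a finite sum of modules m A^G, each isomorphic to some e_j A^G.            *)
(* Finally, let A^G be twisted Calabi-Yau of dimension d.  If d > 2, then        *)
(* Ext^1 and Ext^2 of the bimodule A^G vanish; by Rees' theorem for the regular  *)
(* sequence z (x) 1 - 1 (x) z, z = x^N, y^N, so does Hom(A^G, E/(z1, z2)), where *)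
(* E is the enveloping algebra.  But this Hom contains the class of a Casimir    *)
(* element, which is nonzero because its image under multiplication is not 0 in  *)
(* characteristic 0.  So d <= 2, and the vanishing of Ext^i for i > 2 bounds the *)
(* projective dimension of the bimodule A^G, hence the global dimension.         *)
Require Import Defs.
From HB Require Import structures.
From mathcomp Require Import all_boot all_algebra fingroup perm zify.
From mathcomp Require Import generic_quotient ring_quotient finmap.
From mathcomp.multinomials Require Import monalg.
From mathcomp Require Import boolp classical_sets functions cardinality.

Set Implicit Arguments.
Unset Strict Implicit.
Unset Printing Implicit Defensive.

Import GRing.Theory.
Local Open Scope ring_scope.

(** * Projective dimension *)

(** Let x and y be the sums of the arrows alpha_i and of the starred arrows. The preprojective
    relations say that x y = y x, so A is a skew version of k[x, y]: it has the basis e_i x^p y^q,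
    where x moves the vertex forward and y moves it back ([preproj_monomial]). For n >= 3 the double
    quiver has at most one arrow from a given vertex to another, so a graded automorphism fixing the
    vertices scales every arrow, hence every monomial ([graded_diagonal]). Thus A^G is spanned by
    invariant monomials, and if two of two monomials and their nonzero product are invariant, so is
    the third ([F_mul], [F_divl], [F_divr]). As G is finite, there is an N such that x^N and y^N are
    central and all e_s x^N, e_s y^N are invariant ([central_period_exists]).

    Every condition of the theorem is compared with rectangularity: when e_s x^p y^q is invariant,
    so are e_s x^p and e_s y^q.

    Rectangularity is sufficient. The invariant powers of x along a walk are the successive returns
    to a first one, and likewise for y; the first-return monomials make A^G an algebra with the same
    kind of basis ([fixedring_monomial]). For any such algebra B, multiplications by x (x) 1 - 1 (x)
    x and y (x) 1 - 1 (x) y on the enveloping algebra have explicit left inverses, so both elements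
    form a regular pair on either side ([koszul_left], [koszul_right]). The resulting Koszul complex
    is a bimodule resolution of length 2. Tensoring it with a module bounds the global dimension
    ([gldim_le_pd], [monomial_algebra_gldim]); dualizing it gives B twisted by a vertex shift, which
    is invertible ([monomial_algebra_CY2]). Moreover, the monomials with a given start and a given
    character are the multiples of a least one by invariant monomials, which yields a finite dual
    basis of A over A^G ([over_fixedring_projective]).

    Rectangularity is necessary. Suppose e_s x^p y^q is invariant but e_s x^p is not. In a suitable
    right module M with a map to A, one finds a relation u b1 = w b2; the coordinates of u in a dual
    basis of M would then be divisible by x^p, and the missing monomial e_s x^p leaves no term to
    produce u ([not_projective]). With M = A this refutes projectivity ([violation_not_projective]);
    with M the relations between two invariant monomials, a second syzygy, it refutes global
    dimension at most 2 ([violation_gldim]). The same argument for a first syzygy excludes global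
    dimension at most 1 ([gldim_gt1]).

    For the twisted Calabi-Yau condition it remains to see that the dimension d is at most 2.
    Otherwise Ext^1 and Ext^2 vanish, and Rees' argument ([hom_exact_regular_sequence]) puts a
    Casimir element in the ideal generated by z (x) 1 - 1 (x) z for z = x^N, y^N; but its image
    under multiplication is nonzero in characteristic 0 ([casimir_notin]). Then Ext vanishes above
    degree 2, and the finite resolution of CY1 can be cut at length 2 ([fg_resolution_pd],
    [twistedCY_gldim]). *)

Definition mklin (R : pzRingType) (U V : lmodType R) (f : U -> V)
    (f_lin : linear f) : {linear U -> V} :=
  HB.pack_for {linear U -> V} f (GRing.isLinear.Build R U V *:%R f f_lin).

Definition mkadd (U V : zmodType) (f : U -> V) (fB : zmod_morphism f) :
    {additive U -> V} :=
  HB.pack_for {additive U -> V} f (GRing.isZmodMorphism.Build U V f fB).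

Lemma kermodP (R : nzRingType) (U V : lmodType R) (f : {linear U -> V})
    (x : kermod f) : f (val x) = 0.
Proof. by apply/eqP; exact: (valP x). Qed.

Definition mkker (R : nzRingType) (U V : lmodType R) (f : {linear U -> V})
    (x : U) (fx : f x = 0) : kermod f := exist _ x (introT eqP fx).

Section CorestrictKernel.
Variables (R : nzRingType) (U V W : lmodType R).
Variables (f : {linear U -> V}) (g : {linear W -> U}).
Hypothesis fg0 : forall w, f (g w) = 0.

Fact to_ker_linear : linear (fun w => mkker (fg0 w)).
Proof. by move=> a x y; apply: val_inj; rewrite /= linearP. Qed.
Definition to_ker : {linear W -> kermod f} := mklin to_ker_linear.

End CorestrictKernel.

Section Projectivity.
Variable R : nzRingType.
Implicit Types (M N P Q : lmodType R).

Lemma projective_retract P M (i : {linear M -> P}) (r : {linear P -> M}) :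
  cancel i r -> projective P -> projective M.
Proof.
move=> irK projP X Y g f g_surj.
have [h hE] := projP X Y g (f \o r : {linear P -> Y}) g_surj.
exists (h \o i : {linear M -> X}) => x /=.
by rewrite hE /= irK.
Qed.

(** Only the values of [f] have to lie in the image of [g], so one can lift along a differential
    without naming its image as a module. *)
Lemma projective_lift P M N (g : {linear M -> N}) (f : {linear P -> N}) :
  projective P -> (forall p, exists x, g x = f p) ->
  exists h : {linear P -> M}, forall p, g (h p) = f p.
Proof.
move=> projP fg.
have dL : linear (fun z : P * M => f z.1 - g z.2).
  by move=> a x y; rewrite /= !linearP /= scalerDr addrACA.
(* The kernel of [d] is the pullback of [f] and [g]; its projection to [P] is onto and therefore has
   a section. *)
pose d := mklin dL.
have pL : linear (fun z : kermod d => (val z).1) by [].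
have [p|s sE] := projP _ _ (mklin pL) (idfun : {linear P -> P}).
  have [x xE] := fg p.
  have dpx : d (p, x) = 0 by rewrite /= xE subrr.
  by exists (mkker dpx).
have hL : linear (fun p => (val (s p)).2) by move=> a x y; rewrite !linearP.
exists (mklin hL) => p /=.
have := kermodP (s p); rewrite /= => /eqP; rewrite subr_eq0 => /eqP <-.
by have := sE p => /= ->.
Qed.

Lemma projective_malg (K : choiceType) : projective ({malg R[K]} : lmodType R).
Proof.
move=> M N g f g_surj.
have [h hE] := choice (fun x : K => g_surj (f << x >>)).
exists (@lext R K M h) => x; elim/malg_ind: x => [|a x y IHx IHy|x].
- by rewrite !linear0.
- by rewrite !linearP IHx IHy.
- by rewrite /= lextU hE.
Qed.

Lemma std_cover_surj M (y : M) : exists x, std_cover M x = y.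
Proof. by exists << y >>; exact: (lextU id y). Qed.

Fact pair1_linear P Q : linear (fun p : P => (p, 0 : Q)).
Proof.
by move=> a x y; apply/eqP; rewrite xpair_eqE /= scaler0 addr0 !eqxx.
Qed.
Fact pair2_linear P Q : linear (fun q : Q => (0 : P, q)).
Proof.
by move=> a x y; apply/eqP; rewrite xpair_eqE /= scaler0 addr0 !eqxx.
Qed.
Definition pair1 P Q : {linear P -> (P * Q)%type} := mklin (@pair1_linear P Q).
Definition pair2 P Q : {linear Q -> (P * Q)%type} := mklin (@pair2_linear P Q).

Lemma projective_prod P Q : projective P -> projective Q ->
  projective ((P * Q)%type : lmodType R).
Proof.
move=> projP projQ M N g f g_surj.
have [h1 h1E] := projP M N g (f \o pair1 P Q : {linear P -> N}) g_surj.
have [h2 h2E] := projQ M N g (f \o pair2 P Q : {linear Q -> N}) g_surj.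
have hL : linear (fun z : P * Q => h1 z.1 + h2 z.2).
  by move=> a x y; rewrite !linearP scalerDr addrACA.
exists (mklin hL) => -[p q] /=; rewrite linearD h1E h2E /= -linearD.
by congr (f _); congr pair; rewrite ?addr0 ?add0r.
Qed.

Lemma projective_regular : projective (R^o : lmodType R).
Proof.
move=> M N g f g_surj; have [m mE] := g_surj (f 1).
have hL : linear (fun r : R^o => (r : R) *: m).
  by move=> a x y; rewrite scalerDl scalerA.
exists (mklin hL) => r /=; rewrite linearZ /= mE -linearZ.
by congr (f _); rewrite /GRing.scale /= mulr1.
Qed.

Lemma projective_trivial M : (forall x : M, x = 0) -> projective M.
Proof.
move=> M0 X Y g f _; have hL : linear (fun _ : M => 0 : X).
  by move=> a x y; rewrite scaler0 addr0.
by exists (mklin hL) => x; rewrite (M0 x) !linear0.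
Qed.

(* A form of [pdim_le] suited to induction on [d]. *)
Fixpoint pd_le (d : nat) (M : lmodType R) : Prop :=
  if d is d'.+1 then
    exists P (f : {linear P -> M}),
      [/\ projective P, forall y, exists x, f x = y & pd_le d' (kermod f)]
  else projective M.

(* Schanuel's lemma, in terms of retracts. *)
Lemma kermod_retract P M P' M' Q (f : {linear P -> M}) (f' : {linear P' -> M'})
    (i : {linear M' -> (M * Q)%type}) (r : {linear (M * Q)%type -> M'}) :
  projective P -> projective P' -> projective Q ->
  (forall y, exists x, f x = y) -> (forall y, exists x, f' x = y) ->
  cancel i r ->
  exists (i' : {linear kermod f' -> (kermod f * P')%type})
    (r' : {linear (kermod f * P')%type -> kermod f'}), cancel i' r'.
Proof.
move=> projP projP' projQ f_surj f'_surj irK.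
have fqL : linear (fun z : P * Q => (f z.1, z.2)).
  by move=> a x y; rewrite linearP.
pose fq := mklin fqL.
have [[m q]|a aE] := projP' _ _ fq (i \o f' : {linear P' -> _}).
  by have [x xE] := f_surj m; exists (x, q); rewrite /= xE.
have [b bE] := @projective_prod P Q projP projQ _ _ f'
  (r \o fq : {linear (P * Q)%type -> _}) f'_surj.
have a1_ker (w : kermod f') : f (a (val w)).1 = 0.
  by have := aE (val w); rewrite /= kermodP linear0 => -[].
have a2_ker (w : kermod f') : (a (val w)).2 = 0.
  by have := aE (val w); rewrite /= kermodP linear0 => -[].
have iL : linear (fun w : kermod f' => (mkker (a1_ker w), val w)).
  by move=> c x y; congr pair; apply: val_inj; rewrite /= !linearP.
have r_ker (z : kermod f * P') : f' (b (val z.1, 0) + (z.2 - b (a z.2))) = 0.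
  rewrite linearD linearB !bE /= kermodP.
  have := aE z.2; rewrite /= => ->; rewrite irK subrr addr0.
  by rewrite -[RHS](linear0 r).
have rL : linear (fun z => mkker (r_ker z)).
  move=> c x y; apply: val_inj => /=.
  have -> : (c *: (val x.1 : P) + val y.1, 0 : Q) =
      c *: (val x.1, 0) + (val y.1, 0) := pair1_linear Q c _ _.
  by rewrite !linearP /= !scalerDr [X in _ + X = _]addrACA [LHS]addrACA.
exists (mklin iL), (mklin rL) => w; apply: val_inj => /=.
rewrite [X in b X + _](_ : _ = a (val w)); first by rewrite addrC subrK.
by rewrite [RHS]surjective_pairing a2_ker.
Qed.

(** The summand [Q] is what makes the induction go through: Schanuel's lemma exhibits the kernel of
    one cover as a retract of the other kernel plus a projective module. *)
Lemma pd_le_retract d M M' Q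
    (i : {linear M' -> (M * Q)%type}) (r : {linear (M * Q)%type -> M'}) :
  projective Q -> cancel i r -> pd_le d M -> pd_le d M'.
Proof.
elim: d M M' Q i r => [|d IHd] M M' Q i r projQ irK.
  by move=> projM; exact: (projective_retract irK (projective_prod projM projQ)).
case=> P [f [projP f_surj pd_ker]].
have proj' := @projective_malg M'.
have [i' [r' irK']] := kermod_retract projP proj' projQ f_surj
  (@std_cover_surj M') irK.
exists (std_free M'), (std_cover M'); split=> //; first exact: std_cover_surj.
exact: IHd _ _ _ i' r' proj' irK' pd_ker.
Qed.

(** By Schanuel's lemma the choice of the cover in [pd_le] is immaterial. *)
Lemma pd_le_ker d P M (f : {linear P -> M}) :
  projective P -> (forall y, exists x, f x = y) -> pd_le d.+1 M ->
  pd_le d (kermod f).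
Proof.
move=> projP f_surj [P' [f' [projP' f'_surj pd_ker]]].
have rL : linear (fun z : M * P => z.1) by [].
have irK : cancel (pair1 M P) (mklin rL) by [].
have [i' [r' irK']] := kermod_retract projP' projP projP f'_surj f_surj irK.
exact: pd_le_retract projP irK' pd_ker.
Qed.

Lemma pd_le_iso d M M' (i : {linear M' -> M}) (r : {linear M -> M'}) :
  cancel i r -> pd_le d M -> pd_le d M'.
Proof.
move=> irK; have projM' := @projective_malg M'.
have rL : linear (fun z : M * {malg R[M']} => r z.1).
  by move=> a x y; rewrite linearP.
apply: (@pd_le_retract d M M' _ (pair1 M _ \o i : {linear _ -> _})
  (mklin rL) projM') => x /=.
exact: irK.
Qed.

Lemma pd_le_pdim d M : pd_le d M -> pdim_le M d.
Proof.
elim: d M => [|d IHd] M.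
  move=> projM.
  (* The zero module is realised as the kernel of the identity. *)
  pose T i : lmodType R := if i is 0 then M else (kermod (idfun : {linear M -> M})).
  have z0 (x : kermod (idfun : {linear M -> M})) : x = 0.
    by apply: val_inj; exact: (kermodP x).
  have dL (U V : lmodType R) : linear (fun _ : U => 0 : V).
    by move=> a x y; rewrite scaler0 addr0.
  have E0 x : (idfun : {linear T 0 -> M}) x = 0 <-> exists y, mklin (dL (T 1) (T 0)) y = x.
    by split=> [/= ->|[y <-]] //; exists 0.
  have ES i x : mklin (dL (T i.+1) (T i)) x = 0 <->
     exists y, mklin (dL (T i.+2) (T i.+1)) y = x.
    by split=> // _; exists 0; rewrite (z0 x).
  exists (@Resolution R M T (fun i => mklin (dL (T i.+1) (T i)))
     (idfun : {linear T 0 -> M}) (fun y => ex_intro _ y erefl) E0 ES).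
    by case=> [|i] //=; apply: projective_trivial.
  by case=> // i _ x; exact: z0.
case=> P [f [projP f_surj /IHd[Q projQ Q0]]].
pose T i : lmodType R := if i is j.+1 then Q j else P.
pose D i : {linear T i.+1 -> T i} :=
  match i with
  | 0 => (val : kermod f -> P) \o res_aug Q
  | j.+1 => res_diff Q j
  end.
have E0 (x : T 0) : f x = 0 <-> exists y, D 0 y = x.
  split=> [fx|[y <-]]; last by rewrite /= kermodP.
  by have [y yE] := res_aug_surj Q (mkker fx); exists y; rewrite /= yE.
have ES i x : D i x = 0 <-> exists y, D i.+1 y = x.
  case: i x => [|i] x; last exact: res_exactS.
  rewrite -(@res_exact0 _ _ Q) /=; split=> [v0|->//].
  exact: val_inj.
exists (@Resolution R M T D f f_surj E0 ES); first by case=> [|i] //=.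
by case=> // i ltdi x; apply: Q0.
Qed.

Section Shift.
Variables (M : lmodType R) (P : resolution M).

Fact shift_aug0 x : res_aug P (res_diff P 0 x) = 0.
Proof. by apply/res_exact0; exists x. Qed.
Definition shift_aug : {linear P 1%N -> kermod (res_aug P)} := to_ker shift_aug0.

Fact shift_aug_surj y : exists x, shift_aug x = y.
Proof.
have [x xE] : exists x, res_diff P 0 x = val y by apply/res_exact0; exact: kermodP.
by exists x; apply: val_inj.
Qed.
Fact shift_exact0 x : shift_aug x = 0 <-> exists y, res_diff P 1 y = x.
Proof. by rewrite -res_exactS; split=> [/(congr1 val)|ax]; [|apply: val_inj]. Qed.

Definition res_shift : resolution (kermod (res_aug P)) :=
  @Resolution R (kermod (res_aug P)) (fun i => P i.+1) (fun i => res_diff P i.+1)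
    shift_aug shift_aug_surj shift_exact0 (fun i => @res_exactS R M P i.+1).

End Shift.

Lemma projective_res0 M (P : resolution M) :
  projective (P 0%N) -> res_length_le P 0 -> projective M.
Proof.
move=> projP P0; have aug_inj : injective (res_aug P).
  move=> x y /eqP; rewrite -subr_eq0 -linearB => /eqP /res_exact0 [z zE].
  by apply/eqP; rewrite -subr_eq0 -zE (P0 1%N isT z) linear0.
have [h hE] := choice (res_aug_surj P).
have hL : linear h by move=> a x y; apply: aug_inj; rewrite linearP !hE.
by apply: (@projective_retract (P 0%N) M (mklin hL) (res_aug P)).
Qed.

Lemma pdim_pd_le d M : pdim_le M d -> pd_le d M.
Proof.
elim: d M => [|d IHd] M [P projP P0]; first exact: projective_res0 (projP 0%N) P0.
exists (P 0%N), (res_aug P); split=> //; first exact: res_aug_surj.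
apply: IHd; exists (res_shift P) => [i|i ltdi x]; first exact: projP.
exact: P0.
Qed.

End Projectivity.

(** * Comparison of resolutions and Ext *)

Section Comparison.
Variables (R : nzRingType) (M : lmodType R).
Implicit Types P Q : resolution M.

Lemma res_diff0 P x : res_aug P (res_diff P 0 x) = 0.
Proof. by apply/res_exact0; exists x. Qed.

Lemma res_diffS P i x : res_diff P i (res_diff P i.+1 x) = 0.
Proof. by apply/res_exactS; exists x. Qed.

(** The recursion that builds a chain map has to carry two consecutive components: the commutation
    between them is what allows the next one to be lifted. *)
Definition square P Q i :=
  {p : {linear P i -> Q i} * {linear P i.+1 -> Q i.+1} |
    forall x, p.1 (res_diff P i x) = res_diff Q i (p.2 x)}.

Lemma chain_map_exists P Q : projective_resolution P ->
  exists u : forall i, {linear P i -> Q i},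
    (forall x, res_aug Q (u 0%N x) = res_aug P x) /\
    forall i x, u i (res_diff P i x) = res_diff Q i (u i.+1 x).
Proof.
move=> projP.
have [u0 u0E] := projP 0%N _ _ (res_aug Q) (res_aug P) (res_aug_surj Q).
have next (i : nat) (f : {linear P i -> Q i}) :
    (forall x, exists y, res_diff Q i y = f (res_diff P i x)) ->
    {g : {linear P i.+1 -> Q i.+1} |
      forall x, f (res_diff P i x) = res_diff Q i (g x)}.
  move=> fd; apply: cid.
  have [g gE] := projective_lift (g := res_diff Q i)
    (f := f \o res_diff P i : {linear _ -> _}) (projP i.+1) fd.
  by exists g => x; rewrite gE.
have s_next i (s : square P Q i) : {t : square P Q i.+1 | (sval t).1 = (sval s).2}.
  have [|g gE] := next i.+1 (sval s).2; last first.
    by exists (exist _ ((sval s).2, g) gE).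
  by move=> x; apply/res_exactS; rewrite -(svalP s) res_diffS linear0.
have [u1 u1E] := next 0%N u0 (fun x => (res_exact0 _).1
  (etrans (u0E _) (res_diff0 x))).
pose F := fix F i : square P Q i :=
  if i is j.+1 then sval (s_next j (F j)) else exist _ (u0, u1) u1E.
exists (fun i => (sval (F i)).1); split=> // i x.
by rewrite (svalP (F i)) /= (svalP (s_next i (F i))).
Qed.

Lemma homotopy_exists P Q (w : forall i, {linear P i -> Q i}) :
  projective_resolution P ->
  (forall x, res_aug Q (w 0%N x) = 0) ->
  (forall i x, w i (res_diff P i x) = res_diff Q i (w i.+1 x)) ->
  exists h : forall i, {linear P i -> Q i.+1},
    (forall x, w 0%N x = res_diff Q 0 (h 0%N x)) /\
    forall i x, w i.+1 x = res_diff Q i.+1 (h i.+1 x) + h i (res_diff P i x).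
Proof.
move=> projP w0 wd.
have h0_ex : exists h : {linear P 0%N -> Q 1%N},
    forall x, w 0%N x = res_diff Q 0 (h x).
  have [|h hE] := projective_lift (g := res_diff Q 0) (f := w 0%N) (projP 0%N).
    by move=> x; apply/res_exact0.
  by exists h => x; rewrite hE.
(* The invariant of the recursion: what remains of [w] after the part already built is a cycle, so
   it lifts along the next differential. *)
pose pre i (h : {linear P i -> Q i.+1}) := forall x,
  res_diff Q i (w i.+1 x - h (res_diff P i x)) = 0.
have next i (h : {linear P i -> Q i.+1}) : pre i h ->
    {g : {linear P i.+1 -> Q i.+2} |
      forall x, w i.+1 x = res_diff Q i.+1 (g x) + h (res_diff P i x)}.
  move=> preh; apply: cid.
  have kL : linear (fun x => w i.+1 x - h (res_diff P i x)).
    by move=> a x y; rewrite !linearP /= scalerDr addrACA.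
  have [|g gE] := projective_lift (g := res_diff Q i.+1) (f := mklin kL)
    (projP i.+1).
    by move=> x; apply/res_exactS; exact: preh.
  by exists g => x; rewrite gE subrK.
have [h0 h0E] := cid h0_ex.
have pre0 : pre 0%N h0 by move=> x; rewrite linearB -h0E -wd subrr.
have preS i (h : {linear P i -> Q i.+1}) (ph : pre i h) : pre i.+1 (sval (next i h ph)).
  move=> x; rewrite linearB -wd (svalP (next i h ph)) res_diffS linear0 addr0.
  by rewrite subrr.
pose F := fix F i : {h : {linear P i -> Q i.+1} | pre i h} :=
  if i is j.+1 then exist _ _ (preS j _ (svalP (F j))) else exist _ h0 pre0.
exists (fun i => sval (F i)); split=> // i x.
exact: (svalP (next i (sval (F i)) (svalP (F i)))).
Qed.

(** The analogue, for an arbitrary resolution, of [is_coboundary], which is tied to the standard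
    one. *)
Definition cobounds P (i : nat) : (P i -> R) -> Prop :=
  match i with
  | 0 => fun f => forall x, f x = 0
  | j.+1 => fun f => exists g : {linear P j -> R^o},
      forall x, f x = g (res_diff P j x)
  end.

(** The vanishing of Ext^i(M, R), read off from [P]. *)
Definition hom_exact P i := forall f : {linear P i -> R^o},
  (forall x, f (res_diff P i x) = 0) -> cobounds f.

Lemma cobounds_chain_map P Q (u : forall i, {linear P i -> Q i}) i
    (f : Q i -> R) :
  (forall j x, u j (res_diff P j x) = res_diff Q j (u j.+1 x)) ->
  cobounds f -> cobounds (fun x : P i => f (u i x)).
Proof.
move=> ud; case: i f => [|i] f /= fB; first by move=> x; rewrite fB.
case: fB => g gE; exists (g \o u i : {linear P i -> R^o}) => x /=.
by rewrite gE -ud.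
Qed.

Lemma cobounds_homotopic P (u : forall i, {linear P i -> P i}) i
    (f : {linear P i -> R^o}) : projective_resolution P ->
  (forall x, res_aug P (u 0%N x) = res_aug P x) ->
  (forall j x, u j (res_diff P j x) = res_diff P j (u j.+1 x)) ->
  (forall x, f (res_diff P i x) = 0) ->
  cobounds (fun x => f (u i x) - f x : R).
Proof.
move=> projP u0 ud fd.
have wL j : linear (fun x : P j => u j x - x).
  by move=> a x y; rewrite !linearP /= scalerDr addrACA.
have [||h [h0 hS]] := homotopy_exists (w := fun j => mklin (wL j)) projP.
- by move=> x; rewrite linearB u0 subrr.
- by move=> j x; rewrite linearB /= ud.
case: i f fd => [|i] f fd /=.
  by move=> x; rewrite -linearB; have /= -> := h0 x; rewrite fd.
exists (f \o h i : {linear P i -> R^o}) => x /=.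
by rewrite -linearB; have /= -> := hS i x; rewrite linearD fd add0r.
Qed.

Lemma cobounds_sum P i (f g : P i -> R) :
  cobounds f -> cobounds g -> cobounds (fun x => f x - g x).
Proof.
case: i f g => [|i] f g /=; first by move=> f0 g0 x; rewrite f0 g0 subrr.
move=> [f' f'E] [g' g'E].
have fgL : linear (fun x => f' x - g' x).
  by move=> a x y; rewrite !linearP /= scalerDr addrACA.
by exists (mklin fgL) => x; rewrite f'E g'E.
Qed.

Lemma cobounds_ext P i (f g : P i -> R) : f =1 g -> cobounds f -> cobounds g.
Proof. by move=> /funext ->. Qed.

(** Take chain maps [u] and [v] in the two directions. Their composite is homotopic to the identity,
    so a cocycle differs by a coboundary from its pullback along it; and that pullback passes
    through [P], where it is a coboundary. *)
Lemma hom_exact_transfer P Q i : projective_resolution P ->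
  projective_resolution Q -> hom_exact P i -> hom_exact Q i.
Proof.
move=> projP projQ exP f fd.
have [u [u0 ud]] := chain_map_exists Q projP.
have [v [v0 vd]] := chain_map_exists P projQ.
have fuB : cobounds (fun x => f (u i x)).
  apply: (exP (f \o u i : {linear P i -> R^o})) => x /=.
  by rewrite ud fd.
have fuvB := cobounds_chain_map vd fuB.
have uv0 x : res_aug Q (u 0%N (v 0%N x)) = res_aug Q x by rewrite u0 v0.
have uvd j x : u j (v j (res_diff Q j x)) = res_diff Q j (u j.+1 (v j.+1 x)).
  by rewrite vd ud.
have := cobounds_homotopic (u := fun j => u j \o v j : {linear _ -> _})
  projQ uv0 uvd fd.
move=> /(cobounds_sum fuvB); apply: cobounds_ext => x /=.
by rewrite opprB addrC subrK.
Qed.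

Lemma std_aug_surj (y : M) : exists x, std_cover M x = y.
Proof. exact: std_cover_surj. Qed.

Lemma std_exact0 (x : std_term M 0) :
  std_cover M x = 0 <-> exists y, std_diff M 0 y = x.
Proof.
split=> [x0|[y <-]]; last exact: kermodP.
by have [y yE] := std_cover_surj (mkker x0); exists y; rewrite /= yE.
Qed.

Lemma std_exactS i (x : std_term M i.+1) :
  std_diff M i x = 0 <-> exists y, std_diff M i.+1 y = x.
Proof.
split=> [x0|[y <-]].
  have cx0 : std_cover (std_syz M i.+1) x = 0 by apply: val_inj.
  by have [y yE] := std_cover_surj (mkker cx0); exists y; rewrite /= yE.
have := kermodP (std_cover (std_syz M i.+2) y) => /= E.
by rewrite [LHS](_ : _ = val (0 : kermod (std_cover (std_syz M i)))) // -E.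
Qed.

Definition std_res : resolution M :=
  @Resolution R M (std_term M) (std_diff M) (std_cover M)
    std_aug_surj std_exact0 std_exactS.

Lemma std_res_projective : projective_resolution std_res.
Proof. by move=> i; apply: projective_malg. Qed.

Lemma cocycleP i (c : cocycle M i) : linear (val c : std_res i -> R^o) /\
  forall x, (val c : std_res i -> R) (res_diff std_res i x) = 0.
Proof. by have /asboolP[] := valP c. Qed.

Definition cocycle_lin i (c : cocycle M i) : {linear std_res i -> R^o} :=
  mklin (cocycleP c).1.

Lemma cocycle_intro i (f : {linear std_res i -> R^o}) :
  (forall x, f (res_diff std_res i x) = 0) ->
  exists c : cocycle M i, forall x, (val c : std_res i -> R) x = f x.
Proof.
move=> fd; have fP : (f : cochain M i) \in @cocycle_pred R M i.
  by apply/asboolP; split=> // a x y; rewrite linearP.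
by exists (exist _ (f : cochain M i) fP).
Qed.

Lemma is_coboundaryE i (f : cochain M i) :
  is_coboundary f <-> cobounds (f : std_res i -> R).
Proof.
case: i f => [|i] f /=; first by split=> [-> //|f0]; apply/funext.
split=> [[g gL gE]|[g gE]]; first by exists (@mklin _ _ R^o g gL).
by exists g => // a x y; rewrite linearP.
Qed.

Lemma cocycleZ i (r : R^c) (c : cocycle M i) x :
  (val (r *: c) : std_term M i -> R) x = (val c : std_term M i -> R) x * r.
Proof. by []. Qed.

Lemma Ext_class0 i (c : cocycle M i) :
  qpi (coboundary M i) c = 0 <-> cobounds (val c : std_res i -> R).
Proof.
rewrite -is_coboundaryE -[0](linear0 (qpi (coboundary M i))).
split=> [/qpi_eq|cB]; first by rewrite subr0 => /asboolP.
by apply/qpi_eq; rewrite subr0; apply/asboolP.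
Qed.

Lemma Ext_eq0 i : (forall e : Ext M i, e = 0) <-> hom_exact std_res i.
Proof.
split=> [E0 f /cocycle_intro[c cE]|ex e].
  by apply: (cobounds_ext cE); apply/Ext_class0; apply: E0.
rewrite -[e]qreprK; apply/Ext_class0.
exact: (ex (cocycle_lin (qrepr e)) (cocycleP (qrepr e)).2).
Qed.

End Comparison.

(** * Vector spaces are projective *)

Section VectorSpace.
Variables (k : fieldType) (W : lmodType k).

(** Zorn's lemma on graphs of partial linear lifts: a maximal graph is defined everywhere, since it
    could otherwise be extended along one more line. This is what makes Hom over [k] preserve
    surjections. *)
Lemma vector_space_projective : projective W.
Proof.
move=> M N g f g_surj.
pose lifts (X : set (W * M)) := [/\
  forall a u v, X u -> X v -> X (a *: u + v),
  forall w m m', X (w, m) -> X (w, m') -> m = m' &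
  forall u, X u -> g u.2 = f u.1].
have [F F_lifts F_total|X [[XL X1 Xg] X_max]] := @Zorn_bigcup _ lifts.
  have both u v : (\bigcup_(Y in F) Y)%classic u -> (\bigcup_(Y in F) Y)%classic v ->
      exists2 Y, F Y & Y u /\ Y v.
    move=> [Y FY Yu] [Z FZ Zv]; have [YZ|ZY] := F_total _ _ FY FZ.
      by exists Z => //; split=> //; apply: YZ.
    by exists Y => //; split=> //; apply: ZY.
  split=> [a u v Fu Fv|w m m' Fm Fm'|u [Y /F_lifts[_ _ Yg] /Yg]//].
    have [Y FY [Yu Yv]] := both _ _ Fu Fv; exists Y => //.
    by have [YL _ _] := F_lifts _ FY; apply: YL.
  have [Y FY [Ym Ym']] := both _ _ Fm Fm'.
  by have [_ Y1 _] := F_lifts _ FY; apply: Y1 Ym Ym'.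
have X0 : X 0.
  apply: contrapT => nX0; have Xe u : ~ X u.
    by move=> Xu; apply: nX0; rewrite -(addNr u) -scaleN1r; apply: XL.
  apply: (X_max [set 0]%classic).
    by split=> [u /Xe //|]; move=> sub; exact: nX0 (sub 0 erefl).
  split=> [a u v -> ->|w m m' [_ ->] [_ ->] //|u ->]; first by rewrite scaler0 addr0.
  by rewrite !linear0.
have XZ a u : X u -> X (a *: u) by move=> Xu; rewrite -[_ *: u]addr0; apply: XL.
have X_total w : exists m, X (w, m).
  apply: contrapT => nXw; have [m0 m0E] := g_surj (f w).
  have X1w a m : X (a *: w, m) -> a = 0.
    move=> Xa; apply/eqP/negPn/negP => a0; apply: nXw; exists (a^-1 *: m).
    have : X (a^-1 *: (a *: w), a^-1 *: m) := XZ a^-1 _ Xa.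
    by rewrite scalerA mulVf // scale1r.
  pose Y := [set v | exists u a, X u /\ v = (u.1 + a *: w, u.2 + a *: m0)]%classic.
  apply: (X_max Y).
    split=> [u Xu|sub].
      by exists u, 0; split=> //; rewrite !scale0r !addr0 -surjective_pairing.
    apply: nXw; exists m0; apply: sub; exists 0, 1; split=> //.
    by rewrite !scale1r !add0r.
  split=> [a _ _ [u [b [Xu ->]]] [v [c [Xv ->]]]|v m m'|].
  - exists (a *: u + v), (a * b + c); split; first exact: XL.
    have ACA (L : lmodType k) (x y z : L) :
        a *: (x + b *: z) + (y + c *: z) = a *: x + y + (a * b + c) *: z.
      by rewrite scalerDr scalerA scalerDl addrACA.
    by congr pair; apply: ACA.
  - move=> [[u1 u2] [b [Xu [-> ->]]]] [[v1 v2] [c [Xv [/eqP E ->]]]] /=.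
    have Xuv : X (u1 - v1, u2 - v2).
      have : X ((-1) *: v1 + u1, (-1) *: v2 + u2) := XL (-1) _ _ Xv Xu.
      by rewrite !scaleN1r ![- _ + _]addrC.
    (* Two different coefficients would put a nonzero multiple of [w] in the domain of [X]. *)
    have cb : c = b.
      apply/eqP; rewrite -subr_eq0; apply/eqP; apply: (X1w _ (u2 - v2)).
      have -> // : (c - b) *: w = u1 - v1.
      by apply/eqP; rewrite scalerBl subr_eq addrAC (eqP E) addrAC subrr add0r.
    move: E; rewrite cb /= => /eqP /addIr E.
    by congr (_ + _); apply: (X1 u1) => //; rewrite E.
  - move=> _ [u [a [Xu ->]]] /=; rewrite !linearD !linearZ /= m0E.
    by rewrite Xg.
have [h hE] := choice X_total.
have hL : linear h.
  move=> a x y; apply: (X1 (a *: x + y)) => //.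
  exact: (XL a _ _ (hE x) (hE y)).
by exists (mklin hL) => w /=; rewrite (Xg _ (hE w)).
Qed.

End VectorSpace.

(** * Bimodules as modules over the enveloping algebra *)

Section RestrictScalars.
Variables (k R : nzRingType) (phi : {rmorphism k -> R}).

(** The vacuous [let] records [phi] in the type, so that the scalar action through [phi] can be
    attached to it. *)
Definition kres (M : lmodType R) : Type := let _ := phi in M.
HB.instance Definition _ (M : lmodType R) := GRing.Zmodule.on (kres M).

Section Module.
Variable M : lmodType R.
Definition kres_scale (c : k) (x : kres M) : kres M := phi c *: (x : M).

Fact kres_scaleA a b x : kres_scale a (kres_scale b x) = kres_scale (a * b) x.
Proof. by rewrite /kres_scale scalerA rmorphM. Qed.
Fact kres_scale1 : left_id 1 kres_scale.
Proof. by move=> x; rewrite /kres_scale rmorph1 scale1r. Qed.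
Fact kres_scaleDr : right_distributive kres_scale +%R.
Proof. by move=> a x y; apply: scalerDr. Qed.
Fact kres_scaleDl x : {morph kres_scale^~ x : a b / a + b}.
Proof. by move=> a b; rewrite /kres_scale rmorphD scalerDl. Qed.

HB.instance Definition _ := GRing.Zmodule_isLmodule.Build k (kres M)
  kres_scaleA kres_scale1 kres_scaleDr kres_scaleDl.
End Module.

Lemma kresZ (M : lmodType R) c (x : M) : c *: (x : kres M) = phi c *: x.
Proof. by []. Qed.

Fact kres_map_linear (M N : lmodType R) (f : {linear M -> N}) :
  linear (f : kres M -> kres N).
Proof. by move=> a x y; rewrite !kresZ; exact: linearP. Qed.
Definition kres_map (M N : lmodType R) (f : {linear M -> N}) :
  {linear kres M -> kres N} := mklin (kres_map_linear f).

End RestrictScalars.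

Section Env.
Variables (k : comNzRingType) (B : algType k).
Local Notation E := (env B).

Lemma env_rel_pi z : env_rel z -> quotalg_pi (env_ideal B) z = 0.
Proof.
move=> zR; rewrite -(raddf0 (quotalg_pi (env_ideal B))); apply/qpi_eq.
by rewrite subr0; apply: gen_ideal_sub.
Qed.

Lemma tensDl (a a' b : B) : tens (a + a') b = tens a b + tens a' b.
Proof.
apply/eqP; rewrite -subr_eq0; apply/eqP.
have := env_rel_pi (EnvDl a a' b).
by rewrite raddfB raddfD.
Qed.

Lemma tensDr (a b b' : B) : tens a (b + b') = tens a b + tens a b'.
Proof.
apply/eqP; rewrite -subr_eq0; apply/eqP.
have := env_rel_pi (EnvDr a b b').
by rewrite raddfB raddfD.
Qed.

Lemma tensZl c (a b : B) : tens (c *: a) b = c *: tens a b.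
Proof.
apply/eqP; rewrite -subr_eq0; apply/eqP.
have := env_rel_pi (EnvZl c a b).
by rewrite raddfB /= quotalg_piZ.
Qed.

Lemma tensZr c (a b : B) : tens a (c *: b) = c *: tens a b.
Proof.
apply/eqP; rewrite -subr_eq0; apply/eqP.
have := env_rel_pi (EnvZr c a b).
by rewrite raddfB /= quotalg_piZ.
Qed.

Lemma tensPl c (a a' b : B) : tens (c *: a + a') b = c *: tens a b + tens a' b.
Proof. by rewrite tensDl tensZl. Qed.
Lemma tensPr c (a b b' : B) : tens a (c *: b + b') = c *: tens a b + tens a b'.
Proof. by rewrite tensDr tensZr. Qed.

Fact tens_linear_l b : linear (fun a : B => tens a b : E).
Proof. by move=> c a a'; apply: tensPl. Qed.
Fact tens_linear_r a : linear (fun b : B => tens a b : E).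
Proof. by move=> c b b'; apply: tensPr. Qed.
Definition tensl b : {linear B -> E} := mklin (tens_linear_l b).
Definition tensr a : {linear B -> E} := mklin (tens_linear_r a).

Lemma tens0l b : tens 0 b = 0 :> E. Proof. exact: (linear0 (tensl b)). Qed.
Lemma tens0r a : tens a 0 = 0 :> E. Proof. exact: (linear0 (tensr a)). Qed.

Lemma tens11 : tens 1 1 = 1 :> E.
Proof.
rewrite -(rmorph1 (quotalg_pi (env_ideal B))) /tens; congr (quotalg_pi _ _).
by rewrite /env_bas [RHS]big_seq1.
Qed.

Lemma env_ind (P : E -> Prop) : P 0 ->
  (forall c z w, P z -> P w -> P (c *: z + w)) ->
  (forall a b, P (tens a b)) -> forall z, P z.
Proof.
move=> P0 PD PU z; rewrite -[z]quotalg_surj.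
elim/pmalg_ind: (qrepr z) => [|c u v Pu Pv|[a b]]; first by rewrite raddf0.
  by rewrite linearP; apply: PD.
exact: PU.
Qed.

Section Lift.
Variables (W : lmodType k) (F : B -> B -> W).
Hypotheses (F_linl : forall b, linear (F^~ b)) (F_linr : forall a, linear (F a)).
Local Notation free := (pmalg k (env_pmonoid B)).

Definition env_lift_free : {linear free -> W} :=
  @lext k (B * B)%type W (fun p => F p.1 p.2).

Lemma env_lift_freeE a b : env_lift_free (env_bas a b) = F a b.
Proof. by rewrite /env_lift_free /env_bas pbasE /= lextU. Qed.

(* The relations generate a two-sided ideal, whereas the kernel of *)
(* [env_lift_free] is only a subspace; this is its largest ideal.  *)
Definition env_lift_core : {pred free} :=
  [pred z | `[< forall u v, env_lift_free (u * z * v) = 0 >]].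

Fact env_lift_core0 : 0 \in env_lift_core.
Proof. by apply/asboolP => u v; rewrite mulr0 mul0r linear0. Qed.
Fact env_lift_coreP c z w : z \in env_lift_core -> w \in env_lift_core ->
  c *: z + w \in env_lift_core.
Proof.
move=> /asboolP Fz /asboolP Fw; apply/asboolP => u v.
by rewrite mulrDr mulrDl -scalerAr -scalerAl linearP Fz Fw scaler0 addr0.
Qed.

Lemma env_lift_free0 z : z \in in_gen_ideal (@env_rel k B) -> env_lift_free z = 0.
Proof.
move=> /asboolP /(_ (Submodule env_lift_core0 env_lift_coreP)) /= H.
suff /asboolP/(_ 1 1) : z \in env_lift_core by rewrite mul1r mulr1.
apply: H => [a y /asboolP Fy|s s_rel].
  split; apply/asboolP => u v; last by rewrite mulrA -mulrA Fy.
  by rewrite mulrA Fy.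
have FB0 b : F 0 b = 0 by have /= := linear0 (mklin (F_linl b)).
have F0B a : F a 0 = 0 by have /= := linear0 (mklin (F_linr a)).
have FD a a' b : F (a + a') b = F a b + F a' b.
  by have := F_linl b 1 a a'; rewrite !scale1r.
have FD' a b b' : F a (b + b') = F a b + F a b'.
  by have := F_linr a 1 b b'; rewrite !scale1r.
have FZ c a b : F (c *: a) b = c *: F a b.
  by have := F_linl b c a 0; rewrite FB0 !addr0.
have FZ' c a b : F a (c *: b) = c *: F a b.
  by have := F_linr a c b 0; rewrite F0B !addr0.
apply/asboolP => u v.
elim/pmalg_ind: u => [|c u u' IH IH'|[p p']].
- by rewrite !mul0r linear0.
- by rewrite !mulrDl -!scalerAl linearP IH IH' scaler0 addr0.
elim/pmalg_ind: v => [|c v v' IH IH'|[q q']].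
- by rewrite mulr0 linear0.
- by rewrite mulrDr -scalerAr linearP IH IH' scaler0 addr0.
rewrite -!/(env_bas _ _).
case: s_rel => *; rewrite !(mulrBr, mulrBl, mulrDr, mulrDl) -?scalerAr -?scalerAl;
  rewrite !env_basM -?mulrA !linearB ?linearD ?linearZ /= !env_lift_freeE;
  rewrite ?(mulrDr, mulrDl) -?scalerAr -?scalerAl -?scalerAr ?(FD, FD', FZ, FZ').
1,2: by rewrite -opprD subrr.
all: by rewrite scalerN subrr.
Qed.

Definition env_lift_fun (z : E) : W := env_lift_free (qrepr z).

Lemma env_lift_piE z : env_lift_fun (quotalg_pi (env_ideal B) z) = env_lift_free z.
Proof.
apply/eqP; rewrite -subr_eq0 -linearB; apply/eqP/env_lift_free0.
by apply/(qpi_eq (env_ideal B)); rewrite qreprK.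
Qed.

Fact env_lift_linear : linear env_lift_fun.
Proof.
move=> c z w; rewrite -[z]quotalg_surj -[w]quotalg_surj -linearP.
by rewrite !env_lift_piE linearP.
Qed.

(** The universal property of B (x) B with respect to bilinear maps. *)
Definition env_lift : {linear E -> W} := mklin env_lift_linear.

Lemma env_liftE a b : env_lift (tens a b) = F a b.
Proof. by rewrite /= /tens env_lift_piE env_lift_freeE. Qed.

End Lift.

Lemma env_linear_ext (W : lmodType k) (f g : {linear E -> W}) :
  (forall a b, f (tens a b) = g (tens a b)) -> f =1 g.
Proof.
move=> fg z; elim/env_ind: z => [|c z w IHz IHw|a b]; rewrite ?linear0 //.
by rewrite !linearP IHz IHw.
Qed.

(** Bimodules are entered through two commuting one-sided actions; [bimod] turns them into modules
    over the enveloping algebra. *)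
Record bimod_ops (W : lmodType k) := BimodOps {
  bl : B -> W -> W;
  br : W -> B -> W;
  bl_linl : forall w, linear (bl^~ w);
  bl_linr : forall a, linear (bl a);
  br_linl : forall b, linear (br^~ b);
  br_linr : forall w, linear (br w);
  blM : forall a a' w, bl a (bl a' w) = bl (a * a') w;
  brM : forall b b' w, br (br w b) b' = br w (b * b');
  bl1 : forall w, bl 1 w = w;
  br1 : forall w, br w 1 = w;
  blbr : forall a w b, bl a (br w b) = br (bl a w) b }.

Section Bimodule.
Variables (W : lmodType k) (D : bimod_ops W).

Definition bimod : Type := let _ := D in W.
HB.instance Definition _ := GRing.Zmodule.on bimod.

Fact bimod_fun_linl w b : linear (fun a => bl D a (br D w b)).
Proof. exact: bl_linl. Qed.
Fact bimod_fun_linr w a : linear (fun b => bl D a (br D w b)).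
Proof.
move=> c b b' /=; have := @br_linr _ D w c b b'; rewrite /= => ->.
by have := @bl_linr _ D a c (br D w b) (br D w b').
Qed.

Definition bimod_scale (z : E) (w : bimod) : bimod :=
  env_lift (bimod_fun_linl w) (bimod_fun_linr w) z.

Lemma bimod_scale_tens a b w : bimod_scale (tens a b) w = bl D a (br D w b).
Proof. exact: (env_liftE (bimod_fun_linl w) (bimod_fun_linr w)). Qed.

Lemma bimod_scalePl c z z' w :
  bimod_scale (c *: z + z') w = c *: (bimod_scale z w : W) + bimod_scale z' w.
Proof. by rewrite /bimod_scale linearP. Qed.
Lemma bimod_scale0l w : bimod_scale 0 w = 0.
Proof. by rewrite /bimod_scale linear0. Qed.

Lemma bimod_scalePr c z w w' :
  bimod_scale z (c *: (w : W) + w') = c *: (bimod_scale z w : W) + bimod_scale z w'.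
Proof.
elim/env_ind: z => [|d z z' IH IH'|a b].
- by rewrite !bimod_scale0l scaler0 addr0.
- rewrite !bimod_scalePl IH IH' !scalerDr !scalerA [d * c]mulrC.
  exact: addrACA.
rewrite !bimod_scale_tens (@br_linl _ D b c w w').
exact: (@bl_linr _ D a c (br D w b) (br D w' b)).
Qed.
Lemma bimod_scale0r z : bimod_scale z 0 = 0.
Proof. by have := bimod_scalePr (-1) z 0 0; rewrite scaler0 addr0 scaleN1r addNr. Qed.

Fact bimod_scaleA z z' w : bimod_scale z (bimod_scale z' w) = bimod_scale (z * z') w.
Proof.
elim/env_ind: z => [|d z z1 IH IH'|a b].
- by rewrite mul0r !bimod_scale0l.
- by rewrite mulrDl -scalerAl !bimod_scalePl IH IH'.
elim/env_ind: z' => [|d z z1 IH IH'|a' b'].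
- by rewrite mulr0 !bimod_scale0l bimod_scale0r.
- by rewrite mulrDr -scalerAr !bimod_scalePl bimod_scalePr IH IH'.
by rewrite tensM !bimod_scale_tens -blM -brM !blbr.
Qed.
Fact bimod_scale1 : left_id 1 bimod_scale.
Proof. by move=> w; rewrite -tens11 bimod_scale_tens bl1 br1. Qed.
Fact bimod_scaleDr : right_distributive bimod_scale +%R.
Proof. by move=> z w w'; have := bimod_scalePr 1 z w w'; rewrite !scale1r. Qed.
Fact bimod_scaleDl w : {morph bimod_scale^~ w : z z' / z + z'}.
Proof. by move=> z z'; have := bimod_scalePl 1 z z' w; rewrite !scale1r. Qed.

HB.instance Definition _ := GRing.Zmodule_isLmodule.Build E bimod
  bimod_scaleA bimod_scale1 bimod_scaleDr bimod_scaleDl.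

Lemma bimod_tens a b (w : bimod) : tens a b *: w = bl D a (br D w b) :> W.
Proof. exact: bimod_scale_tens. Qed.

End Bimodule.

Definition env_in_alg : {rmorphism k -> E} := GRing.in_alg E.

Lemma tens_in_algl c b : tens c%:A b = c%:A * tens 1 b :> E.
Proof. by rewrite tensZl -scalerAl mul1r. Qed.

(** Pure tensors suffice because a scalar c acts as the pure tensor c (x) 1. *)
Lemma env_lmodP (M N : lmodType E) (f : M -> N) : zmod_morphism f ->
  (forall a b m, f (tens a b *: m) = tens a b *: f m) -> linear f.
Proof.
move=> fB fT; pose g := mkadd fB; have gE x : f x = g x by [].
have fZ z m : f (z *: m) = z *: f m.
  elim/env_ind: z => [|c z w IHz IHw|a b]; last exact: fT.
    by rewrite !scale0r gE raddf0.
  rewrite !scalerDl gE raddfD -!gE IHw; congr (_ + _).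
  have cE (L : lmodType E) (u : L) : (c *: z) *: u = tens c%:A 1 *: (z *: u).
    by rewrite scalerA tens_in_algl tens11 mulr1 -scalerAl mul1r.
  by rewrite !cE fT IHz.
by move=> z m m'; rewrite gE raddfD -!gE fZ.
Qed.

End Env.

(** * Bimodules of linear maps *)

Section LinearMaps.
Variables (k : comNzRingType) (U V : lmodType k).

Definition khom_pred : {pred (U -> V)} := [pred f | `[< linear f >]].
Fact khom_submod_closed : submod_closed khom_pred.
Proof.
split=> [|c f g /asboolP fL /asboolP gL]; apply/asboolP => a x y /=.
  by rewrite scaler0 addr0.
change (c *: f (a *: x + y) + g (a *: x + y) =
  a *: (c *: f x + g x) + (c *: f y + g y)).
by rewrite fL gL !scalerDr !scalerA [c * a]mulrC addrACA.
Qed.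
HB.instance Definition _ :=
  GRing.isSubmodClosed.Build k (U -> V) khom_pred khom_submod_closed.
Definition khom := {f : U -> V | f \in khom_pred}.
HB.instance Definition _ := SubChoice.on khom.
HB.instance Definition _ := [SubChoice_isSubLmodule of khom by <:].

Definition mkhom (f : {linear U -> V}) : khom :=
  exist _ (f : U -> V) (introT (asboolP _) (@linearP _ _ _ _ f)).

Lemma khom_linear (f : khom) : linear (val f).
Proof. by apply/asboolP; exact: (valP f). Qed.

Definition khom_lin (f : khom) : {linear U -> V} := mklin (khom_linear f).

Lemma khomE c (f g : khom) x : val (c *: f + g) x = c *: val f x + val g x.
Proof. by []. Qed.

Lemma khomP (f g : khom) : (forall x, val f x = val g x) -> f = g.
Proof. by move=> fg; apply: val_inj; apply/funext. Qed.

End LinearMaps.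

Section HomBimodules.
Variables (k : comNzRingType) (B : algType k).

Definition conv_scalar (c : k) : B^c := c%:A.
Fact conv_scalarB : zmod_morphism conv_scalar.
Proof. by move=> a b; rewrite /conv_scalar scalerBl. Qed.
Fact conv_scalarM : monoid_morphism conv_scalar.
Proof.
split=> [|a b]; first by rewrite /conv_scalar scale1r.
by rewrite [RHS]/GRing.mul /= /conv_scalar -scalerAl mul1r scalerA mulrC.
Qed.
HB.instance Definition _ := GRing.isZmodMorphism.Build k B^c conv_scalar conv_scalarB.
HB.instance Definition _ := GRing.isMonoidMorphism.Build k B^c conv_scalar conv_scalarM.

Local Notation kr := (kres (conv_scalar : {rmorphism k -> B^c})).
Local Notation ke := (kres (env_in_alg B)).

Lemma conv_scale (C : lmodType B^c) (c : k) (a : B) (x : C) :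
  ((c *: a : B) : B^c) *: x = conv_scalar c *: ((a : B^c) *: x).
Proof.
by rewrite scalerA; congr (_ *: x); rewrite /GRing.mul /= /conv_scalar -scalerAr mulr1.
Qed.

Lemma conv_scaleC (C : lmodType B^c) (c : k) (a : B) (x : C) :
  (a : B^c) *: (conv_scalar c *: x) = conv_scalar c *: ((a : B^c) *: x).
Proof.
rewrite !scalerA; congr (_ *: x); rewrite /GRing.mul /= /conv_scalar.
by rewrite -scalerAl -scalerAr mulr1 mul1r.
Qed.

Lemma env_scaleC (M : lmodType (env B)) (c : k) (z : env B) (x : M) :
  z *: ((c *: (x : ke M)) : M) = c *: ((z *: x) : ke M).
Proof.
by rewrite !kresZ !scalerA /env_in_alg /= -scalerAl -scalerAr mulr1 mul1r.
Qed.

Lemma env_scaleA (M : lmodType (env B)) (c : k) (z : env B) (x : M) :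
  (c *: z) *: x = c *: ((z *: x) : ke M).
Proof. by rewrite !kresZ !scalerA /env_in_alg /= -scalerAl mul1r. Qed.

Section RightHom.
Variables C N : lmodType B^c.
Local Notation H := (khom (kr C) (kr N)).

Fact hom_bl_linear (a : B) (f : H) :
  linear (fun x : kr C => val f ((a : B^c) *: (x : C)) : kr N).
Proof.
move=> c x y; rewrite [X in val f X](_ : _ =
    c *: ((a : B^c) *: (x : C) : kr C) + ((a : B^c) *: (y : C) : kr C)).
  exact: khom_linear.
by rewrite !kresZ scalerDr conv_scaleC.
Qed.
Definition hom_bl (a : B) (f : H) : H := mkhom (mklin (hom_bl_linear a f)).

Fact hom_br_linear (f : H) (b : B) :
  linear (fun x : kr C => (b : B^c) *: (val f x : N) : kr N).
Proof.
by move=> c x y; rewrite khom_linear scalerDr !kresZ conv_scaleC.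
Qed.
Definition hom_br (f : H) (b : B) : H := mkhom (mklin (hom_br_linear f b)).

Fact hom_bl_linl f : linear (hom_bl^~ f).
Proof.
move=> c a a'; apply: khomP => x; rewrite khomE /=.
rewrite [X in sval f X](_ : _ =
    c *: ((a : B^c) *: (x : C) : kr C) + ((a' : B^c) *: (x : C) : kr C)).
  exact: khom_linear.
by rewrite scalerDl conv_scale.
Qed.
Fact hom_bl_linr a : linear (hom_bl a).
Proof. by move=> c f g; apply: khomP. Qed.
Fact hom_br_linl b : linear (hom_br^~ b).
Proof.
move=> c f g; apply: khomP => x; rewrite khomE /=.
by rewrite scalerDr !kresZ conv_scaleC.
Qed.
Fact hom_br_linr f : linear (hom_br f).
Proof.
by move=> c a a'; apply: khomP => x; rewrite khomE /= scalerDl conv_scale.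
Qed.
Fact hom_blM a a' f : hom_bl a (hom_bl a' f) = hom_bl (a * a') f.
Proof. by apply: khomP => x /=; rewrite scalerA. Qed.
Fact hom_brM b b' f : hom_br (hom_br f b) b' = hom_br f (b * b').
Proof. by apply: khomP => x /=; rewrite scalerA. Qed.
Fact hom_bl1 f : hom_bl 1 f = f.
Proof. by apply: khomP => x /=; rewrite scale1r. Qed.
Fact hom_br1 f : hom_br f 1 = f.
Proof. by apply: khomP => x /=; rewrite scale1r. Qed.
Fact hom_blbr a f b : hom_bl a (hom_br f b) = hom_br (hom_bl a f) b.
Proof. by apply: khomP. Qed.

Definition hom_ops := BimodOps hom_bl_linl hom_bl_linr hom_br_linl hom_br_linr
  hom_blM hom_brM hom_bl1 hom_br1 hom_blbr.

(* [Hom_k(C, N)] with [(a f b)(x) = f(x a) b]. *)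
Definition hom_bimod : lmodType (env B) := bimod hom_ops.

End RightHom.

Section LeftHom.
Variable N : lmodType (env B).
Local Notation H := (khom B (ke N)).

Fact lhom_bl_linear (a : B) (f : H) :
  linear (fun x : B => tens a 1 *: (val f x : N) : ke N).
Proof. by move=> c x y; rewrite khom_linear scalerDr env_scaleC. Qed.
Definition lhom_bl (a : B) (f : H) : H := mkhom (mklin (lhom_bl_linear a f)).

Fact lhom_br_linear (f : H) (b : B) :
  linear (fun x : B => val f (b * x) : ke N).
Proof. by move=> c x y; rewrite mulrDr -scalerAr khom_linear. Qed.
Definition lhom_br (f : H) (b : B) : H := mkhom (mklin (lhom_br_linear f b)).

Fact lhom_bl_linl f : linear (lhom_bl^~ f).
Proof.
move=> c a a'; apply: khomP => x; rewrite khomE /=.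
by rewrite tensPl scalerDl env_scaleA.
Qed.
Fact lhom_bl_linr a : linear (lhom_bl a).
Proof.
move=> c f g; apply: khomP => x; rewrite khomE /= scalerDr.
by rewrite env_scaleC.
Qed.
Fact lhom_br_linl b : linear (lhom_br^~ b).
Proof. by move=> c f g; apply: khomP. Qed.
Fact lhom_br_linr f : linear (lhom_br f).
Proof.
move=> c a a'; apply: khomP => x; rewrite khomE /= mulrDl -scalerAl.
exact: khom_linear.
Qed.
Fact lhom_blM a a' f : lhom_bl a (lhom_bl a' f) = lhom_bl (a * a') f.
Proof. by apply: khomP => x /=; rewrite scalerA tensM mulr1. Qed.
Fact lhom_brM b b' f : lhom_br (lhom_br f b) b' = lhom_br f (b * b').
Proof. by apply: khomP => x /=; rewrite mulrA. Qed.
Fact lhom_bl1 f : lhom_bl 1 f = f.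
Proof. by apply: khomP => x /=; rewrite tens11 scale1r. Qed.
Fact lhom_br1 f : lhom_br f 1 = f.
Proof. by apply: khomP => x /=; rewrite mul1r. Qed.
Fact lhom_blbr a f b : lhom_bl a (lhom_br f b) = lhom_br (lhom_bl a f) b.
Proof. by apply: khomP. Qed.

Definition lhom_ops := BimodOps lhom_bl_linl lhom_bl_linr lhom_br_linl
  lhom_br_linr lhom_blM lhom_brM lhom_bl1 lhom_br1 lhom_blbr.

(* [Hom_k(B, N)] with [(a f b)(x) = a f(b x)]. *)
Definition lhom_bimod : lmodType (env B) := bimod lhom_ops.

End LeftHom.
End HomBimodules.

(** * Global dimension and the projective dimension of the regular bimodule *)

Section GeneratedSubmodule.
Variables (R : nzRingType) (V : lmodType R) (S : set V).

Definition in_gen_submod : {pred V} := [pred x | `[<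
  forall J : submodule V, (forall s, S s -> s \in submod_pred J) ->
    x \in submod_pred J >]].

Fact gen_submod0 : 0 \in in_gen_submod.
Proof. by apply/asboolP => J _; apply: submod0. Qed.
Fact gen_submodP a x y : x \in in_gen_submod -> y \in in_gen_submod ->
  a *: x + y \in in_gen_submod.
Proof.
by move=> /asboolP Jx /asboolP Jy; apply/asboolP => J SJ; apply: submodP; auto.
Qed.
Definition gen_submod := Submodule gen_submod0 gen_submodP.

Lemma gen_submod_sub x : S x -> x \in submod_pred gen_submod.
Proof. by move=> Sx; apply/asboolP => J; apply. Qed.

Lemma gen_submod_ker (W : lmodType R) (f : {linear V -> W}) :
  (forall s, S s -> f s = 0) -> forall x, x \in submod_pred gen_submod -> f x = 0.
Proof.
move=> fS x /asboolP Jx; pose K := [pred x | f x == 0].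
have K0 : 0 \in K by rewrite inE linear0.
have KP a u v : u \in K -> v \in K -> a *: u + v \in K.
  by rewrite !inE linearP => /eqP-> /eqP->; rewrite scaler0 addr0.
apply/eqP; apply: (Jx (Submodule K0 KP)) => s /fS fs.
by rewrite inE fs.
Qed.

End GeneratedSubmodule.

(** * The tensor product of a right module with a bimodule *)

Section Tensor.
Variables (k : comNzRingType) (B : algType k) (C : lmodType B^c).
Local Notation kr := (kres (conv_scalar B : {rmorphism k -> B^c})).
Local Notation ke := (kres (env_in_alg B)).

Section Construction.
Variable P : lmodType (env B).

Definition tbas (x : C) (p : P) : {malg k[(C * P)%type]} := << (x, p) >>.

Variant tensor_rel : set {malg k[(C * P)%type]} :=
| TensDl x y p : tensor_rel (tbas (x + y) p - (tbas x p + tbas y p))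
| TensDr x p q : tensor_rel (tbas x (p + q) - (tbas x p + tbas x q))
| TensZ c x p : tensor_rel (tbas (conv_scalar B c *: x) p - c *: tbas x p)
| TensBal x b p : tensor_rel (tbas ((b : B^c) *: x) p - tbas x (tens b 1 *: p)).

(** C (x)_B P as a module over [k]. The right action of B that comes from [P] is put on the copy
    [tensor]. *)
Definition tensor0 : lmodType k := quotmod (gen_submod tensor_rel).
Definition tpi : {linear {malg k[(C * P)%type]} -> tensor0} :=
  qpi (gen_submod tensor_rel).
Definition tmap (x : C) (p : P) : tensor0 := tpi (tbas x p).

Lemma tpi_rel z : tensor_rel z -> tpi z = 0.
Proof.
move=> zS; rewrite -(linear0 tpi); apply/qpi_eq.
by rewrite subr0; apply: gen_submod_sub.
Qed.

Lemma tmapDl x y p : tmap (x + y) p = tmap x p + tmap y p.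
Proof.
apply/eqP; rewrite -subr_eq0 -linearD -linearB; apply/eqP.
exact/tpi_rel/TensDl.
Qed.
Lemma tmapDr x p q : tmap x (p + q) = tmap x p + tmap x q.
Proof.
apply/eqP; rewrite -subr_eq0 -linearD -linearB; apply/eqP.
exact/tpi_rel/TensDr.
Qed.
Lemma tmapZ c x p : tmap (conv_scalar B c *: x) p = c *: tmap x p.
Proof.
apply/eqP; rewrite -subr_eq0 /tmap -linearZZ -linearB; apply/eqP.
exact/tpi_rel/TensZ.
Qed.
Lemma tmap_bal x b p : tmap ((b : B^c) *: x) p = tmap x (tens b 1 *: p).
Proof.
apply/eqP; rewrite -subr_eq0 -linearB; apply/eqP.
exact/tpi_rel/TensBal.
Qed.
Lemma tmapZr c x (p : P) : tmap x (c *: (p : ke P) : ke P) = c *: tmap x p.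
Proof.
rewrite -tmapZ [conv_scalar B c]/conv_scalar tmap_bal; congr tmap.
by rewrite kresZ tensZl tens11.
Qed.

Lemma tensor_ext (W : lmodType k) (f g : {linear tensor0 -> W}) :
  (forall x p, f (tmap x p) = g (tmap x p)) -> f =1 g.
Proof.
move=> fg z; rewrite -[z]qreprK.
elim/malg_ind: (qrepr z) => [|a u v IHu IHv|[x p]]; last exact: fg.
  by rewrite !linear0.
by rewrite !linearP IHu IHv.
Qed.

Section Lift.
Variables (W : lmodType k) (F : C -> P -> W).
Hypothesis FDl : forall x y p, F (x + y) p = F x p + F y p.
Hypothesis FDr : forall x p q, F x (p + q) = F x p + F x q.
Hypothesis FZ : forall c x p, F (conv_scalar B c *: x) p = c *: F x p.
Hypothesis F_bal : forall x (b : B) p, F ((b : B^c) *: x) p = F x (tens b 1 *: p).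

Definition tlift_free : {linear {malg k[(C * P)%type]} -> W} :=
  @lext k (C * P)%type W (fun z => F z.1 z.2).

Lemma tlift_freeE x p : tlift_free (tbas x p) = F x p.
Proof. exact: lextU. Qed.

Lemma tlift_free0 z : z \in submod_pred (gen_submod tensor_rel) -> tlift_free z = 0.
Proof.
apply: gen_submod_ker => _ [x y p|x p q|c x p|x b p];
  apply/eqP; rewrite linearB subr_eq0 ?linearD ?linearZZ !tlift_freeE; apply/eqP.
- exact: FDl.
- exact: FDr.
- exact: FZ.
- exact: F_bal.
Qed.

Definition tlift_fun (z : tensor0) : W := tlift_free (qrepr z).

Lemma tlift_piE z : tlift_fun (tpi z) = tlift_free z.
Proof.
apply/eqP; rewrite -subr_eq0 -linearB; apply/eqP/tlift_free0.
by apply/qpi_eq; rewrite qreprK.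
Qed.
Fact tlift_linear : linear tlift_fun.
Proof.
move=> c z w; rewrite -[z]qreprK -[w]qreprK -linearP.
by rewrite !tlift_piE linearP.
Qed.
Definition tlift : {linear tensor0 -> W} := mklin tlift_linear.

Lemma tliftE x p : tlift (tmap x p) = F x p.
Proof. by rewrite /= /tmap tlift_piE tlift_freeE. Qed.

End Lift.

Section Action.
Variable b : B.
Let F x p := tmap x (tens 1 b *: p).
Fact tract_Dl x y p : F (x + y) p = F x p + F y p. Proof. exact: tmapDl. Qed.
Fact tract_Dr x p q : F x (p + q) = F x p + F x q.
Proof. by rewrite /F scalerDr tmapDr. Qed.
Fact tract_Z c x p : F (conv_scalar B c *: x) p = c *: F x p.
Proof. exact: tmapZ. Qed.
Fact tract_bal x (a : B) p : F ((a : B^c) *: x) p = F x (tens a 1 *: p).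
Proof. by rewrite /F tmap_bal !scalerA !tensM !mulr1 !mul1r. Qed.
Definition tract : {linear tensor0 -> tensor0} :=
  tlift tract_Dl tract_Dr tract_Z tract_bal.
Lemma tractE x p : tract (tmap x p) = tmap x (tens 1 b *: p).
Proof. exact: tliftE. Qed.
End Action.

Definition tensor : Type := tensor0.
HB.instance Definition _ := GRing.Zmodule.on tensor.

Definition tensor_scale (b : B^c) (z : tensor) : tensor := tract b z.

Fact tensor_scaleA a b z : tensor_scale a (tensor_scale b z) = tensor_scale (a * b) z.
Proof.
apply: (@tensor_ext tensor0 (tract a \o tract b : {linear _ -> _}) (tract (a * b))).
move=> x p; rewrite tractE; change (tract a (tract b (tmap x p)) = tmap x (tens 1 (a * b) *: p)).
by rewrite !tractE scalerA tensM mulr1.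
Qed.
Fact tensor_scale1 : left_id 1 tensor_scale.
Proof.
apply: (@tensor_ext tensor0 (tract 1) (idfun : {linear _ -> _})) => x p.
by rewrite tractE tens11 scale1r.
Qed.
Fact tensor_scaleDr : right_distributive tensor_scale +%R.
Proof. by move=> a z w; rewrite /tensor_scale linearD. Qed.
Fact tensor_scaleDl z : {morph tensor_scale^~ z : a b / a + b}.
Proof.
move=> a b; have abL : linear (fun z => tract a z + tract b z).
  by move=> c u v; rewrite !linearP scalerDr addrACA.
apply: (@tensor_ext tensor0 (tract (a + b : B)) (mklin abL)) => x p.
rewrite tractE; change (tmap x (tens 1 (a + b : B) *: p) =
  tract a (tmap x p) + tract b (tmap x p)).
by rewrite !tractE tensDr scalerDl tmapDr.
Qed.
HB.instance Definition _ := GRing.Zmodule_isLmodule.Build B^c tensor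
  tensor_scaleA tensor_scale1 tensor_scaleDr tensor_scaleDl.

Lemma tensor_scaleE (b : B) x p :
  (b : B^c) *: (tmap x p : tensor) = tmap x (tens 1 b *: p).
Proof. exact: tractE. Qed.

Lemma tensor_kscale c (z : tensor0) :
  conv_scalar B c *: (z : tensor) = (c *: z : tensor0) :> tensor.
Proof.
have cL : linear (fun z : tensor0 => c *: z).
  by move=> a u v; rewrite scalerDr !scalerA mulrC.
apply: (@tensor_ext tensor0 (tract (c%:A : B)) (mklin cL)) => x p.
by rewrite tractE /= tensZr tens11 -tmapZr kresZ.
Qed.

Definition tensor_kres (z : tensor0) : kr tensor := z.
Fact tensor_kres_linear : linear tensor_kres.
Proof.
by move=> c z w; rewrite /tensor_kres kresZ -tensor_kscale.
Qed.

End Construction.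
End Tensor.

(** * Left-linear maps between bimodules *)

Section LeftLinear.
Variables (k : fieldType) (B : algType k).
Local Notation E := (env B).
Local Notation ke := (kres (env_in_alg B)).
Implicit Types M N P X Y : lmodType E.

Definition left_linear M N (h : M -> N) : Prop :=
  zmod_morphism h /\ forall b m, h (tens b 1 *: m) = tens b 1 *: h m.

Lemma linear_left_linear M N (f : {linear M -> N}) : left_linear f.
Proof. by split=> [x y|b m]; rewrite ?linearB ?linearZZ. Qed.

Lemma left_linear_comp M N P (f : N -> P) (g : M -> N) :
  left_linear f -> left_linear g -> left_linear (f \o g).
Proof.
by move=> [fB fZ] [gB gZ]; split=> [x y|b m] /=; rewrite ?gB ?fB ?gZ ?fZ.
Qed.

Lemma left_linear_kres M N (h : M -> N) : left_linear h ->
  linear (h : ke M -> ke N).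
Proof.
move=> [hB hZ] c x y; pose h' := mkadd hB.
have hD u v : h (u + v) = h u + h v by exact: (raddfD h').
have cE (L : lmodType E) (u : L) : c *: (u : ke L) = tens c%:A 1 *: u.
  by rewrite kresZ tensZl tens11.
by rewrite [LHS]hD !cE hZ.
Qed.

(** Lifting is tested only against surjections of bimodules; this is enough to split, on the left,
    every bimodule cover of [X]. *)
Definition left_projective X : Prop :=
  forall P Y (f : {linear P -> Y}) (g : X -> Y), left_linear g ->
    (forall y, exists x, f x = y) ->
    exists h : X -> P, left_linear h /\ forall x, f (h x) = g x.

Lemma left_projective_regbim : left_projective (regbim B).
Proof.
move=> P Y f g [gB gZ] f_surj; have [p pE] := f_surj (g (1 : B)).
exists (fun b : regbim B => tens (b : B) 1 *: p); split; first split.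
- by move=> x y; rewrite -scalerBl -[RHS]/(_ *: p); congr (_ *: p); exact: (raddfB (tensl 1)).
- by move=> b x; rewrite scalerA regbim_tens tensM !mulr1.
move=> x; rewrite linearZZ pE -gZ; congr g.
by rewrite regbim_tens !mulr1.
Qed.

(** By adjunction a left-linear g corresponds to the bimodule map x -> (b -> g (x b)) into Hom_k(B,
    Y), and Hom_k(B, -) preserves surjections over a field. A lift is evaluated at 1 to come
    back. *)
Lemma projective_left_projective X : projective X -> left_projective X.
Proof.
move=> projX P Y f g [gB gZ] f_surj.
have g_lin := left_linear_kres (conj gB gZ).
have cX (x : X) : linear (fun b : B => g (tens 1 b *: x) : ke Y).
  move=> c a b; rewrite tensPr scalerDl env_scaleA.
  exact: g_lin.
pose G x : lhom_bimod Y := mkhom (mklin (cX x)).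
have GB : zmod_morphism G.
  by move=> x y; apply: khomP => b /=; rewrite scalerBr gB.
have GL : linear G.
  apply: env_lmodP => // a b x; rewrite bimod_tens; apply: khomP => c /=.
  by rewrite -gZ !scalerA !tensM !mul1r !mulr1.
have FL : linear (fun h : lhom_bimod P =>
    (mkhom (kres_map _ f \o khom_lin h : {linear _ -> _}) : lhom_bimod Y)).
  apply: env_lmodP => [x y|a b h]; apply: khomP => c /=; first by rewrite linearB.
  by rewrite !bimod_tens /= linearZZ.
have F_surj y : exists x, mklin FL x = y.
  have [h hE] := vector_space_projective (g := kres_map _ f)
    (khom_lin (y : khom _ _)) f_surj.
  by exists (mkhom h); apply: khomP => b /=; exact: hE.
have [H HE] := projX _ _ (mklin FL) (mklin GL) F_surj.
exists (fun x => val (H x : khom _ _) 1); split; first split.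
- by move=> x y; rewrite linearB.
- by move=> b x; rewrite linearZZ bimod_tens /= mulr1.
move=> x; have := congr1 (fun h : khom _ _ => val h 1) (HE x) => /= ->.
by rewrite tens11 scale1r.
Qed.

Lemma left_linear_section P X (f : {linear P -> X}) :
  left_projective X -> (forall y, exists x, f x = y) ->
  exists s : X -> P, left_linear s /\ cancel s f.
Proof.
move=> lpX f_surj.
by apply: (lpX P X f id) => //; split.
Qed.

Lemma left_linear_retraction P X (f : {linear P -> X}) (s : X -> P) :
  left_linear s -> cancel s f ->
  exists r : P -> kermod f, left_linear r /\ forall p, val (r p) = p - s (f p).
Proof.
move=> [sB sZ] sK; have r_ker p : f (p - s (f p)) = 0.
  by rewrite linearB sK subrr.
exists (fun p => mkker (r_ker p)); split=> //; split=> [x y|b x]; apply: val_inj => /=.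
  by rewrite (linearB f) sB !opprB addrACA [RHS]addrACA [- y + _]addrC.
by rewrite linearZZ sZ scalerBr.
Qed.

(** As a left module the kernel is a direct summand of [P]. *)
Lemma left_projective_ker P X (f : {linear P -> X}) : projective P ->
  left_projective X -> (forall y, exists x, f x = y) ->
  left_projective (kermod f).
Proof.
move=> projP lpX f_surj P' Y g h hL g_surj.
have [s [sL sK]] := left_linear_section lpX f_surj.
have [r [rL rE]] := left_linear_retraction sL sK.
have [h' [h'L h'E]] := projective_left_projective projP
  (left_linear_comp hL rL) g_surj.
have jL := linear_left_linear (val : {linear kermod f -> P}).
exists (h' \o val); split; first exact: left_linear_comp h'L jL.
move=> x; rewrite /= h'E /=; congr h; apply: val_inj.
rewrite rE kermodP; have [sB _] := sL.
by have /= -> := raddf0 (mkadd sB); rewrite subr0.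
Qed.

End LeftLinear.

Section TensorFunctor.
Variables (k : fieldType) (B : algType k) (C : lmodType B^c).
Local Notation E := (env B).
Local Notation ke := (kres (env_in_alg B)).
Local Notation kr := (kres (conv_scalar B : {rmorphism k -> B^c})).
Implicit Types P X N : lmodType E.

Lemma tensor_map P X (h : P -> X) : left_linear h ->
  exists f : {linear tensor0 C P -> tensor0 C X},
    forall x p, f (tmap x p) = tmap x (h p).
Proof.
move=> [hB hZ]; pose h' := mkadd hB.
have Dr x p q : tmap x (h (p + q)) = tmap x (h p) + tmap x (h q) :> tensor0 C X.
  by rewrite -tmapDr; congr tmap; exact: (raddfD h').
have bal x (b : B) p : tmap ((b : B^c) *: x) (h p) = tmap x (h (tens b 1 *: p)) :> tensor0 C X.
  by rewrite hZ tmap_bal.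
exists (tlift (F := fun x p => tmap x (h p) : tensor0 C X)
  (fun x y p => tmapDl x y (h p)) Dr (fun c x p => tmapZ c x (h p)) bal) => x p.
exact: tliftE.
Qed.

Lemma tensor_linear P (N : lmodType B^c) (f : {linear tensor0 C P -> kr N}) :
  (forall x p (b : B), f (tmap x (tens 1 b *: p)) = (b : B^c) *: (f (tmap x p) : N)) ->
  linear (f : tensor C P -> N).
Proof.
move=> fb; have fZ (b : B^c) (z : tensor C P) : f (b *: z) = b *: (f z : N).
  have bL : linear (fun z : tensor0 C P => b *: (f z : N) : kr N).
    by move=> c u v; rewrite linearP scalerDr !kresZ conv_scaleC.
  apply: (@tensor_ext _ _ _ _ _ (f \o tract C P b : {linear _ -> _}) (mklin bL)).
  by move=> x p; rewrite [LHS]/= -[X in f X]/(tract C P b (tmap x p)) tractE fb.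
move=> b z w; apply: (etrans (raddfD f _ _)).
exact: (congr1 (fun u : N => u + f w) (fZ b z)).
Qed.

(** By adjunction, maps from C (x)_B P to [N] are bimodule maps from [P] to Hom_k(C, N), and
    Hom_k(C, -) preserves surjections over a field. *)
Lemma tensor_projective P : projective P -> projective (tensor C P : lmodType B^c).
Proof.
move=> projP M N g f g_surj.
pose f0 : {linear tensor0 C P -> kr N} := 
  (kres_map (conv_scalar B) f) \o mklin (@tensor_kres_linear k B C P).
have f0D (x y : C) p : f0 (tmap (x + y) p) = f0 (tmap x p) + f0 (tmap y p).
  by rewrite tmapDl linearD.
have cP (p : P) : linear (fun x : kr C => f0 (tmap (x : C) p) : kr N).
  by move=> c x y; rewrite f0D kresZ tmapZ linearZZ.
pose G p : hom_bimod C N := mkhom (mklin (cP p)).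
have f0_act x p (b : B) : f0 (tmap x (tens 1 b *: p)) = (b : B^c) *: (f0 (tmap x p) : N).
  by rewrite -tensor_scaleE /f0 /= /tensor_kres linearZZ.
have f0B c (x y : P) : f0 (tmap c (x - y)) = f0 (tmap c x) - f0 (tmap c y).
  by apply/eqP; rewrite eq_sym subr_eq -(linearD f0) -tmapDr subrK.
have GL : linear G.
  apply: env_lmodP => [x y|a b x].
    by apply: khomP => c; exact: f0B.
  rewrite bimod_tens; apply: khomP => c.
  change (f0 (tmap c (tens a b *: x)) =
    (b : B^c) *: (f0 (tmap ((a : B^c) *: c) x) : N)).
  by rewrite tmap_bal -f0_act scalerA tensM mul1r mul1r.
have FL : linear (fun h : hom_bimod C M =>
    (mkhom (kres_map _ g \o khom_lin h : {linear _ -> _}) : hom_bimod C N)).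
  apply: env_lmodP => [x y|a b h]; apply: khomP => c /=; first by rewrite linearB.
  by rewrite !bimod_tens /= linearZZ.
have F_surj y : exists x, mklin FL x = y.
  have [h hE] := vector_space_projective (g := kres_map _ g)
    (khom_lin (y : khom _ _)) g_surj.
  by exists (mkhom h); apply: khomP => b /=; exact: hE.
have [H HE] := projP _ _ (mklin FL) (mklin GL) F_surj.
have HL p := khom_linear (H p : khom _ _).
have H1 x y p : val (H p : khom _ _) (x + y) = val (H p : khom _ _) x + val (H p : khom _ _) y.
  by exact: (raddfD (mklin (HL p))).
have H2 x p q : val (H (p + q) : khom _ _) x = val (H p : khom _ _) x + val (H q : khom _ _) x.
  by rewrite linearD.
have H3 c x p : val (H p : khom _ _) (conv_scalar B c *: x) = c *: (val (H p : khom _ _) x).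
  by exact: (linearZZ (mklin (HL p))).
have H4 x (b : B) p : val (H p : khom _ _) ((b : B^c) *: x) = val (H (tens b 1 *: p) : khom _ _) x.
  by rewrite linearZZ bimod_tens /= scale1r.
pose h0 : {linear tensor0 C P -> kr M} := tlift (F := fun x p => val (H p : khom _ _) x : kr M) H1 H2 H3 H4.
have h0E x p : h0 (tmap x p) = val (H p : khom _ _) x by exact: tliftE.
have hL : linear (h0 : tensor C P -> M).
  apply: tensor_linear => x p b; rewrite !h0E linearZZ bimod_tens /=.
  by rewrite scale1r.
pose h := mklin hL; have hE x p : h (tmap x p) = val (H p : khom _ _) x by exact: h0E.
exists h => z; have ghf := @tensor_ext _ _ _ _ _ (kres_map (conv_scalar B) (g \o h : {linear _ -> _}) 
  \o mklin (@tensor_kres_linear k B C P)) f0.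
apply: ghf => x p; change (g (h (tmap x p)) = f0 (tmap x p)); rewrite hE.
exact: (congr1 (fun h1 : khom (kr C) (kr N) => val h1 x) (HE p)).
Qed.

Lemma tensor_regbim_pd d : pd_le d (tensor C (regbim B) : lmodType B^c) -> pd_le d C.
Proof.
have iL : linear (fun x : C => tmap x ((1 : B) : regbim B) : tensor C (regbim B)).
  move=> b x y; rewrite tmapDl tensor_scaleE tmap_bal; congr (tmap x _ + _).
  by rewrite !regbim_tens !mul1r !mulr1.
have rDl (x y : C) (p : regbim B) : (p : B^c) *: (x + y) = (p : B^c) *: x + (p : B^c) *: y.
  exact: scalerDr.
have rDr (x : C) (p q : regbim B) : ((p + q : regbim B) : B^c) *: x = (p : B^c) *: x + (q : B^c) *: x.
  exact: scalerDl.
have rZ c (x : C) (p : regbim B) : (p : B^c) *: (conv_scalar B c *: x) = c *: (((p : B^c) *: x : C) : kr C).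
  by rewrite kresZ conv_scaleC.
have rbal (x : C) (b : B) (p : regbim B) : (p : B^c) *: ((b : B^c) *: x) = ((tens b 1 *: p : regbim B) : B^c) *: x.
  by rewrite scalerA regbim_tens mulr1.
pose r0 : {linear tensor0 C (regbim B) -> kr C} :=
  tlift (F := fun x (p : regbim B) => ((p : B^c) *: x : C) : kr C) rDl rDr rZ rbal.
have r0E x (p : regbim B) : r0 (tmap x p) = (p : B^c) *: x by exact: tliftE.
have rL : linear (r0 : tensor C (regbim B) -> C).
  apply: tensor_linear => x p b; rewrite !r0E scalerA; congr (_ *: x).
  by rewrite regbim_tens mul1r.
apply: (@pd_le_iso _ d _ _ (mklin iL) (mklin rL)) => x.
by rewrite [LHS]r0E scale1r.
Qed.

(** The sequence from the kernel of a cover to [X] splits on the left, so it stays exact after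
    tensoring with [C]; left projectivity passes to the kernel and the induction continues. *)
Lemma tensor_pd d X : left_projective X -> pd_le d X ->
  pd_le d (tensor C X : lmodType B^c).
Proof.
elim: d X => [|d IHd] X lpX; first exact: tensor_projective.
case=> P [f [projP f_surj pdK]].
have [s [sL sK]] := left_linear_section lpX f_surj.
have [r [rL rE]] := left_linear_retraction sL sK.
have [F FE] := tensor_map (linear_left_linear f).
have [S SE] := tensor_map sL; have [T TE] := tensor_map rL.
have [J JE] := tensor_map (linear_left_linear (val : {linear kermod f -> P})).
have lin_act (P1 P2 : lmodType E) (h : {linear P1 -> P2})
    (h0 : {linear tensor0 C P1 -> tensor0 C P2}) :
    (forall x p, h0 (tmap x p) = tmap x (h p)) ->
    linear (h0 : tensor C P1 -> tensor C P2).
  move=> h0E; have h0Z (b : B^c) (z : tensor C P1) :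
      h0 (b *: z) = b *: (h0 z : tensor C P2).
    apply: (@tensor_ext _ _ _ _ _ (h0 \o tract C P1 b : {linear _ -> _})
      (tract C P2 b \o h0 : {linear _ -> _})) => x p.
    change (h0 (tract C P1 b (tmap x p)) = tract C P2 b (h0 (tmap x p))).
    by rewrite h0E !tractE h0E linearZZ.
  move=> b z w; apply: (etrans (raddfD h0 _ _)).
  exact: (congr1 (fun u : tensor C P2 => u + h0 w) (h0Z b z)).
have FL := lin_act _ _ _ _ FE; have JL := lin_act _ _ _ _ JE.
have STL : linear (fun z => S (F z) + J (T z)).
  by move=> c u v; rewrite !linearP scalerDr addrACA.
(* The left splitting survives tensoring; with [FJ0] and [TJ] it identifies the kernel of [F] with
   the image of [J]. *)
have STE z : S (F z) + J (T z) = z.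
  apply: (tensor_ext (f := mklin STL) (g := idfun)) => x p.
  change (S (F (tmap x p)) + J (T (tmap x p)) = tmap x p).
  rewrite FE SE TE JE -tmapDr; congr tmap.
  by have := rE p => /= ->; rewrite addrC subrK.
have zeroL : linear (fun _ : tensor0 C (kermod f) => 0 : tensor0 C X).
  by move=> c u v; rewrite scaler0 addr0.
have FJ0 z : F (J z) = 0.
  apply: (tensor_ext (f := F \o J : {linear _ -> _}) (g := mklin zeroL)) => x p.
  rewrite /= JE FE kermodP; apply: (addrI (tmap x (0 : X))).
  by rewrite -tmapDr !addr0.
have TJ z : T (J z) = z.
  apply: (tensor_ext (f := T \o J : {linear _ -> _}) (g := idfun)) => x p.
  rewrite /= JE TE; congr tmap; apply: val_inj.
  have [sB _] := sL; have /= s0 := raddf0 (mkadd sB).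
  by rewrite rE kermodP s0 subr0.
pose jF : {linear tensor C (kermod f) -> tensor C P} := mklin JL.
pose fF : {linear tensor C P -> tensor C X} := mklin FL.
have jk z : fF (jF z) = 0 by exact: FJ0.
pose j := to_ker jk.
have ij (z : kermod fF) : j (T (val z)) = z.
  apply: val_inj; change (J (T (val z)) = val z).
  rewrite -[RHS](STE (val z)) (_ : F (val z) = 0) ?linear0 ?add0r //.
  exact: (kermodP z).
have iL : linear (fun z : kermod fF => T (val z) : tensor C (kermod f)).
  move=> b z w; rewrite -{1}(ij z) -{1}(ij w) -linearP.
  exact: TJ.
exists (tensor C P), fF; split; first exact: tensor_projective.
  move=> z; have FS : F (S z) = z.
    apply: (tensor_ext (f := F \o S : {linear _ -> _}) (g := idfun)) => x p.
    by rewrite /= SE FE sK.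
  by exists (S z).
apply: (pd_le_iso (i := mklin iL) (r := j)); first exact: ij.
apply: IHd => //; exact: left_projective_ker.
Qed.

End TensorFunctor.

(** Tensoring a bimodule resolution of B with [C] over B resolves C (x)_B B, which is [C]. *)
Theorem gldim_le_pd (k : fieldType) (B : algType k) d :
  pd_le d (regbim B : lmodType (env B)) -> gldim_le B d.
Proof.
move=> pdB C; apply/pd_le_pdim/tensor_regbim_pd.
by apply: tensor_pd => //; apply: left_projective_regbim.
Qed.

(** * Finitely generated resolutions and Rees' theorem *)

Section FiniteResolutions.
Variable R : nzRingType.

Lemma lext_fin (K : finType) (V : lmodType R) (h : K -> V) (f : {malg R[K]}) :
  lext h f = \sum_x f@_x *: h x.
Proof.
elim/malg_ind: f => [|a f g IHf IHg|x].
- by rewrite linear0 big1 // => x _; rewrite mcoeff0 scale0r.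
- rewrite linearP /= IHf IHg scaler_sumr -big_split /=; apply: eq_bigr => x _.
  by rewrite mcoeffD mcoeffZ scalerDl scalerA.
rewrite lextU (bigD1 x) //= mcoeffUU scale1r big1 ?addr0 // => y /negPf yx.
by rewrite mcoeffU eq_sym yx scale0r.
Qed.

Lemma fin_gen_dual_basis (Z : lmodType R) : fin_gen Z -> projective Z ->
  exists m (s : 'I_m -> Z) (u : 'I_m -> {linear Z -> R^o}),
    forall z, z = \sum_(l < m) (u l z : R) *: s l.
Proof.
move=> [m [s s_gen]] projZ.
have [z|h hE] := projZ _ _ (@lext R 'I_m Z s) (idfun : {linear Z -> Z}).
  have [c ->] := s_gen z; exists (\sum_i c i *: << i >>).
  by rewrite linear_sum; apply: eq_bigr => i _; rewrite linearZ /= lextU.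
have cL l : linear (fun z => mcoeff l (h z) : R^o).
  by move=> a x y; rewrite linearP mcoeffD mcoeffZ.
exists m, s, (fun l => mklin (cL l)) => z.
by have := hE z; rewrite /= lext_fin => /esym.
Qed.

Lemma fin_gen_image (P Z : lmodType R) (f : {linear P -> Z}) :
  fin_gen P -> (forall y, exists x, f x = y) -> fin_gen Z.
Proof.
move=> [m [s s_gen]] f_surj; exists m, (f \o s) => z.
have [x <-] := f_surj z; have [c ->] := s_gen x; exists c.
by rewrite linear_sum; apply: eq_bigr => i _; rewrite linearZ.
Qed.

(** A retraction onto the kernel splits the sequence: p - r p depends only on e p, and this defines
    the section [t]. *)
Lemma projective_coker (P X : lmodType R) (e : {linear P -> X})
    (r : {linear P -> kermod e}) : projective P ->
  (forall y, exists x, e x = y) -> (forall z, r (val z) = z) -> projective X.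
Proof.
move=> projP e_surj rK; have [s sE] := choice e_surj.
pose t x := s x - val (r (s x)).
have tE p : p - val (r p) = t (e p).
  have ps0 : e (p - s (e p)) = 0 by rewrite linearB sE subrr.
  have := rK (mkker ps0); rewrite linearB => /(congr1 val) /= E.
  rewrite /t; apply/eqP; rewrite subr_eq addrAC eq_sym subr_eq.
  by move/eqP: E; rewrite subr_eq addrAC eq_sym subr_eq [_ + s _]addrC eq_sym.
have tL : linear t.
  move=> a x y; rewrite -[x]sE -[y]sE -linearP -!tE !linearP /=.
  by rewrite scalerDr addrACA.
apply: (projective_retract (i := mklin tL) (r := e)) projP => x.
by rewrite /= /t linearB kermodP subr0 sE.
Qed.

(** By induction the first syzygy is projective, and it is finitely generated, so it has a finite
    dual basis. The coordinates extend to the term of degree 0 because Ext^1 vanishes, and together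
    they retract it onto the syzygy. *)
Lemma fg_resolution_projective N (M : lmodType R) (P : resolution M) :
  (forall i, projective (P i) /\ fin_gen (P i)) -> res_length_le P N ->
  (forall i, (0 < i)%N -> hom_exact P i) -> projective M.
Proof.
elim: N M P => [|N IHN] M P fgP P0 exP.
  by apply: projective_res0 P0; apply: (fgP 0%N).1.
have projK : projective (kermod (res_aug P)).
  apply: (IHN _ (res_shift P)) => [i|i ltNi x|[//|i] _].
  - exact: fgP.
  - exact: P0.
  exact: (exP i.+2).
have fgK := fin_gen_image (fgP 1%N).2 (@shift_aug_surj _ _ P).
have [m [s [u uE]]] := fin_gen_dual_basis fgK projK.
(* Seen on the term of degree 1, the coordinate [u l] is a cocycle. *)
have g_ex l : exists g : {linear P 0%N -> R^o},
    forall x, u l (shift_aug P x) = g (res_diff P 0 x).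
  apply: (exP 1%N isT (u l \o shift_aug P : {linear _ -> _})) => x.
  change (u l (shift_aug P (res_diff P 1 x)) = 0).
  by rewrite (_ : shift_aug P _ = 0) ?linear0 //; apply/shift_exact0; exists x.
have [g gE] := choice g_ex.
have rL : linear (fun p => \sum_(l < m) (g l p : R) *: s l).
  move=> a x y; rewrite scaler_sumr -big_split /=; apply: eq_bigr => l _.
  by rewrite linearP scalerDl scalerA.
apply: (projective_coker (r := mklin rL)) (fgP 0%N).1 (@res_aug_surj _ _ P) _ => z /=.
have [x <-] := shift_aug_surj z; rewrite [RHS]uE.
by apply: eq_bigr => l _; rewrite gE.
Qed.

(** Dimension shifting: passing to the first syzygy lowers by one the degree above which Ext
    vanishes. *)
Lemma fg_resolution_pd d N (M : lmodType R) (P : resolution M) :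
  (forall i, projective (P i) /\ fin_gen (P i)) -> res_length_le P N ->
  (forall i, (d < i)%N -> hom_exact P i) -> pd_le d M.
Proof.
elim: d M P => [|d IHd] M P fgP PN exP; first exact: fg_resolution_projective PN exP.
exists (P 0%N), (res_aug P); split; [exact: (fgP 0%N).1|exact: res_aug_surj|].
apply: (IHd _ (res_shift P)) => [i|i ltNi x|[//|i] ltdi].
- exact: fgP.
- by apply: PN; apply: leqW.
exact: (exP i.+2).
Qed.

End FiniteResolutions.

(** * Ext and central regular sequences *)

Section RegularSequence.
Variables (R : nzRingType) (M : lmodType R) (z1 z2 kappa : R) (m0 : M).
Hypothesis z1C : forall r, r * z1 = z1 * r.
Hypothesis z2C : forall r, r * z2 = z2 * r.
Hypothesis z1_reg : forall r, z1 * r = 0 -> r = 0.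
Hypothesis z2_reg : forall r, z2 * r = 0 -> r = 0.
Hypothesis z12_reg : forall a b, z1 * a = z2 * b ->
  exists c, a = z2 * c /\ b = z1 * c.
Hypothesis z1M : z1 *: m0 = 0.
Hypothesis m0_gen : forall m, exists r, r *: m0 = m.
Hypothesis kappaP : forall r, r *: m0 = 0 ->
  exists a b, r * kappa = z1 * a + z2 * b.

(* Rees: for a regular sequence of central elements annihilating [M],     *)
(* [Hom(M, R/(z1, z2))], which contains the class of [kappa], is a         *)
(* subquotient of the first two Ext groups.                                *)
Lemma hom_exact_regular_sequence :
  hom_exact (std_res M) 1 -> hom_exact (std_res M) 2 ->
  exists a b, kappa = z1 * a + z2 * b.
Proof.
set P := std_res M => ex1 ex2; have projP := @std_res_projective R M.
have [rho rhoE] := choice m0_gen.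
(* [l] lifts the augmentation to [R] in the sense of [lE]; by [kappaP], the form [c0] = l kappa is
   then a cocycle modulo (z1, z2). *)
pose l : {linear P 0%N -> R^o} := @lext R M R^o rho.
have lE p : (l p : R) *: m0 = res_aug P p.
  elim/malg_ind: p => [|a u v IHu IHv|m].
  - by rewrite !linear0 scale0r.
  - by rewrite !linearP scalerDl -scalerA IHu IHv.
  by rewrite /l /= /std_cover !lextU rhoE.
have c0L : linear (fun p => (l p : R) * kappa : R^o).
  by move=> a x y; rewrite linearP mulrDl -mulrA.
pose c0 := mklin c0L.
have zL : linear (fun t : (R^o * R^o)%type => z1 * (t.1 : R) + z2 * (t.2 : R) : R^o).
  move=> a [x1 x2] [y1 y2]; change (z1 * (a * x1 + y1) + z2 * (a * x2 + y2) =
    a * (z1 * x1 + z2 * x2) + (z1 * y1 + z2 * y2) :> R).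
  by rewrite !mulrDr !mulrA z1C z2C addrACA.
have [y|g gE] := projective_lift (g := mklin zL)
    (f := c0 \o res_diff P 0 : {linear _ -> _}) (projP 1%N).
  have [|a [b abE]] := kappaP (r := l (res_diff P 0 y)).
    by rewrite lE; apply/res_exact0; exists y.
  by exists (a, b); rewrite /= abE.
have wL : linear (fun c : R^o => (z2 * (c : R), - (z1 * (c : R))) : (R^o * R^o)%type).
  move=> a x y; congr pair.
    by change (z2 * (a * x + y) = a * (z2 * x) + z2 * y :> R); rewrite mulrDr !mulrA z2C.
  change (- (z1 * (a * x + y)) = a * - (z1 * x) - z1 * y :> R).
  by rewrite mulrDr opprD mulrN !mulrA z1C.
(* Since c0 d = z1 g1 + z2 g2 vanishes on boundaries, regularity makes g d a multiple [h] of the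
   syzygy (z2, - z1); this [h] is a 2-cocycle, hence a coboundary. *)
have [y|h hE] := projective_lift (g := mklin wL)
    (f := g \o res_diff P 1 : {linear _ -> _}) (projP 2%N).
  have := gE (res_diff P 1 y); rewrite /= -[X in l X]/(res_diff P 0 _).
  rewrite res_diffS linear0 mul0r => /eqP; rewrite addr_eq0 -mulrN => /eqP E.
  have [c [c1 c2]] := z12_reg E; exists c; rewrite /= -c1 -c2 opprK.
  by rewrite -surjective_pairing.
have h1 y : (g (res_diff P 1 y)).1 = z2 * (h y : R) by rewrite -[g _]hE.
have h2 y : (g (res_diff P 1 y)).2 = - (z1 * (h y : R)) by rewrite -[g _]hE.
have hd y : h (res_diff P 2 y) = 0.
  by apply: z2_reg; rewrite -h1 res_diffS linear0.
have [h' h'E] := ex2 h hd.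
(* Corrected by [h'], the two components of [g] become 1-cocycles, hence coboundaries. *)
have k1L : linear (fun y => (g y).1 - z2 * (h' y : R) : R^o).
  move=> a x y; rewrite !linearP.
  change (a * (g x).1 + (g y).1 - z2 * (a * h' x + h' y) =
    a * ((g x).1 - z2 * h' x) + ((g y).1 - z2 * h' y) :> R).
  by rewrite mulrDr opprD mulrBr !mulrA z2C addrACA.
have k2L : linear (fun y => (g y).2 + z1 * (h' y : R) : R^o).
  move=> a x y; rewrite !linearP.
  change (a * (g x).2 + (g y).2 + z1 * (a * h' x + h' y) =
    a * ((g x).2 + z1 * h' x) + ((g y).2 + z1 * h' y) :> R).
  by rewrite !mulrDr !mulrA z1C addrACA.
have [y|k1 k1E] := ex1 (mklin k1L).
  by rewrite /= [X in X.1]/(g _) h1 h'E subrr.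
have [y|k2 k2E] := ex1 (mklin k2L).
  by rewrite /= h2 h'E addNr.
(* [c] is a true 0-cocycle, congruent to [c0] modulo (z1, z2). *)
have cL : linear (fun p => (c0 p : R) - (z1 * (k1 p : R) + z2 * (k2 p : R)) : R^o).
  move=> a x y; rewrite !linearP.
  change (a * c0 x + c0 y - (z1 * (a * k1 x + k1 y) + z2 * (a * k2 x + k2 y)) =
    a * (c0 x - (z1 * k1 x + z2 * k2 x)) + (c0 y - (z1 * k1 y + z2 * k2 y)) :> R).
  rewrite !mulrDr mulrN mulrDr !mulrA z1C z2C [RHS]addrACA -opprD.
  by congr (_ - _); rewrite addrACA.
pose c := mklin cL.
have cd y : c (res_diff P 0 y) = 0.
  rewrite /= -[X in X - _]gE /= -[k1 _]k1E -[k2 _]k2E /=.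
  rewrite mulrBr mulrDr !mulrA addrACA z1C [- _ + _]addrC subrr addr0.
  by rewrite subrr.
have [p pE] := res_aug_surj P m0.
(* z1 p lies over z1 m0 = 0, so it is a boundary and z1 c(p) = c(z1 p) = 0. Then l(p) kappa lies in
   (z1, z2), and so does (1 - l(p)) kappa because 1 - l(p) kills [m0]. *)
have cp0 : c p = 0.
  apply: z1_reg; have [|y yE] := (@res_exact0 _ _ P (z1 *: p)).1.
    by rewrite linearZZ pE.
  by have := cd y; rewrite yE linearZZ.
have [|a [b abE]] := kappaP (r := 1 - l p).
  by rewrite scalerBl lE pE scale1r subrr.
exists (a + k1 p), (b + k2 p); rewrite !mulrDr addrACA -abE mulrBl mul1r.
by move/eqP: cp0; rewrite subr_eq0 => /eqP /= <-; rewrite subrK.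
Qed.

End RegularSequence.

(** * Ext computed by evaluation at a generator *)

Section ExtIso.
Variables (R : nzRingType) (M : lmodType R) (P : resolution M) (j : nat).
Hypothesis projP : projective_resolution P.
Variables (U : zmodType) (theta : {additive R -> U}) (gen : P j.+1).
Hypothesis theta0 : forall g : {linear P j -> R^o}, theta (g (res_diff P j gen)) = 0.
Hypothesis theta_inj : forall f : {linear P j.+1 -> R^o},
  (forall x, f (res_diff P j.+1 x) = 0) -> theta (f gen) = 0 -> cobounds f.
Hypothesis theta_surj : forall u, exists f : {linear P j.+1 -> R^o},
  (forall x, f (res_diff P j.+1 x) = 0) /\ theta (f gen) = u.

(** Up to coboundaries a cocycle on [P] is known from the image under [theta] of its value at [gen].
    The isomorphism is given as evaluation at one element [u0] of the standard resolution, so that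
    the right action of [R] can be followed through it. *)
Lemma Ext_iso : exists (u0 : std_term M j.+1) (F : {additive Ext M j.+1 -> U}),
  bijective F /\ forall c : cocycle M j.+1,
    F (qpi (coboundary M j.+1) c) = theta ((val c : std_term M j.+1 -> R) u0).
Proof.
have projS := @std_res_projective R M.
have [u [u_aug ud]] := chain_map_exists P projS.
have [v [v_aug vd]] := chain_map_exists (std_res M) projP.
pose u0 : std_term M j.+1 := v j.+1 gen.
have theta_cob (c : std_res M j.+1 -> R) : cobounds c -> theta (c u0) = 0.
  move=> [g gE]; rewrite gE /u0 -vd.
  exact: (theta0 (g \o v j : {linear _ -> _})).
pose F (e : Ext M j.+1) : U := theta ((val (qrepr e) : std_term M j.+1 -> R) u0).
have FE c : F (qpi (coboundary M j.+1) c) = theta ((val c : std_term M j.+1 -> R) u0).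
  apply/eqP; rewrite -subr_eq0 -raddfB.
  set c' := qrepr _; have cc' : qpi (coboundary M j.+1) (c' - c) = 0.
    by apply/eqP; rewrite linearB subr_eq0; apply/eqP; exact: qreprK.
  by move/Ext_class0: cc' => /theta_cob /= E; apply/eqP; rewrite -[RHS]E.
have FB : zmod_morphism F.
  move=> x y; rewrite -[x]qreprK -[y]qreprK -linearB !FE -raddfB.
  reflexivity.
exists u0, (mkadd FB); split=> //.
have F_inj : injective F.
  move=> x y /eqP; rewrite -subr_eq0 -FB => /eqP Fxy; apply/eqP.
  rewrite -subr_eq0; move: (x - y) Fxy => e; rewrite -[e]qreprK FE => E.
  apply/eqP/Ext_class0; set c := qrepr e in E *.
  have [cL cd] := cocycleP c; pose f := mklin cL.
  have fvB : cobounds (fun x => f (v j.+1 x)).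
    apply: (theta_inj (f := f \o v j.+1 : {linear _ -> _})) => // z.
    by rewrite /= -[v j.+1 _]/(v j.+1 (res_diff P j.+1 z)) vd [LHS]cd.
  have fvuB := cobounds_chain_map ud fvB.
  have := cobounds_homotopic (u := fun i => v i \o u i : {linear _ -> _}) (f := f) projS.
  move=> /(_ _ _ cd) H; have {}H := H (fun x => etrans (v_aug _) (u_aug x)).
  have {}H := H (fun i x => etrans (congr1 (v i) (ud i x)) (vd i _)).
  apply: cobounds_ext (cobounds_sum fvuB H) => x' /=.
  by rewrite opprB addrC subrK.
have F_surj u1 : exists e, F e = u1.
  have [f [fd fE]] := theta_surj u1.
  have [|c cE] := cocycle_intro (f := f \o u j.+1 : {linear std_res M j.+1 -> R^o}).
    by move=> x; rewrite /= -[u j.+1 _]/(u j.+1 (res_diff (std_res M) j.+1 x)) ud fd.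
  exists (qpi (coboundary M j.+1) c); rewrite FE cE /= /u0 -fE.
  apply/eqP; rewrite -subr_eq0 -raddfB; apply/eqP.
  have := cobounds_homotopic (u := fun i => u i \o v i : {linear _ -> _}) (f := f) projP.
  move=> /(_ _ _ fd) H; have {}H := H (fun x => etrans (u_aug _) (v_aug x)).
  have [g gE] := H (fun i x => etrans (congr1 (u i) (vd i x)) (ud i _)).
  by rewrite [X in theta X]gE theta0.
by have [G GE] := choice F_surj; exists G => // x; apply: F_inj; rewrite GE.
Qed.

End ExtIso.

(** * Algebras with a monomial basis and their Koszul resolution *)

Section Homotopy.
Variables (k : comNzRingType) (B : algType k) (mu nu delta : {linear B -> B}).
Local Notation E := (env B).
Hypothesis delta_nil : forall a, exists J, iter J delta a = 0.

Lemma iter_linear (f : {linear B -> B}) j : linear (iter j f).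
Proof. by move=> c a b; elim: j => //= j ->; rewrite linearP. Qed.

Lemma iter_delta0 a J J' : iter J delta a = 0 -> (J <= J')%N -> iter J' delta a = 0.
Proof.
move=> aJ /subnK <-; rewrite iterD aJ.
by have /= -> := linear0 (mklin (iter_linear delta (J' - J))).
Qed.

(** A truncation of the geometric series in delta (x) nu, applied after delta (x) 1; it is complete
    once delta^J a = 0. *)
Definition homotopy_sum J (a b : B) : E :=
  \sum_(j < J) tens (iter j.+1 delta a) (iter j nu b).

Lemma homotopy_sum_stable a b J J' : iter J delta a = 0 -> iter J' delta a = 0 ->
  homotopy_sum J a b = homotopy_sum J' a b.
Proof.
wlog leJ : J J' / (J <= J')%N.
  by move=> H aJ aJ'; case/orP: (leq_total J J') => /H -> //.
move=> aJ _; rewrite /homotopy_sum (big_ord_widen J' (fun j =>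
  tens (iter j.+1 delta a) (iter j nu b)) leJ) [RHS](bigID (fun j : 'I_J' => (j < J)%N)) /=.
rewrite [X in _ = _ + X]big1 ?addr0 // => j; rewrite -leqNgt => leJj.
by rewrite -iterS (iter_delta0 aJ (leqW leJj)) tens0l.
Qed.

Lemma homotopy_exists_env : exists H : {linear E -> E}, forall a b J,
  iter J delta a = 0 -> H (tens a b) = homotopy_sum J a b.
Proof.
have [N NE] := choice delta_nil.
pose F a b := homotopy_sum (N a) a b.
have FE a b J : iter J delta a = 0 -> F a b = homotopy_sum J a b.
  by move=> aJ; apply: homotopy_sum_stable.
have FL b : linear (F^~ b).
  move=> c a a'; pose J := maxn (N a) (N a').
  have aJ : iter J delta a = 0 by apply: iter_delta0 (NE a) (leq_maxl _ _).
  have aJ' : iter J delta a' = 0 by apply: iter_delta0 (NE a') (leq_maxr _ _).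
  rewrite !(FE _ _ J) //; last by rewrite iter_linear aJ aJ' scaler0 addr0.
  rewrite /homotopy_sum scaler_sumr -big_split /=; apply: eq_bigr => j _.
  by rewrite -!iterS iter_linear tensPl.
have FR a : linear (F a).
  move=> c b b'; rewrite /F /homotopy_sum scaler_sumr -big_split /=.
  by apply: eq_bigr => j _; rewrite iter_linear tensPr.
by exists (env_lift FL FR) => a b J aJ; rewrite env_liftE (FE _ _ J).
Qed.

Hypothesis delta_mu : forall a, delta (mu a) = a.

(** With D = mu (x) 1 - 1 (x) nu, one has (delta (x) 1) D = 1 - delta (x) nu, which the geometric
    series inverts because [delta] is locally nilpotent. The series commutes with any D' whose two
    maps commute with [delta] and [nu]. *)
Lemma homotopy_left_inverse (D : {linear E -> E}) :
  (forall a b, D (tens a b) = tens (mu a) b - tens a (nu b)) ->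
  exists2 H : {linear E -> E}, cancel D H &
    forall (mu' nu' : {linear B -> B}) (D' : {linear E -> E}),
      (forall a b, D' (tens a b) = tens (mu' a) b - tens a (nu' b)) ->
      (forall a, delta (mu' a) = mu' (delta a)) ->
      (forall b, nu (nu' b) = nu' (nu b)) ->
      forall w, H (D' w) = D' (H w).
Proof.
move=> DE; have [H HE] := homotopy_exists_env; exists H => [w|mu' nu' D' D'E dm nn w].
  apply: (env_linear_ext (f := H \o D : {linear _ -> _}) (g := idfun)) => a b.
  have [J aJ] := delta_nil a.
  have aJ1 : iter J.+1 delta (mu a) = 0 by rewrite iterSr delta_mu.
  rewrite /= DE linearB (HE _ _ _ aJ1) (HE _ _ _ aJ).
  rewrite /homotopy_sum big_ord_recl /= delta_mu -[RHS]addr0 -addrA.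
  congr (_ + _); apply/eqP; rewrite subr_eq0; apply/eqP.
  apply: eq_bigr => j _.
  change (tens (iter j.+2 delta (mu a)) (iter j.+1 nu b) =
    tens (iter j.+1 delta a) (iter j nu (nu b))).
  by rewrite (iterSr j.+1) delta_mu (iterSr j nu).
have iter_comm j a : iter j delta (mu' a) = mu' (iter j delta a).
  by elim: j => //= j ->; rewrite dm.
have iter_comm' j b : iter j nu (nu' b) = nu' (iter j nu b).
  by elim: j => //= j ->; rewrite nn.
apply: (env_linear_ext (f := H \o D' : {linear _ -> _})
  (g := D' \o H : {linear _ -> _})) => a b.
have [J aJ] := delta_nil a.
have aJ' : iter J delta (mu' a) = 0 by rewrite iter_comm aJ linear0.
rewrite /= D'E linearB (HE _ _ _ aJ') !(HE _ _ _ aJ).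
rewrite /homotopy_sum -sumrB (linear_sum D'); apply: eq_bigr => j _.
by rewrite D'E (iter_comm j.+1) iter_comm'.
Qed.

End Homotopy.

(** Applying [H1] to the equation gives f = D2 (H1 g), as [H1] commutes with [D2]; injectivity of
    [D2] then gives g = D1 (H1 g). *)
Lemma regular_pair (V : zmodType) (D1 D2 H1 H2 : {additive V -> V}) :
  cancel D1 H1 -> cancel D2 H2 -> (forall w, H1 (D2 w) = D2 (H1 w)) ->
  (forall w, D1 (D2 w) = D2 (D1 w)) ->
  forall f g, D1 f = D2 g -> exists h, f = D2 h /\ g = D1 h.
Proof.
move=> HD1 HD2 HDC DC f g E; exists (H1 g).
have fE : f = D2 (H1 g) by rewrite -HDC -E HD1.
by split=> //; apply: (can_inj HD2); rewrite -E -DC -fE.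
Qed.

Lemma env_mull_linear (k : comNzRingType) (B : algType k) (z : env B) :
  linear (fun w : env B => z * w).
Proof. by move=> c v w; rewrite mulrDr scalerAr. Qed.
Lemma env_mulr_linear (k : comNzRingType) (B : algType k) (z : env B) :
  linear (fun w : env B => w * z).
Proof. by move=> c v w; rewrite mulrDl scalerAl. Qed.

Section AlgMul.
Variables (k : comNzRingType) (B : algType k) (a : B).
Fact lmul_linear : linear (fun b : B => a * b).
Proof. by move=> c b b'; rewrite mulrDr scalerAr. Qed.
Fact rmul_linear : linear (fun b : B => b * a).
Proof. by move=> c b b'; rewrite mulrDl scalerAl. Qed.
Definition lmul : {linear B -> B} := mklin lmul_linear.
Definition rmul : {linear B -> B} := mklin rmul_linear.
End AlgMul.

Definition comm_tens (k : comNzRingType) (B : algType k) (a : B) : env B :=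
  tens a 1 - tens 1 a.

Lemma comm_tens_mull (k : comNzRingType) (B : algType k) (z a b : B) :
  comm_tens z * tens a b = tens (z * a) b - tens a (b * z).
Proof. by rewrite mulrBl !tensM !mul1r mulr1. Qed.

Lemma comm_tens_mulr (k : comNzRingType) (B : algType k) (z a b : B) :
  tens a b * comm_tens z = tens (a * z) b - tens a (z * b).
Proof. by rewrite mulrBr !tensM !mulr1 mul1r. Qed.

Lemma comm_tensC (k : comNzRingType) (B : algType k) (a b : B) : a * b = b * a ->
  comm_tens a * comm_tens b = comm_tens b * comm_tens a.
Proof.
move=> abC; rewrite {1 3}/comm_tens !mulrBl !comm_tens_mulr !mul1r !mulr1 abC.
by rewrite !opprB addrACA [RHS]addrACA [- tens a b - _]addrC.
Qed.

Section DivisionPair.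
Variables (k : comNzRingType) (B : algType k) (z1 z2 : B).
Local Notation E := (env B).
Hypothesis zC : z1 * z2 = z2 * z1.

(** [homotopy_left_inverse] applies with division by z as [delta]. *)
Lemma regular_pair_left (d1 d2 : {linear B -> B}) :
  (forall a, exists J, iter J d1 a = 0) -> (forall a, exists J, iter J d2 a = 0) ->
  (forall a, d1 (z1 * a) = a) -> (forall a, d2 (z2 * a) = a) ->
  (forall a, d1 (z2 * a) = z2 * d1 a) ->
  [/\ forall w : E, comm_tens z1 * w = 0 -> w = 0,
      forall w : E, comm_tens z2 * w = 0 -> w = 0 &
      forall f g : E, comm_tens z1 * f = comm_tens z2 * g ->
        exists h, f = comm_tens z2 * h /\ g = comm_tens z1 * h].
Proof.
move=> nil1 nil2 dz1 dz2 dC.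
pose D1 := mklin (env_mull_linear (comm_tens z1)).
pose D2 := mklin (env_mull_linear (comm_tens z2)).
have D1E a b : D1 (tens a b) = tens (lmul z1 a) b - tens a (rmul z1 b).
  exact: comm_tens_mull.
have D2E a b : D2 (tens a b) = tens (lmul z2 a) b - tens a (rmul z2 b).
  exact: comm_tens_mull.
have [H1 HD1 H1C] := homotopy_left_inverse (mu := lmul z1) (nu := rmul z1) nil1 dz1 D1E.
have [H2 HD2 _] := homotopy_left_inverse (mu := lmul z2) (nu := rmul z2) nil2 dz2 D2E.
have ztC := comm_tensC zC.
split=> [w zw|w zw|f g zfg].
- by rewrite -[w]HD1 -[D1 w]/(comm_tens z1 * w) zw linear0.
- by rewrite -[w]HD2 -[D2 w]/(comm_tens z2 * w) zw linear0.
apply: (regular_pair (D1 := D1) (D2 := D2) HD1 HD2) => // w.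
  by apply: (H1C _ _ _ D2E) => // b /=; rewrite -!mulrA zC.
by rewrite /= !mulrA ztC.
Qed.

Lemma regular_pair_right (d1 d2 : {linear B -> B}) :
  (forall a, exists J, iter J d1 a = 0) -> (forall a, exists J, iter J d2 a = 0) ->
  (forall a, d1 (a * z1) = a) -> (forall a, d2 (a * z2) = a) ->
  (forall a, d1 (a * z2) = d1 a * z2) ->
  [/\ forall w : E, w * comm_tens z1 = 0 -> w = 0,
      forall w : E, w * comm_tens z2 = 0 -> w = 0 &
      forall f g : E, f * comm_tens z1 = g * comm_tens z2 ->
        exists h, f = h * comm_tens z2 /\ g = h * comm_tens z1].
Proof.
move=> nil1 nil2 dz1 dz2 dC.
pose D1 := mklin (env_mulr_linear (comm_tens z1)).
pose D2 := mklin (env_mulr_linear (comm_tens z2)).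
have D1E a b : D1 (tens a b) = tens (rmul z1 a) b - tens a (lmul z1 b).
  exact: comm_tens_mulr.
have D2E a b : D2 (tens a b) = tens (rmul z2 a) b - tens a (lmul z2 b).
  exact: comm_tens_mulr.
have [H1 HD1 H1C] := homotopy_left_inverse (mu := rmul z1) (nu := lmul z1) nil1 dz1 D1E.
have [H2 HD2 _] := homotopy_left_inverse (mu := rmul z2) (nu := lmul z2) nil2 dz2 D2E.
have ztC := comm_tensC zC.
split=> [w zw|w zw|f g zfg].
- by rewrite -[w]HD1 -[D1 w]/(w * comm_tens z1) zw linear0.
- by rewrite -[w]HD2 -[D2 w]/(w * comm_tens z2) zw linear0.
apply: (regular_pair (D1 := D1) (D2 := D2) HD1 HD2) => // w.
  by apply: (H1C _ _ _ D2E) => // b /=; rewrite !mulrA zC.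
by rewrite /= -!mulrA ztC.
Qed.

End DivisionPair.

(* An algebra with a basis [mb (s, p, q)] playing the role of [e_s x^p y^q], *)
(* where [e_s x = x e_(sigma s)] and [e_s y = y e_(tau s)].                   *)
Record monomial_algebra (k : comNzRingType) (B : algType k) := MonomialAlgebra {
  mS : finType;
  msig : {perm mS};
  mtau : {perm mS};
  msigtau : forall s, msig (mtau s) = mtau (msig s);
  mb : mS * nat * nat -> B;
  mcf : {linear B -> {malg k[(mS * nat * nat)%type]}};
  mcfK : forall a, lext mb (mcf a) = a;
  mbK : forall t, mcf (mb t) = << t >>;
  mbM : forall s p q s' p' q', mb (s, p, q) * mb (s', p', q') =
    if s' == iter p msig (iter q mtau s) then mb (s, (p + p')%N, (q + q')%N) else 0;
  mb1 : 1 = \sum_s mb (s, 0%N, 0%N) }.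

Arguments mb {k B} m t.
Arguments mcf {k B} m.
Arguments mcfK {k B} m a.
Arguments mbK {k B} m t.
Arguments mbM {k B} m.
Arguments mb1 {k B} m.
Arguments msigtau {k B} m s.

Section MonomialAlgebra.
Variables (k : comNzRingType) (B : algType k) (D : monomial_algebra B).
Notation S := (mS D).
Notation sig := (msig D).
Notation tau := (mtau D).
Notation b := (mb D).
Notation E := (env B).

Lemma mb_span a : a = \sum_(t <- msupp (mcf D a)) (mcf D a)@_t *: b t.
Proof. by rewrite -[LHS](mcfK D). Qed.

Lemma mb_ind (P : B -> Prop) : P 0 ->
  (forall c u v, P u -> P v -> P (c *: u + v)) -> (forall t, P (b t)) ->
  forall a, P a.
Proof.
move=> P0 PD Pb a; rewrite [a]mb_span.
by elim/big_rec: _ => // t x _; apply: PD.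
Qed.

Lemma mb_ext (W : lmodType k) (f g : {linear B -> W}) :
  (forall t, f (b t) = g (b t)) -> f =1 g.
Proof.
move=> fg; apply: mb_ind => [|c u v fu fv|//]; first by rewrite !linear0.
by rewrite !linearP fu fv.
Qed.

Definition mlift (W : lmodType k) (h : S * nat * nat -> W) : {linear B -> W} :=
  @lext k _ W h \o mcf D.

Lemma mliftE (W : lmodType k) (h : S * nat * nat -> W) t : mlift h (b t) = h t.
Proof. by rewrite /mlift /= mbK lextU. Qed.

Definition me (s : S) : B := b (s, 0%N, 0%N).
Definition mx : B := \sum_s b (s, 1%N, 0%N).
Definition my : B := \sum_s b (s, 0%N, 1%N).
Local Notation x := mx.
Local Notation y := my.

Lemma mb_x s p q : b (s, p, q) * x = b (s, p.+1, q).
Proof.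
rewrite mulr_sumr (bigD1 (iter p sig (iter q tau s))) //= mbM eqxx addn1 addn0.
rewrite big1 ?addr0 // => r /negPf rs; by rewrite mbM rs.
Qed.
Lemma mb_y s p q : b (s, p, q) * y = b (s, p, q.+1).
Proof.
rewrite mulr_sumr (bigD1 (iter p sig (iter q tau s))) //= mbM eqxx addn1 addn0.
rewrite big1 ?addr0 // => r /negPf rs; by rewrite mbM rs.
Qed.
Lemma me_b r s p q : me r * b (s, p, q) = if s == r then b (s, p, q) else 0.
Proof. by rewrite mbM /= !add0n; case: eqP => // ->. Qed.
Lemma x_mb s p q : x * b (sig s, p, q) = b (s, p.+1, q).
Proof.
rewrite mulr_suml (bigD1 s) //= mbM eqxx add1n add0n.
rewrite big1 ?addr0 // => r /negPf rs; rewrite mbM /=.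
by rewrite (inj_eq perm_inj) eq_sym rs.
Qed.
Lemma y_mb s p q : y * b (tau s, p, q) = b (s, p, q.+1).
Proof.
rewrite mulr_suml (bigD1 s) //= mbM eqxx add1n add0n.
rewrite big1 ?addr0 // => r /negPf rs; rewrite mbM /=.
by rewrite (inj_eq perm_inj) eq_sym rs.
Qed.

Lemma me_idem r s : me r * me s = if s == r then me s else 0.
Proof. exact: me_b. Qed.
Lemma me_x s : me s * x = x * me (sig s).
Proof. by rewrite mb_x -x_mb. Qed.
Lemma me_y s : me s * y = y * me (tau s).
Proof. by rewrite mb_y -y_mb. Qed.
Lemma mxy : x * y = y * x.
Proof.
rewrite -[x * y]mul1r -[y * x]mul1r (mb1 D) [LHS]mulr_suml [RHS]mulr_suml.
apply: eq_bigr => s _.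
by rewrite !mulrA mb_x mb_y mb_y mb_x.
Qed.

(* Division, on either side, kills the monomials that are not divisible. *)
Definition div_xr := mlift (fun t => if t is (s, p.+1, q) then b (s, p, q) else 0).
Definition div_yr := mlift (fun t => if t is (s, p, q.+1) then b (s, p, q) else 0).
Definition div_xl :=
  mlift (fun t => if t is (s, p.+1, q) then b (sig s, p, q) else 0).
Definition div_yl :=
  mlift (fun t => if t is (s, p, q.+1) then b (tau s, p, q) else 0).

Lemma iter_linear_nil (d : {linear B -> B}) :
  (forall t, exists J, iter J d (b t) = 0) -> forall a, exists J, iter J d a = 0.
Proof.
move=> d_nil; apply: mb_ind => [|c u v [J uJ] [J' vJ]|//]; first by exists 0%N.
exists (J + J')%N; rewrite iter_linear (iter_delta0 uJ (leq_addr _ _)).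
by rewrite (iter_delta0 vJ (leq_addl _ _)) scaler0 addr0.
Qed.

Lemma div_xr_nil a : exists J, iter J div_xr a = 0.
Proof.
apply: iter_linear_nil a => -[[s p] q]; exists p.+1.
by elim: p => [|p IHp]; rewrite iterSr [div_xr _]mliftE.
Qed.
Lemma div_yr_nil a : exists J, iter J div_yr a = 0.
Proof.
apply: iter_linear_nil a => -[[s p] q]; exists q.+1.
by elim: q => [|q IHq]; rewrite iterSr [div_yr _]mliftE.
Qed.
Lemma div_xl_nil a : exists J, iter J div_xl a = 0.
Proof.
apply: iter_linear_nil a => -[[s p] q]; exists p.+1.
by elim: p s => [|p IHp] s; rewrite iterSr [div_xl _]mliftE.
Qed.
Lemma div_yl_nil a : exists J, iter J div_yl a = 0.
Proof.
apply: iter_linear_nil a => -[[s p] q]; exists q.+1.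
by elim: q s => [|q IHq] s; rewrite iterSr [div_yl _]mliftE.
Qed.

Lemma mb_ext_id (f : {linear B -> B}) : (forall t, f (b t) = b t) -> f =1 id.
Proof. by move=> fb; apply: (mb_ext (g := idfun)). Qed.

Lemma div_xrK a : div_xr (a * x) = a.
Proof.
apply: (mb_ext_id (f := div_xr \o rmul x : {linear _ -> _})) => -[[s p] q] /=.
by rewrite mb_x [LHS]mliftE.
Qed.
Lemma div_yrK a : div_yr (a * y) = a.
Proof.
apply: (mb_ext_id (f := div_yr \o rmul y : {linear _ -> _})) => -[[s p] q] /=.
by rewrite mb_y [LHS]mliftE.
Qed.
Lemma x_mbV s p q : x * b (s, p, q) = b (sig^-1%g s, p.+1, q).
Proof. by rewrite -{1}[s](permKV sig) x_mb. Qed.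
Lemma y_mbV s p q : y * b (s, p, q) = b (tau^-1%g s, p, q.+1).
Proof. by rewrite -{1}[s](permKV tau) y_mb. Qed.
Lemma div_xlK a : div_xl (x * a) = a.
Proof.
apply: (mb_ext_id (f := div_xl \o lmul x : {linear _ -> _})) => -[[s p] q] /=.
by rewrite x_mbV [LHS]mliftE permKV.
Qed.
Lemma div_ylK a : div_yl (y * a) = a.
Proof.
apply: (mb_ext_id (f := div_yl \o lmul y : {linear _ -> _})) => -[[s p] q] /=.
by rewrite y_mbV [LHS]mliftE permKV.
Qed.
Lemma div_xr_y a : div_xr (a * y) = div_xr a * y.
Proof.
apply: (mb_ext (f := div_xr \o rmul y : {linear _ -> _})
  (g := rmul y \o div_xr : {linear _ -> _})) => -[[s p] q] /=.
rewrite mb_y [LHS]mliftE [X in _ = X * y](mliftE _ (s, p, q)).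
case: p => [|p]; first by rewrite mul0r.
by rewrite mb_y.
Qed.
Lemma sigtauV s : sig (tau^-1%g s) = tau^-1%g (sig s).
Proof. by apply: (@perm_inj _ tau); rewrite -msigtau !permKV. Qed.
Lemma div_xl_y a : div_xl (y * a) = y * div_xl a.
Proof.
apply: (mb_ext (f := div_xl \o lmul y : {linear _ -> _})
  (g := lmul y \o div_xl : {linear _ -> _})) => -[[s p] q] /=.
rewrite y_mbV [LHS]mliftE [X in _ = y * X](mliftE _ (s, p, q)).
case: p => [|p]; first by rewrite mulr0.
by rewrite y_mbV sigtauV.
Qed.

Notation zx := (comm_tens x : E).
Notation zy := (comm_tens y : E).

(** The two elements need not be central, so regularity is wanted on both sides: on the right for
    the exactness of the resolution, on the left for that of its dual. *)
Lemma koszul_left : [/\ forall w : E, zx * w = 0 -> w = 0,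
  forall w : E, zy * w = 0 -> w = 0 &
  forall f g : E, zx * f = zy * g -> exists h, f = zy * h /\ g = zx * h].
Proof.
have H := regular_pair_left mxy div_xl_nil div_yl_nil.
exact (H div_xlK div_ylK div_xl_y).
Qed.
Lemma koszul_right : [/\ forall w : E, w * zx = 0 -> w = 0,
  forall w : E, w * zy = 0 -> w = 0 &
  forall f g : E, f * zx = g * zy -> exists h, f = h * zy /\ g = h * zx].
Proof.
have H := regular_pair_right mxy div_xr_nil div_yr_nil.
exact (H div_xrK div_yrK div_xr_y).
Qed.

(** The idempotent generating the left ideal that is the sum of the B e_s (x) e_(th s) B, a term of
    the Koszul resolution. *)
Definition diag_tens (th : S -> S) : E := \sum_s tens (me s) (me (th s)).

Lemma diag_tens_idem th : diag_tens th * diag_tens th = diag_tens th.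
Proof.
rewrite {1}/diag_tens mulr_suml; apply: eq_bigr => s _.
rewrite mulr_sumr (bigD1 s) //= tensM !me_idem !eqxx big1 ?addr0 // => r rs.
by rewrite tensM me_idem (negPf rs) tens0l.
Qed.

Lemma diag_tens_l th s : diag_tens th * tens (me s) 1 = tens (me s) (me (th s)).
Proof.
rewrite mulr_suml (bigD1 s) //= tensM me_idem eqxx mul1r big1 ?addr0 // => r rs.
by rewrite tensM me_idem eq_sym (negPf rs) tens0l.
Qed.

Lemma diag_tens_r th s : injective th ->
  diag_tens th * tens 1 (me (th s)) = tens (me s) (me (th s)).
Proof.
move=> th_inj; rewrite mulr_suml (bigD1 s) //= tensM me_idem eqxx mulr1.
rewrite big1 ?addr0 // => r rs.
by rewrite tensM me_idem (inj_eq th_inj) (negPf rs) tens0r.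
Qed.

(** Moving x across e_s shifts the vertex by [sig] in either factor. Hence right multiplication by
    zx maps one term of the Koszul complex to the next. *)
Lemma diag_tens_x th : (forall s, th (sig s) = sig (th s)) ->
  diag_tens (fun s => th (sig s)) * zx = zx * diag_tens th.
Proof.
move=> thC; rewrite /comm_tens mulrBr mulrBl !mulr_suml !mulr_sumr.
congr (_ - _); last first.
  by apply: eq_bigr => s _; rewrite !tensM mulr1 mul1r thC me_x.
rewrite [RHS](reindex_inj (@perm_inj _ sig)); apply: eq_bigr => s _ /=.
by rewrite !tensM mulr1 mul1r me_x.
Qed.
Lemma diag_tens_y th : (forall s, th (tau s) = tau (th s)) ->
  diag_tens (fun s => th (tau s)) * zy = zy * diag_tens th.
Proof.
move=> thC; rewrite /comm_tens mulrBr mulrBl !mulr_suml !mulr_sumr.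
congr (_ - _); last first.
  by apply: eq_bigr => s _; rewrite !tensM mulr1 mul1r thC me_y.
rewrite [RHS](reindex_inj (@perm_inj _ tau)); apply: eq_bigr => s _ /=.
by rewrite !tensM mulr1 mul1r me_y.
Qed.

End MonomialAlgebra.

Arguments me {k B} D s.
Arguments mlift {k B} D {W} h.

Section FiniteGeneration.
Variable R : nzRingType.

Lemma fin_gen_regular : fin_gen (R^o : lmodType R).
Proof.
exists 1%N, (fun=> 1 : R^o) => x; exists (fun=> x).
by rewrite big_ord1 /GRing.scale /= mulr1.
Qed.

Lemma fin_gen_trivial (M : lmodType R) : (forall x : M, x = 0) -> fin_gen M.
Proof. by move=> M0; exists 0%N, (fun=> 0) => x; exists (fun=> 0); rewrite big_ord0; exact: M0. Qed.

Lemma fin_gen_prod (M N : lmodType R) : fin_gen M -> fin_gen N ->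
  fin_gen ((M * N)%type : lmodType R).
Proof.
move=> [m [s s_gen]] [n [t t_gen]].
exists (m + n)%N, (fun i : 'I_(m + n) => match fintype.split i with
  | inl j => pair1 M N (s j) | inr j => pair2 M N (t j) end) => -[x y].
have [c xE] := s_gen x; have [d yE] := t_gen y.
exists (fun i : 'I_(m + n) => match fintype.split i with inl j => c j | inr j => d j end).
rewrite big_split_ord /=.
set sx := \sum_(i < m) _; set sy := \sum_(i < n) _.
have -> : sx = pair1 M N x.
  rewrite [in RHS]xE [RHS]linear_sum; apply: eq_bigr => i _.
  by rewrite (unsplitK (inl i)) linearZZ.
have -> : sy = pair2 M N y.
  rewrite [in RHS]yE [RHS]linear_sum; apply: eq_bigr => i _.
  by rewrite (unsplitK (inr i)) linearZZ.
by apply/eqP; rewrite xpair_eqE /= addr0 add0r !eqxx.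
Qed.

End FiniteGeneration.

(** * The module generated by an idempotent *)

Section IdempotentModule.
Variables (R : nzRingType) (e : R).

Fact reg_mulr_linear (r : R) : linear (fun w : R^o => (w : R) * r : R^o).
Proof.
move=> a x y; change ((a * x + y) * r = a * (x * r) + y * r :> R).
by rewrite mulrDl mulrA.
Qed.
Definition reg_mulr r := mklin (reg_mulr_linear r).

(** R e, as the kernel of right multiplication by 1 - e, which provides the module structure. *)
Definition idem_mod : lmodType R := kermod (reg_mulr (1 - e)).
Definition ival (w : idem_mod) : R := val w.

Lemma ival_inj : injective ival. Proof. by move=> u v; exact: val_inj. Qed.
Lemma ivalP a u v : ival (a *: u + v) = a * ival u + ival v. Proof. by []. Qed.

Lemma ival_e w : ival w * e = ival w.
Proof.
have := kermodP w; rewrite /= -[val w]/(ival w : R) mulrBr mulr1 => /eqP.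
by rewrite subr_eq0 => /eqP <-.
Qed.

Lemma idem_mk (r : R) : r * e = r -> {w : idem_mod | ival w = r}.
Proof.
move=> re; have rP : reg_mulr (1 - e) r = 0 by rewrite /= mulrBr mulr1 re subrr.
by exists (mkker rP).
Qed.

Lemma idem_lin (U : lmodType R) (f : U -> R) :
  (forall a u v, f (a *: u + v) = a * f u + f v) -> (forall u, f u * e = f u) ->
  {g : {linear U -> idem_mod} | forall u, ival (g u) = f u}.
Proof.
move=> fL fe; pose g u := sval (idem_mk (fe u)).
have gE u : ival (g u) = f u by exact: svalP (idem_mk (fe u)).
have gL : linear g by move=> a u v; apply: ival_inj; rewrite ivalP !gE.
by exists (mklin gL) => u; exact: gE.
Qed.

Fact ival_mulr_linear r : linear (fun w : idem_mod => ival w * r : R^o).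
Proof.
move=> a x y; rewrite ivalP; change ((a * ival x + ival y) * r =
  a * (ival x * r) + ival y * r :> R).
by rewrite mulrDl mulrA.
Qed.
Definition ival_mulr r : {linear idem_mod -> R^o} := mklin (ival_mulr_linear r).

Hypothesis ee : e * e = e.

Lemma idem_mod_retract : exists (p : {linear R^o -> idem_mod}),
  forall w : R^o, ival (p w) = w * e.
Proof.
have pe (w : R^o) : (w * e) * e = w * e :> R by rewrite -mulrA ee.
have [|p pE] := @idem_lin R^o (fun w => (w : R) * e) _ pe.
  move=> a u v; change ((a * u + v) * e = a * (u * e) + v * e :> R).
  by rewrite mulrDl mulrA.
by exists p.
Qed.

Lemma idem_mod_projective : projective idem_mod.
Proof.
have [p pE] := idem_mod_retract.
apply: (projective_retract (i := ival_mulr 1) (r := p)); last exact: projective_regular.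
by move=> w; apply: ival_inj; rewrite pE /= mulr1 ival_e.
Qed.

Lemma idem_mod_fin_gen : fin_gen idem_mod.
Proof.
have [p pE] := idem_mod_retract.
apply: (fin_gen_image (f := p)); first exact: fin_gen_regular.
by move=> w; exists (ival w); apply: ival_inj; rewrite pE ival_e.
Qed.

End IdempotentModule.

(** * Koszul complexes of length two and their duals *)

Section KoszulComplex.
Variables (R : nzRingType) (M : lmodType R) (m0 : M).
Variables (e1 ex ey exy zx zy : R).
Hypotheses (e1K : e1 * e1 = e1) (exK : ex * ex = ex) (eyK : ey * ey = ey).
Hypothesis exyK : exy * exy = exy.
Hypotheses (ex_zx : ex * zx = zx * e1) (ey_zy : ey * zy = zy * e1).
Hypotheses (exy_zy : exy * zy = zy * ex) (exy_zx : exy * zx = zx * ey).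
Hypothesis zxy : zx * zy = zy * zx.
Hypothesis zx_reg : forall w : R, w * zx = 0 -> w = 0.
Hypothesis zxy_reg : forall f g : R, f * zx = g * zy ->
  exists h, f = h * zy /\ g = h * zx.
Hypotheses (e1_m0 : e1 *: m0 = m0) (zx_m0 : zx *: m0 = 0) (zy_m0 : zy *: m0 = 0).
Hypothesis m0_gen : forall m, exists r, r *: m0 = m.
Hypothesis m0_ann : forall w, w *: m0 = 0 -> exists u v, w * e1 = u * zx + v * zy.

(** R exy -> R ex + R ey -> R e1, continued by zero, which is realised as the kernel of the
    identity. *)
Definition kz_term (i : nat) : lmodType R :=
  match i with
  | 0 => idem_mod e1
  | 1 => (idem_mod ex * idem_mod ey)%type
  | 2 => idem_mod exy
  | _ => kermod (idfun : {linear R^o -> R^o})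
  end.

Lemma kz_term3 i (w : kz_term i.+3) : w = 0.
Proof. by apply: val_inj; exact: (kermodP w). Qed.

Lemma kz_d1_exists : {d : {linear kz_term 1 -> kz_term 0} |
  forall w, ival (d w) = ival w.1 * zx + ival w.2 * zy}.
Proof.
apply: (@idem_lin _ e1 (idem_mod ex * idem_mod ey)%type
  (fun w => ival w.1 * zx + ival w.2 * zy)) => [a u v|u].
  by rewrite !ivalP !mulrDl mulrDr !mulrA addrACA.
by rewrite mulrDl -!mulrA -ex_zx -ey_zy !mulrA !ival_e.
Qed.
Definition kz_d1 := sval kz_d1_exists.
Lemma kz_d1E w : ival (kz_d1 w) = ival w.1 * zx + ival w.2 * zy.
Proof. exact: (svalP kz_d1_exists). Qed.

Lemma kz_d2x_exists : {d : {linear kz_term 2 -> idem_mod ex} |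
  forall w, ival (d w) = - (ival w * zy)}.
Proof.
apply: (@idem_lin _ ex (idem_mod exy) (fun w => - (ival w * zy))) => [a u v|u].
  by rewrite !ivalP mulrDl opprD mulrN mulrA.
by rewrite mulNr -mulrA -exy_zy mulrA ival_e.
Qed.
Lemma kz_d2y_exists : {d : {linear kz_term 2 -> idem_mod ey} |
  forall w, ival (d w) = ival w * zx}.
Proof.
apply: (@idem_lin _ ey (idem_mod exy) (fun w => ival w * zx)) => [a u v|u].
  by rewrite !ivalP mulrDl mulrA.
by rewrite -mulrA -exy_zx mulrA ival_e.
Qed.
Fact kz_d2_linear : linear (fun w : kz_term 2 =>
  (sval kz_d2x_exists w, sval kz_d2y_exists w) : kz_term 1).
Proof. by move=> a u v; rewrite !linearP. Qed.
Definition kz_d2 : {linear kz_term 2 -> kz_term 1} := mklin kz_d2_linear.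
Lemma kz_d2E1 w : ival (kz_d2 w).1 = - (ival w * zy).
Proof. exact: (svalP kz_d2x_exists). Qed.
Lemma kz_d2E2 w : ival (kz_d2 w).2 = ival w * zx.
Proof. exact: (svalP kz_d2y_exists). Qed.

Fact zero_linear (U V : lmodType R) : linear (fun _ : U => 0 : V).
Proof. by move=> a u v; rewrite scaler0 addr0. Qed.

Definition kz_diff (i : nat) : {linear kz_term i.+1 -> kz_term i} :=
  match i with
  | 0 => kz_d1
  | 1 => kz_d2
  | j.+2 => mklin (@zero_linear (kz_term j.+3) (kz_term j.+2))
  end.

Fact kz_aug_linear : linear (fun w : kz_term 0 => ival w *: m0).
Proof. by move=> a u v; rewrite ivalP scalerDl scalerA. Qed.
Definition kz_aug : {linear kz_term 0 -> M} := mklin kz_aug_linear.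

Lemma kz_aug_surj m : exists w, kz_aug w = m.
Proof.
have [r rE] := m0_gen m.
have [|w wE] := @idem_mk _ e1 (r * e1); first by rewrite -mulrA e1K.
by exists w; rewrite /= wE -scalerA e1_m0.
Qed.

Lemma kz_exact0 w : kz_aug w = 0 <-> exists v, kz_diff 0 v = w.
Proof.
split=> [w0|[v <-]]; last first.
  rewrite /= -[X in X *: _]/(ival (kz_d1 v)) kz_d1E scalerDl -!scalerA zx_m0 zy_m0.
  by rewrite !scaler0 addr0.
have [u [v uvE]] := m0_ann w0.
have [|u' u'E] := @idem_mk _ ex (u * ex); first by rewrite -mulrA exK.
have [|v' v'E] := @idem_mk _ ey (v * ey); first by rewrite -mulrA eyK.
exists (u', v'); apply: ival_inj; rewrite /= kz_d1E u'E v'E /=.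
rewrite -!mulrA ex_zx ey_zy !mulrA -mulrDl -uvE -mulrA e1K.
exact: ival_e.
Qed.

Lemma kz_exactS i w : kz_diff i w = 0 <-> exists v, kz_diff i.+1 v = w.
Proof.
case: i w => [|[|i]] w; last by split=> [_|//]; exists 0; rewrite [w]kz_term3.
  split=> [/(congr1 (@ival _ _)) w0|[v <-]]; last first.
    apply: ival_inj; rewrite /= kz_d1E kz_d2E1 kz_d2E2 mulNr -!mulrA.
    by rewrite zxy addNr.
  move: w0; rewrite /= kz_d1E => /eqP; rewrite addr_eq0 -mulNr => /eqP.
  move/zxy_reg=> [h [h1 h2]].
  have [|v vE] := @idem_mk _ exy (- h * exy); first by rewrite -mulrA exyK.
  exists v; rewrite [w]surjective_pairing; change (((kz_d2 v).1, (kz_d2 v).2) = (w.1, w.2)).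
  congr pair; apply: ival_inj; rewrite ?kz_d2E1 ?kz_d2E2 vE -mulrA.
    by rewrite exy_zy mulrA mulNr -h1 mulNr opprK ival_e.
  by rewrite exy_zx mulrA mulNr -h2 opprK ival_e.
split=> [w0|[v <-]]; last exact: (linear0 kz_d2).
exists 0; rewrite linear0; apply: (@ival_inj R exy).
have {}w0 : kz_d2 w = 0 := w0; apply/esym/zx_reg.
by rewrite -kz_d2E2 w0.
Qed.

Definition kz_resolution : resolution M :=
  @Resolution R M kz_term kz_diff kz_aug kz_aug_surj kz_exact0 kz_exactS.

Lemma kz_fg i : projective (kz_term i) /\ fin_gen (kz_term i).
Proof.
case: i => [|[|[|i]]]; split.
- exact: idem_mod_projective e1K.
- exact: idem_mod_fin_gen e1K.
- apply: projective_prod; [exact: idem_mod_projective exK|exact: idem_mod_projective eyK].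
- apply: fin_gen_prod; [exact: idem_mod_fin_gen exK|exact: idem_mod_fin_gen eyK].
- exact: idem_mod_projective exyK.
- exact: idem_mod_fin_gen exyK.
- exact: projective_trivial (@kz_term3 i).
- exact: fin_gen_trivial (@kz_term3 i).
Qed.

Lemma idem_lin_gen e (g : idem_mod e) (f : {linear idem_mod e -> R^o}) w :
  ival g = e -> f w = ival w * (f g : R).
Proof.
move=> ge; have wE : w = ival w *: g.
  by apply: ival_inj; rewrite -[RHS]/(ival w * ival g) ge ival_e.
by rewrite [in LHS]wE linearZZ.
Qed.

Section Dual.
Hypothesis zx_regl : forall w : R, zx * w = 0 -> w = 0.
Hypothesis zxy_regl : forall f g : R, zx * f = zy * g ->
  exists h, f = zy * h /\ g = zx * h.

Lemma kz_gen (e : R) : e * e = e -> {g : idem_mod e | ival g = e}.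
Proof. exact: idem_mk. Qed.

Lemma kz_lin1 (f : {linear kz_term 1 -> R^o}) : exists a c : R,
  [/\ ex * a = a, ey * c = c & forall w : (idem_mod ex * idem_mod ey)%type, f w = ival w.1 * a + ival w.2 * c].
Proof.
have [gx gxE] := kz_gen exK; have [gy gyE] := kz_gen eyK.
pose fx : {linear idem_mod ex -> R^o} := f \o pair1 _ _.
pose fy : {linear idem_mod ey -> R^o} := f \o pair2 _ _.
exists (fx gx), (fy gy); split.
- by rewrite -[X in X * _]gxE -idem_lin_gen.
- by rewrite -[X in X * _]gyE -idem_lin_gen.
move=> [u v]; rewrite -(idem_lin_gen fx u gxE) -(idem_lin_gen fy v gyE) /=.
rewrite -linearD; congr (f _); apply/eqP.
by rewrite xpair_eqE /= addr0 add0r !eqxx.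
Qed.

Lemma kz_lin1_d2 (f : {linear kz_term 1 -> R^o}) a c :
  ex * a = a -> ey * c = c -> (forall w : (idem_mod ex * idem_mod ey)%type, f w = ival w.1 * a + ival w.2 * c) ->
  forall g, ival g = exy -> f (kz_d2 g) = zx * c - zy * a :> R.
Proof.
move=> exa eyc fE g gE; rewrite fE kz_d2E1 kz_d2E2 gE mulNr exy_zx exy_zy.
by rewrite -!mulrA exa eyc addrC.
Qed.

(** A linear form on R e is right multiplication by its value at e. So the dual complex is given by
    left multiplications by [zx] and [zy], and regularity on the left makes it exact outside degree
    2. *)
Lemma kz_hom_exact i : i != 2%N -> hom_exact kz_resolution i.
Proof.
case: i => [|[|[|i]]] // _ f fd.
- have [g gE] := kz_gen e1K; have [gx gxE] := kz_gen exK.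
  have f0 : f g = 0.
    apply: zx_regl; have := fd (gx, 0); rewrite /= (idem_lin_gen f _ gE) kz_d1E /=.
    rewrite gxE mul0r addr0 ex_zx -mulrA -[X in X * f g]gE.
    by rewrite -(idem_lin_gen f g gE).
  by move=> w; rewrite (idem_lin_gen f w gE) f0 mulr0.
- have [a [c [exa eyc fE]]] := kz_lin1 f; have [g gE] := kz_gen exyK.
  have := fd g; rewrite [LHS](kz_lin1_d2 exa eyc fE gE) => /eqP; rewrite subr_eq0.
  move=> /eqP/zxy_regl[h [cE aE]].
  exists (ival_mulr e1 h) => w; rewrite fE aE cE !mulrA -mulrDl.
  by rewrite -kz_d1E.
by exists (mklin (@zero_linear (kz_term i.+2) R^o)) => w; rewrite [w]kz_term3 linear0.
Qed.

Variables (U : zmodType) (theta : {additive R -> U}).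
Hypotheses (theta_zx : forall w, theta (zx * w) = 0).
Hypotheses (theta_zy : forall w, theta (zy * w) = 0).
Hypothesis theta_ker : forall w, theta w = 0 ->
  exists u v, exy * w = zx * u + zy * v.
Hypothesis theta_surj : forall m, exists w, exy * w = w /\ theta w = m.

Fact ival_pair_linear (u v : R) : linear
  (fun p : (idem_mod ex * idem_mod ey)%type => ival p.2 * u - ival p.1 * v : R^o).
Proof.
move=> a [p p'] [q q'].
change ((ival (a *: p' + q')) * u - ival (a *: p + q) * v =
  a * (ival p' * u - ival p * v) + (ival q' * u - ival q * v) :> R).
by rewrite !ivalP !mulrDl opprD mulrBr !mulrA addrACA.
Qed.

(** The dual complex ends with exy R modulo the multiples of [zx] and [zy], which [theta] identifies
    with [U]. *)
Lemma kz_Ext2 : exists (u0 : std_term M 2) (F : {additive Ext M 2 -> U}),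
  bijective F /\ forall c : cocycle M 2,
    F (qpi (coboundary M 2) c) = theta ((val c : std_term M 2 -> R) u0).
Proof.
have [gen genE] := kz_gen exyK.
have projK : projective_resolution kz_resolution by move=> i; exact: (kz_fg i).1.
apply: (@Ext_iso R M kz_resolution 1 projK U theta gen).
- move=> g; have [a [c [exa eyc gE]]] := kz_lin1 g.
  rewrite [X in theta X](kz_lin1_d2 exa eyc gE genE) raddfB.
  by rewrite theta_zx theta_zy subrr.
- move=> f fd f0; have [u [v uvE]] := theta_ker f0.
  exists (mklin (ival_pair_linear u v)) => w; rewrite [LHS](idem_lin_gen f w genE).
  rewrite /= kz_d2E1 kz_d2E2 mulNr opprK -!mulrA -mulrDr -uvE mulrA ival_e.
  by [].
move=> m; have [w [ew wE]] := theta_surj m.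
exists (ival_mulr exy w); split=> [v|]; last by rewrite /= genE ew.
by rewrite linear0.
Qed.

End Dual.

End KoszulComplex.

(** * The Koszul bimodule resolution of a monomial algebra *)

Section Koszul.
Variables (k : comNzRingType) (B : algType k) (D : monomial_algebra B).
Notation S := (mS D).
Notation sig := (msig D).
Notation tau := (mtau D).
Notation b := (mb D).
Notation E := (env B).
Notation x := (mx D).
Notation y := (my D).
Notation zx := (comm_tens x : E).
Notation zy := (comm_tens y : E).

Definition eps1 := @diag_tens k B D (fun s => s).
Definition epsx := @diag_tens k B D sig.
Definition epsy := @diag_tens k B D tau.
Definition epsxy := @diag_tens k B D (fun s => sig (tau s)).

Lemma epsx_zx : epsx * zx = zx * eps1.
Proof. exact: (@diag_tens_x k B D id). Qed.
Lemma epsy_zy : epsy * zy = zy * eps1.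
Proof. exact: (@diag_tens_y k B D id). Qed.
Lemma epsxy_zy : epsxy * zy = zy * epsx.
Proof. exact: (@diag_tens_y k B D sig (msigtau D)). Qed.
Lemma epsxy_zx : epsxy * zx = zx * epsy.
Proof.
rewrite -(@diag_tens_x k B D tau) => [|s]; last by rewrite msigtau.
by congr (_ * _); apply: eq_bigr => s _; rewrite msigtau.
Qed.
Lemma eps1K : eps1 * eps1 = eps1. Proof. exact: diag_tens_idem. Qed.
Lemma epsxK : epsx * epsx = epsx. Proof. exact: diag_tens_idem. Qed.
Lemma epsyK : epsy * epsy = epsy. Proof. exact: diag_tens_idem. Qed.
Lemma epsxyK : epsxy * epsxy = epsxy. Proof. exact: diag_tens_idem. Qed.

Lemma zx_1 : zx *: (1 : regbim B) = 0.
Proof. by rewrite scalerBl !regbim_tens !mulr1 !mul1r subrr. Qed.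
Lemma zy_1 : zy *: (1 : regbim B) = 0.
Proof. by rewrite scalerBl !regbim_tens !mulr1 !mul1r subrr. Qed.

Lemma eps1_1 : eps1 *: (1 : regbim B) = (1 : B).
Proof.
rewrite /eps1 /diag_tens scaler_suml [RHS](mb1 D); apply: eq_bigr => s _.
by rewrite regbim_tens mulr1 me_idem eqxx.
Qed.

Definition in_kz_ideal (w : E) := exists u v, w = u * zx + v * zy.

Lemma in_kz_ideal0 : in_kz_ideal 0.
Proof. by exists 0, 0; rewrite !mul0r addr0. Qed.
Lemma in_kz_idealP r w w' : in_kz_ideal w -> in_kz_ideal w' -> in_kz_ideal (r * w + w').
Proof.
move=> [u [v ->]] [u' [v' ->]]; exists (r * u + u'), (r * v + v').
by rewrite !mulrDl mulrDr !mulrA addrACA.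
Qed.

Lemma alg_generated (P : B -> Prop) : P 0 ->
  (forall c u v, P u -> P v -> P (c *: u + v)) ->
  (forall u v, P u -> P v -> P (u * v)) ->
  (forall s, P (me D s)) -> P x -> P y -> forall a, P a.
Proof.
move=> P0 PD PM Pe Px Py; apply: mb_ind => // -[[s p] q].
elim: q => [|q IHq]; last by rewrite -mb_y; exact: PM IHq Py.
by elim: p => [|p IHp]; [exact: Pe | rewrite -mb_x; exact: PM IHp Px].
Qed.

(** a -> a (x) 1 - 1 (x) a obeys a Leibniz rule, so generators suffice: e_s (x) 1 and 1 (x) e_s
    agree on [eps1], while x and y give [zx] and [zy]. *)
Lemma kz_ideal_comm a : in_kz_ideal ((tens a 1 - tens 1 a) * eps1).
Proof.
elim/alg_generated: a => [|c u v IHu IHv|u v IHu IHv|s||].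
- by rewrite tens0l tens0r subrr mul0r; exact: in_kz_ideal0.
- have := in_kz_idealP (c *: 1) IHu IHv; congr in_kz_ideal.
  rewrite -scalerAl mul1r scalerAl -mulrDl; congr (_ * _).
  by rewrite tensPl tensPr scalerBr opprD addrACA.
- have := in_kz_idealP (tens u 1) IHv (in_kz_idealP (tens 1 v) IHu in_kz_ideal0).
  congr in_kz_ideal; rewrite addr0 !mulrA -mulrDl; congr (_ * _).
  by rewrite !mulrBr !tensM !mulr1 !mul1r addrA subrK.
- have -> : (tens (me D s) 1 - tens 1 (me D s)) * eps1 = 0; last exact: in_kz_ideal0.
  rewrite mulrBl /eps1 /diag_tens !mulr_sumr -sumrB big1 // => r _.
  rewrite !tensM !mulr1 !mul1r !me_idem [r == s]eq_sym.
  by case: eqP => [->|_]; rewrite ?subrr // tens0l tens0r subrr.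
- by exists epsx, 0; rewrite mul0r addr0 -epsx_zx.
- by exists 0, epsy; rewrite mul0r add0r -epsy_zy.
Qed.

(** Modulo the ideal everything can be moved to the right factor, so only the action on 1 matters;
    this is exactness at the augmentation. *)
Lemma kz_ideal_aug w :
  in_kz_ideal (w * eps1 - tens 1 ((w *: (1 : regbim B)) : B) * eps1).
Proof.
elim/env_ind: w => [|c w w' IH IH'|u v].
- by rewrite scale0r tens0r !mul0r subrr; exact: in_kz_ideal0.
- have := in_kz_idealP (c *: 1) IH IH'; congr in_kz_ideal.
  have -> : (c *: w + w') *: (1 : regbim B) = c *: (w *: (1 : regbim B) : B) + (w' *: (1 : regbim B)) :> B.
    rewrite scalerDl; congr (_ + _).
    have -> : c *: w = tens c%:A 1 * w by rewrite tens_in_algl tens11 mulr1 -scalerAl mul1r.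
    by rewrite -scalerA regbim_tens mulr1 -scalerAl mul1r.
  rewrite -scalerAl mul1r tensPr scalerBr mulrDl mulrDl !scalerAl.
  by rewrite opprD addrACA.
rewrite regbim_tens mulr1; have := in_kz_idealP (tens 1 v) (kz_ideal_comm u) in_kz_ideal0.
congr in_kz_ideal; rewrite addr0 mulrA -mulrBl; congr (_ * _).
by rewrite mulrBr !tensM !mulr1 !mul1r.
Qed.

Lemma regbim_generated (a : regbim B) : exists w : E, w *: (1 : regbim B) = a.
Proof. by exists (tens (a : B) 1); rewrite regbim_tens !mulr1. Qed.

Lemma regbim_annihilator (w : E) : w *: (1 : regbim B) = 0 ->
  exists u v, w * eps1 = u * zx + v * zy.
Proof.
by move=> w0; have := kz_ideal_aug w; rewrite w0 tens0r mul0r subr0.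
Qed.

Let zx_regr := let: And3 H _ _ := koszul_right D in H.
Let zxy_regr := let: And3 _ _ H := koszul_right D in H.

Definition koszul : resolution (regbim B : lmodType E) :=
  kz_resolution eps1K epsxK epsyK epsxyK epsx_zx epsy_zy epsxy_zy epsxy_zx
    (comm_tensC (mxy D)) zx_regr zxy_regr eps1_1 zx_1 zy_1
    regbim_generated regbim_annihilator.

Lemma koszul_fg i : projective (koszul i) /\ fin_gen (koszul i).
Proof. exact: (kz_fg eps1K epsxK epsyK epsxyK). Qed.

Lemma koszul_length : res_length_le koszul 2.
Proof. by case=> [|[|[|i]]] // _ w; exact: kz_term3. Qed.

Lemma monomial_algebra_CY1 : CY1 B.
Proof. by exists koszul; split; [exact: koszul_fg | exists 2%N; exact: koszul_length]. Qed.

End Koszul.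

Lemma monomial_algebra_gldim (k : fieldType) (B : algType k)
  (D : monomial_algebra B) : gldim_le B 2.
Proof.
apply: gldim_le_pd; apply: pdim_pd_le; exists (koszul D).
  by move=> i; exact: (koszul_fg D i).1.
exact: koszul_length.
Qed.

(** * The dualizing bimodule *)

Section TwistedBimodule.
Variables (k : comNzRingType) (B : algType k).

Section Twist.
Variable nu : {linear B -> B}.
Hypotheses (nu1 : nu 1 = 1) (nuM : forall a b, nu (a * b) = nu a * nu b).

Fact twist_blM (a a' w : B) : a * (a' * w) = a * a' * w. Proof. exact: mulrA. Qed.
Fact twist_brM (b b' w : B) : w * nu b * nu b' = w * nu (b * b').
Proof. by rewrite nuM mulrA. Qed.
Fact twist_br1 (w : B) : w * nu 1 = w. Proof. by rewrite nu1 mulr1. Qed.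
Fact twist_br_linr (w : B) : linear (fun b => w * nu b).
Proof. by move=> c b b'; rewrite linearP mulrDr scalerAr. Qed.

Definition twist_ops : bimod_ops B B :=
  @BimodOps k B B (fun a w => a * w) (fun w b => w * nu b)
    (fun w => @rmul_linear k B w) (fun a => @lmul_linear k B a)
    (fun b => @rmul_linear k B (nu b)) twist_br_linr
    twist_blM twist_brM (@mul1r B) twist_br1 (fun a w b => mulrA a w (nu b)).

Definition twist : lmodType (env B) := bimod twist_ops.

Lemma twist_tens a b (w : twist) : tens a b *: w = a * ((w : B) * nu b) :> B.
Proof. exact: (bimod_tens a b w). Qed.

End Twist.

(** A balanced map satisfies s u v = s (u nu(v)) 1, so it factors through b -> s b 1. *)
Lemma twist_tensor (nu nu' : {linear B -> B}) (nu1 : nu 1 = 1)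
    (nuM : forall a b, nu (a * b) = nu a * nu b) (nu1' : nu' 1 = 1)
    (nuM' : forall a b, nu' (a * b) = nu' a * nu' b) : cancel nu' nu ->
  @is_tensor k B (twist nu1 nuM) (twist nu1' nuM') (regbim B)
    (fun u v => (u : B) * nu (v : B)).
Proof.
move=> nuK; split.
- split=> [u u' v|u v v']; first exact: mulrDl.
  by rewrite [nu _](linearD nu) mulrDr.
- move=> u b v; rewrite /ract /lact !twist_tens mul1r nu1' mulr1 nuM.
  by rewrite mulrA.
- by move=> b u v; rewrite /lact regbim_tens twist_tens nu1 !mulr1 mulrA.
- by move=> b u v; rewrite /ract regbim_tens twist_tens !mul1r nuM nuK mulrA.
move=> W s [sDl sDr] s_bal.
have fB : zmod_morphism (fun b : regbim B => s (b : B) (1 : B)).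
  pose s1 := fun b : B => s b (1 : B).
  have s1D b c : s1 (b + c) = s1 b + s1 c by exact: sDl.
  by move=> b c; apply/eqP; rewrite eq_sym subr_eq -[X in _ == X]/(_ + _) -s1D subrK.
have fE (u : twist nu1 nuM) (v : twist nu1' nuM') :
    s ((u : B) * nu (v : B)) (1 : B) = s u v.
  have := s_bal u (v : B) (1 : B); rewrite /ract /lact !twist_tens mul1r.
  by rewrite nu1' !mulr1.
exists (mkadd fB) => [u v|f' f'E b]; first exact: fE.
have := f'E (b : B) (1 : B); rewrite nu1 mulr1 => ->.
by [].
Qed.

Lemma twist_invertible (nu nu' : {linear B -> B}) (nu1 : nu 1 = 1)
    (nuM : forall a b, nu (a * b) = nu a * nu b) : 
  cancel nu nu' -> cancel nu' nu -> invertible_bimodule (twist nu1 nuM).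
Proof.
move=> nuK nuK'; have nu1' : nu' 1 = 1 by rewrite -nu1 nuK.
have nuM' a b : nu' (a * b) = nu' a * nu' b.
  by apply: (can_inj nuK); rewrite nuM !nuK'.
exists (twist nu1' nuM'); split.
  by eexists; exact: (twist_tensor nu1 nuM nu1' nuM' nuK').
by eexists; exact: (twist_tensor nu1' nuM' nu1 nuM nuK).
Qed.

End TwistedBimodule.

Section MonomialCY2.
Variables (k : comNzRingType) (B : algType k) (D : monomial_algebra B).
Notation S := (mS D).
Notation sig := (msig D).
Notation tau := (mtau D).
Notation b := (mb D).
Notation E := (env B).
Notation x := (mx D).
Notation y := (my D).
Notation zx := (comm_tens x : E).
Notation zy := (comm_tens y : E).

Section Shift.
Variable th : {perm S}.
Hypotheses (th_sig : forall s, th (sig s) = sig (th s)).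
Hypotheses (th_tau : forall s, th (tau s) = tau (th s)).

Definition vshift : {linear B -> B} :=
  mlift D (fun t : S * nat * nat => b (th t.1.1, t.1.2, t.2)).

Lemma vshift_b s p q : vshift (b (s, p, q)) = b (th s, p, q).
Proof. exact: mliftE. Qed.

Lemma vshift_iter p q s : th (iter p sig (iter q tau s)) = iter p sig (iter q tau (th s)).
Proof.
by elim: p => [|p IHp] /=; [elim: q => //= q <- | rewrite -IHp].
Qed.

Lemma vshiftM a c : vshift (a * c) = vshift a * vshift c.
Proof.
apply: (mb_ext (D := D) (f := vshift \o lmul a : {linear _ -> _})
  (g := lmul (vshift a) \o vshift : {linear _ -> _})) => t.
change (vshift (a * b t) = vshift a * vshift (b t)).
apply: (mb_ext (D := D) (f := vshift \o rmul (b t) : {linear _ -> _})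
  (g := rmul (vshift (b t)) \o vshift : {linear _ -> _})) => t'.
change (vshift (b t' * b t) = vshift (b t') * vshift (b t)).
case: t t' => [[s' p'] q'] [[s p] q]; rewrite !vshift_b !mbM -vshift_iter.
by rewrite (inj_eq perm_inj); case: eqP => _; rewrite ?vshift_b ?linear0.
Qed.

Lemma vshift_sum p q : vshift (\sum_s b (s, p, q)) = \sum_s b (s, p, q).
Proof.
rewrite linear_sum [RHS](reindex_inj (@perm_inj _ th)).
by apply: eq_bigr => s _; exact: vshift_b.
Qed.

Lemma vshift1 : vshift 1 = 1.
Proof. by rewrite (mb1 D) vshift_sum. Qed.

End Shift.

Definition st : {perm S} := (tau * sig)%g.
Lemma stE s : st s = sig (tau s). Proof. by rewrite permM. Qed.
Lemma st_sig s : st (sig s) = sig (st s). Proof. by rewrite !stE !msigtau. Qed.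
Lemma st_tau s : st (tau s) = tau (st s). Proof. by rewrite !stE !msigtau. Qed.

(** The Nakayama automorphism: it shifts vertices along x y and fixes x and y. *)
Definition nak : {linear B -> B} := vshift st.
Definition nakV : {linear B -> B} := vshift st^-1%g.
Let nakM := vshiftM st_sig st_tau.
Let nak1 : nak 1 = 1 := vshift1 st.

Lemma nakK : cancel nak nakV.
Proof.
move=> a; apply: (mb_ext_id (D := D) (f := nakV \o nak : {linear _ -> _})) => -[[s p] q].
by change (nakV (nak (b (s, p, q))) = b (s, p, q)); rewrite [nak _]vshift_b [LHS]vshift_b permK.
Qed.
Lemma nakVK : cancel nakV nak.
Proof.
move=> a; apply: (mb_ext_id (D := D) (f := nak \o nakV : {linear _ -> _})) => -[[s p] q].
by change (nak (nakV (b (s, p, q))) = b (s, p, q)); rewrite [nakV _]vshift_b [LHS]vshift_b permKV.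
Qed.

Fact nak_theta_linl (v : B) : linear (fun u : B => v * nak u).
Proof. by move=> c u u'; rewrite linearP mulrDr scalerAr. Qed.
(** Identifies the top cohomology of the dual Koszul complex with B. The twist is forced: multiplied
    by [epsxy] on the left, e_s (x) 1 and 1 (x) e_(st s) become equal. *)
Definition nak_theta : {linear E -> B} :=
  env_lift (F := fun u v => v * nak u) nak_theta_linl (fun u => rmul_linear (nak u)).
Lemma nak_thetaE u v : nak_theta (tens u v) = v * nak u.
Proof. exact: env_liftE. Qed.

Lemma nak_theta_comm (z : B) : nak z = z -> forall w, nak_theta (comm_tens z * w) = 0.
Proof.
move=> nz; elim/env_ind => [|c w w' IH IH'|u v].
- by rewrite mulr0 linear0.
- by rewrite mulrDr -scalerAr linearP IH IH' scaler0 addr0.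
by rewrite comm_tens_mull linearB !nak_thetaE nakM nz mulrA subrr.
Qed.

Lemma nak_theta_tens w a c : nak_theta (w * tens a c) = c * (nak_theta w * nak a).
Proof.
elim/env_ind: w => [|d w w' IH IH'|u v].
- by rewrite mul0r !linear0 mul0r mulr0.
- rewrite mulrDl -scalerAl !linearP IH IH' mulrDl mulrDr.
  by rewrite -scalerAl -scalerAr.
by rewrite tensM !nak_thetaE nakM !mulrA.
Qed.

Definition in_kz_rideal (w : E) := exists u v, w = zx * u + zy * v.

Lemma in_kz_rideal0 : in_kz_rideal 0.
Proof. by exists 0, 0; rewrite !mulr0 addr0. Qed.
Lemma in_kz_ridealP r w w' : in_kz_rideal w -> in_kz_rideal w' -> in_kz_rideal (w * r + w').
Proof.
move=> [u [v ->]] [u' [v' ->]]; exists (u * r + u'), (v * r + v').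
by rewrite !mulrDr mulrDl !mulrA addrACA.
Qed.

(** The mirror image of [kz_ideal_comm], for the right ideal and with the twist by [nak]. *)
Lemma kz_rideal_comm a : in_kz_rideal (epsxy D * (tens a 1 - tens 1 (nak a))).
Proof.
elim/(alg_generated (D := D)): a => [|c u v IHu IHv|u v IHu IHv|s||].
- by rewrite linear0 tens0l tens0r subrr mulr0; exact: in_kz_rideal0.
- have := in_kz_ridealP (c *: 1) IHu IHv; congr in_kz_rideal.
  rewrite -scalerAr mulr1 scalerAr -mulrDr; congr (_ * _).
  by rewrite linearP tensPl tensPr scalerBr opprD addrACA.
- have := in_kz_ridealP (tens v 1) IHu (in_kz_ridealP (tens 1 (nak u)) IHv in_kz_rideal0).
  congr in_kz_rideal; rewrite addr0 -!mulrA -mulrDr; congr (_ * _).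
  by rewrite !mulrBl !tensM !mulr1 !mul1r nakM addrA subrK.
- have -> : epsxy D * (tens (me D s) 1 - tens 1 (nak (me D s))) = 0; last exact: in_kz_rideal0.
  have st_inj : injective (fun s => sig (tau s)).
    by move=> r r' /perm_inj/perm_inj.
  rewrite mulrBr [nak _]vshift_b stE -/(me D _).
  by rewrite diag_tens_l (@diag_tens_r k B D (fun s => sig (tau s)) s st_inj) subrr.
- exists (epsy D), 0; rewrite mulr0 addr0 -epsxy_zx.
  by rewrite [nak _](vshift_sum st).
- exists 0, (epsx D); rewrite mulr0 add0r -epsxy_zy.
  by rewrite [nak _](vshift_sum st).
Qed.

Lemma kz_rideal_theta w :
  in_kz_rideal (epsxy D * w - epsxy D * tens 1 (nak_theta w)).
Proof.
elim/env_ind: w => [|c w w' IH IH'|u v].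
- by rewrite linear0 tens0r !mulr0 subrr; exact: in_kz_rideal0.
- have := in_kz_ridealP (c *: 1) IH IH'; congr in_kz_rideal.
  rewrite -scalerAr mulr1 linearP tensPr !mulrDr scalerBr -!scalerAr.
  by rewrite opprD addrACA.
have := in_kz_ridealP (tens 1 v) (kz_rideal_comm u) in_kz_rideal0.
congr in_kz_rideal; rewrite addr0 -mulrA -mulrBr; congr (_ * _).
by rewrite mulrBl !tensM !mulr1 ?mul1r nak_thetaE.
Qed.

Lemma nak_theta_ker w : nak_theta w = 0 -> exists u v, epsxy D * w = zx * u + zy * v.
Proof.
by move=> w0; have := kz_rideal_theta w; rewrite w0 tens0r mulr0 subr0.
Qed.

Lemma nak_theta_surj m : exists w, epsxy D * w = w /\ nak_theta w = m.
Proof.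
exists (epsxy D * tens 1 m); split; first by rewrite mulrA epsxyK.
rewrite mulr_suml linear_sum -[RHS]mulr1 [in RHS](mb1 D) mulr_sumr.
rewrite [RHS](reindex_inj (@perm_inj _ st)); apply: eq_bigr => s _.
rewrite tensM mulr1 nak_thetaE [nak _]vshift_b -mulrA -/(me D (st s)) -stE.
by rewrite me_idem eqxx.
Qed.

Lemma monomial_algebra_CY2 : CY2 B 2.
Proof.
exists (twist nak1 nakM); first exact: twist_invertible nakK nakVK.
have projK : projective_resolution (koszul D) by move=> i; exact: (koszul_fg D i).1.
have [zx_regl zy_regl zxy_regl] := koszul_left D.
split=> [i /eqP i2|].
  apply/Ext_eq0; apply: hom_exact_transfer projK (@std_res_projective _ _) _.
  exact: kz_hom_exact.
have [u0 [F [F_bij FE]]] := kz_Ext2 (eps1K D) (epsxK D) (epsyK D) (epsxyK D)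
  (epsx_zx D) (epsy_zy D) (epsxy_zy D) (epsxy_zx D) (comm_tensC (mxy D))
  (let: And3 H _ _ := koszul_right D in H) (let: And3 _ _ H := koszul_right D in H)
  (eps1_1 D) (zx_1 D) (zy_1 D) (@regbim_generated _ _) (@regbim_annihilator _ _ D)
  (nak_theta_comm (vshift_sum st 1 0)) (nak_theta_comm (vshift_sum st 0 1))
  nak_theta_ker nak_theta_surj.
(* The right action of a (x) c multiplies the value of a cocycle on the right; by [nak_theta_tens],
   [nak_theta] turns this into w -> c w nak(a), the action on the twisted bimodule. *)
exists F; split=> // a c e; rewrite -[e]qreprK -linearZZ !FE twist_tens.
rewrite [LHS](congr1 nak_theta (cocycleZ _ _ _)).
exact: nak_theta_tens.
Qed.

Lemma monomial_algebra_twistedCY : twistedCY B.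
Proof.
by exists 2%N; split; [exact: monomial_algebra_CY1 D | exact: monomial_algebra_CY2].
Qed.

End MonomialCY2.

(** * The monomial basis of the preprojective algebra *)

Section Preprojective.
Variables (k : comNzRingType) (m : nat).
Notation Q := (Atilde m).
Notation S := 'I_m.+1.
Notation A := (preproj k Q).
Notation kQQ := (pathalg k (Defs.double Q)).
Notation T := (S * nat * nat)%type.

Fact ordS_injective : injective (@ordS m.+1). Proof. exact: bij_inj (@ordS_bij _). Qed.
Definition cyc : {perm S} := perm ordS_injective.
Definition cycV : {perm S} := cyc^-1%g.
Lemma cycE i : cyc i = ordS i. Proof. by rewrite permE. Qed.
Lemma cycC i : cyc (cycV i) = cycV (cyc i). Proof. by rewrite permK permKV. Qed.

Definition mon_end (t : T) : S := iter t.1.2 cyc (iter t.2 cycV t.1.1).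
Definition mon_mul (t t' : T) : option T :=
  if t'.1.1 == mon_end t
  then Some (t.1.1, (t.1.2 + t'.1.2)%N, (t.2 + t'.2)%N) else None.

Lemma iter_cycC p q i : iter p cyc (iter q cycV i) = iter q cycV (iter p cyc i).
Proof.
elim: p => //= p ->; elim: q => //= q IHq; by rewrite cycC IHq.
Qed.

Lemma mon_endM t t' u : mon_mul t t' = Some u -> mon_end u = mon_end t'.
Proof.
rewrite /mon_mul; case: eqP => // E [<-]; rewrite /mon_end /= E /mon_end.
by rewrite addnC iterD [(t.2 + _)%N]addnC iterD -!iter_cycC.
Qed.

Fact mon_mulA t t' t'' :
  obind (mon_mul t) (mon_mul t' t'') = obind (mon_mul^~ t'') (mon_mul t t').
Proof.
case E: (mon_mul t t') => [u|]; rewrite /=.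
  rewrite [mon_mul t' t'']/mon_mul [mon_mul u t'']/mon_mul (mon_endM E).
  case: eqP => //= _; move: E; rewrite /mon_mul /=; case: eqP => // _ [<-] /=.
  by rewrite !addnA.
move: E; rewrite /mon_mul; case: eqP => // N _.
by case: eqP => //= _; case: eqP.
Qed.

Definition mon_ones : seq T := [seq (s, 0%N, 0%N) | s <- enum S].
Fact mon_ones_uniq : uniq mon_ones.
Proof. by rewrite map_inj_uniq ?enum_uniq // => s r []. Qed.
Fact mon_ones_neq0 : mon_ones != [::].
Proof. by rewrite -size_eq0 size_map -cardE card_ord. Qed.
Fact mon_mul1 t : exists2 u, u \in mon_ones & mon_mul u t = Some t /\
  {in mon_ones, forall v, v != u -> mon_mul v t = None}.
Proof.
exists (t.1.1, 0%N, 0%N); first by apply: map_f; rewrite mem_enum.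
split; first by rewrite /mon_mul /mon_end /= eqxx; case: t => [[]].
move=> _ /mapP[s _ ->] ns; rewrite /mon_mul /mon_end /=; case: eqP => // E.
by case/eqP: ns; rewrite E.
Qed.
Fact mon_mulr1 t : exists2 u, u \in mon_ones & mon_mul t u = Some t /\
  {in mon_ones, forall v, v != u -> mon_mul t v = None}.
Proof.
exists (mon_end t, 0%N, 0%N); first by apply: map_f; rewrite mem_enum.
split; first by rewrite /mon_mul /= eqxx !addn0; case: t => [[]].
move=> _ /mapP[s _ ->] ns; rewrite /mon_mul /=; case: eqP => // E.
by case/eqP: ns; rewrite E.
Qed.
(** A model of A defined by the multiplication table of the monomials; the map from the path algebra
    to it shows that they are linearly independent in A. *)
Definition mon_pmonoid := @PMonoid T mon_mul mon_ones mon_mulA mon_ones_uniq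
  mon_ones_neq0 mon_mul1 mon_mulr1.

Local Notation MA := (pmalg k mon_pmonoid).
Definition mbas (t : T) : MA := @pbas k mon_pmonoid t.

Lemma mbasM s p q s' p' q' : mbas (s, p, q) * mbas (s', p', q') =
  if s' == mon_end (s, p, q) then mbas (s, (p + p')%N, (q + q')%N) else 0.
Proof.
rewrite [LHS](@pbasM k mon_pmonoid) /= /mon_mul /=.
by case: (_ == _).
Qed.

Definition word_mon (p : qpath (Defs.double Q)) : T :=
  (pstart p, count (fun a : S * bool => ~~ a.2) (parrows p),
   count (fun a : S * bool => a.2) (parrows p)).

(** An arrow raises the vertex by one and a starred arrow lowers it by one, so the end of a path
    depends only on its start and on the two counts. *)
Lemma word_mon_end p : mon_end (word_mon p) = pend p.
Proof.
case: p => [[v s] vs]; rewrite /mon_end /word_mon /pend /pstart /parrows /= in vs *.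
elim: s v vs => //= -[i []] s IHs v /= /andP[/eqP <- /IHs <-] /=.
  by rewrite !add0n -iterS iterSr -[ordS i]cycE permK.
by rewrite !add0n -iterS iterSr -[cyc _]/(iter 1 cyc _) (iter_cycC 1) /= cycE.
Qed.

Definition to_mon : {linear kQQ -> {malg k[T]}} :=
  @lext k (qpath (Defs.double Q)) MA (fun p => mbas (word_mon p)).

Lemma to_monE p : to_mon (path_el k p) = mbas (word_mon p).
Proof. by rewrite /to_mon /path_el pbasE; exact: lextU. Qed.

Lemma mbas_mulPl c (u v w : MA) : (c *: u + v) * w = c *: (u * w) + v * w.
Proof. by rewrite mulrDl -scalerAl. Qed.
Lemma mbas_mulPr c (u v w : MA) : w * (c *: u + v) = c *: (w * u) + w * v.
Proof. by rewrite mulrDr -scalerAr. Qed.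

Lemma to_monM f g : to_mon (f * g) = (to_mon f : MA) * (to_mon g : MA).
Proof.
elim/pathalg_ind: f => [|a f f' IH IH'|p].
- by rewrite mul0r !linear0 mul0r.
- rewrite mulrDl -scalerAl !linearP IH IH'; exact: esym (mbas_mulPl _ _ _ _).
elim/pathalg_ind: g => [|a f f' IH IH'|q].
- by rewrite mulr0 !linear0 mulr0.
- rewrite mulrDr -scalerAr !linearP IH IH'; exact: esym (mbas_mulPr _ _ _ _).
rewrite path_elM !to_monE mbasM -/(word_mon p) word_mon_end.
case E: (Defs.pcomp p q) => [r|].
  have [-> rs ra _] := pcomp_end E; rewrite eqxx to_monE.
  by rewrite /word_mon rs ra !count_cat.
rewrite linear0; case: eqP => // qp.
by have [r] := @pcomp_Some (Defs.double Q) p q (esym qp); rewrite E.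
Qed.

Lemma arr_mon (a : arr Q) :
  to_mon (arrow k a) = mbas (a, 1%N, 0%N) /\
  to_mon (arrow_star k a) = mbas (ordS a, 0%N, 1%N).
Proof. by split; rewrite [LHS]to_monE. Qed.

Lemma to_mon_rel : to_mon (preproj_rel k Q) = 0.
Proof.
have E1 : to_mon (\sum_(a : arr Q) arrow k a * arrow_star k a) =
    \sum_(a : S) mbas (a, 1%N, 1%N) :> MA.
  rewrite linear_sum; apply: eq_bigr => a _; have [a1 a2] := arr_mon a.
  by rewrite [LHS]to_monM a1 a2 mbasM /mon_end /= cycE eqxx.
have E2 : to_mon (\sum_(a : arr Q) arrow_star k a * arrow k a) =
    \sum_(a : S) mbas (ordS a, 1%N, 1%N) :> MA.
  rewrite linear_sum; apply: eq_bigr => a _; have [a1 a2] := arr_mon a.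
  by rewrite [LHS]to_monM a1 a2 mbasM /mon_end /= -cycE permK eqxx.
rewrite /preproj_rel linearB E1 E2 [X in X - _](reindex_inj ordS_injective).
exact: subrr.
Qed.

Definition mon_ker : {pred kQQ} := [pred z | to_mon z == 0].
Fact mon_ker0 : 0 \in mon_ker. Proof. by rewrite inE linear0. Qed.
Fact mon_kerP c z w : z \in mon_ker -> w \in mon_ker -> c *: z + w \in mon_ker.
Proof. by rewrite !inE linearP => /eqP-> /eqP->; rewrite scaler0 addr0. Qed.

Lemma to_mon_ideal z : z \in in_gen_ideal [set preproj_rel k Q]%classic -> to_mon z = 0.
Proof.
move=> /asboolP /(_ (Submodule mon_ker0 mon_kerP)) H; apply/eqP; apply: H.
  move=> a y; rewrite !inE => /eqP y0; rewrite !to_monM y0.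
  by rewrite mulr0 mul0r.
by move=> _ ->; rewrite inE to_mon_rel.
Qed.

Definition pcoef_fun (a : A) : {malg k[T]} := to_mon (qrepr a).

Lemma pcoef_pi f : pcoef_fun (preproj_pi f) = to_mon f.
Proof.
apply/eqP; rewrite -subr_eq0 -linearB; apply/eqP/to_mon_ideal.
by apply/(qpi_eq (preproj_ideal k Q)); rewrite qreprK.
Qed.

Lemma preproj_surj (a : A) : preproj_pi (qrepr a) = a. Proof. exact: quotalg_surj. Qed.

Fact pcoef_linear : linear pcoef_fun.
Proof.
move=> c a a'; rewrite -[a]preproj_surj -[a']preproj_surj.
rewrite -[c *: _ + _](linearP (quotalg_pi (preproj_ideal k Q))) !pcoef_pi.
exact: linearP.
Qed.
Definition pcoef : {linear A -> {malg k[T]}} := mklin pcoef_linear.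

Lemma pcoefM a a' : pcoef (a * a') = (pcoef a : MA) * (pcoef a' : MA).
Proof.
rewrite -[a]preproj_surj -[a']preproj_surj.
rewrite [in LHS](@quotalg_piM k kQQ (preproj_ideal k Q)) /= !pcoef_pi.
exact: to_monM.
Qed.

Local Notation pi := (@preproj_pi k Q).
Definition pe (i : S) : A := vertex_el k (i : vert Q).
Definition pal (i : S) : A := pi (arrow k (i : arr Q)).
Definition pst (i : S) : A := pi (arrow_star k (i : arr Q)).
Definition px : A := \sum_i pal i.
Definition py : A := \sum_i pst i.
Definition pmon (t : T) : A := pe t.1.1 * px ^+ t.1.2 * py ^+ t.2.

Lemma piM f g : pi f * pi g = pi (f * g).
Proof. exact: (@quotalg_piM k kQQ (preproj_ideal k Q)). Qed.
Lemma pi0 : pi 0 = 0. Proof. exact: (linear0 (quotalg_pi (preproj_ideal k Q))). Qed.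

Lemma path_mul (p q r : qpath (Defs.double Q)) : pend p = pstart q ->
  pstart r = pstart p -> parrows r = parrows p ++ parrows q ->
  pi (path_el k p) * pi (path_el k q) = pi (path_el k r).
Proof.
move=> pq rp ra; rewrite piM path_elM.
by have /eqP -> : Defs.pcomp p q == Some r by apply/pcompP.
Qed.

Lemma path_mul0 (p q : qpath (Defs.double Q)) : pend p != pstart q ->
  pi (path_el k p) * pi (path_el k q) = 0.
Proof. by move=> pq; rewrite piM path_elM pcomp_None // pi0. Qed.

Lemma pe_pe i j : pe i * pe j = if j == i then pe i else 0.
Proof.
case: eqP => [->|/eqP ij]; first exact: path_mul.
by apply: path_mul0; rewrite eq_sym.
Qed.
Lemma pe_pal i j : pe i * pal j = if j == i then pal j else 0.
Proof.
case: eqP => [->|/eqP ij]; first exact: path_mul.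
by apply: path_mul0; rewrite eq_sym.
Qed.
Lemma pal_pe i j : pal i * pe j = if j == ordS i then pal i else 0.
Proof.
case: eqP => [->|/eqP ij]; first exact: path_mul.
by apply: path_mul0; rewrite eq_sym.
Qed.
Lemma pe_pst i j : pe i * pst j = if i == ordS j then pst j else 0.
Proof.
case: eqP => [->|/eqP ij]; first exact: path_mul.
exact: path_mul0.
Qed.
Lemma pst_pe i j : pst i * pe j = if j == i then pst i else 0.
Proof.
case: eqP => [->|/eqP ij]; first exact: path_mul.
by apply: path_mul0; rewrite eq_sym.
Qed.

Lemma pe_px i : pe i * px = pal i.
Proof.
rewrite mulr_sumr (bigD1 i) //= pe_pal eqxx big1 ?addr0 // => j /negPf ji.
by rewrite pe_pal ji.
Qed.
Lemma px_pe i : px * pe (ordS i) = pal i.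
Proof.
rewrite mulr_suml (bigD1 i) //= pal_pe eqxx big1 ?addr0 // => j /negPf ji.
by rewrite pal_pe (inj_eq ordS_injective) eq_sym ji.
Qed.
Lemma pe_py i : pe (ordS i) * py = pst i.
Proof.
rewrite mulr_sumr (bigD1 i) //= pe_pst eqxx big1 ?addr0 // => j /negPf ji.
by rewrite pe_pst (inj_eq ordS_injective) eq_sym ji.
Qed.
Lemma py_pe i : py * pe i = pst i.
Proof.
rewrite mulr_suml (bigD1 i) //= pst_pe eqxx big1 ?addr0 // => j /negPf ji.
by rewrite pst_pe eq_sym ji.
Qed.

Lemma pal_pst i j : pal i * pst j = if j == i then pal i * pst i else 0.
Proof.
case: eqP => [->//|/eqP ij]; apply: path_mul0 => /=.
by rewrite (inj_eq ordS_injective) eq_sym.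
Qed.
Lemma pst_pal i j : pst i * pal j = if j == i then pst i * pal i else 0.
Proof. by case: eqP => [->//|/eqP ij]; apply: path_mul0; rewrite eq_sym. Qed.

(** The products of non-consecutive arrows vanish; what remains is the preprojective relation. *)
Lemma pxy : px * py = py * px.
Proof.
have -> : px * py = \sum_i pal i * pst i.
  rewrite mulr_suml; apply: eq_bigr => i _; rewrite mulr_sumr (bigD1 i) //=.
  by rewrite big1 ?addr0 // => j /negPf ji; rewrite pal_pst ji.
have -> : py * px = \sum_i pst i * pal i.
  rewrite mulr_suml; apply: eq_bigr => i _; rewrite mulr_sumr (bigD1 i) //=.
  by rewrite big1 ?addr0 // => j /negPf ji; rewrite pst_pal ji.
apply/eqP; rewrite -subr_eq0; apply/eqP.
have rel0 : pi (preproj_rel k Q) = 0.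
  rewrite -pi0; apply/(qpi_eq (preproj_ideal k Q)); rewrite subr0.
  exact: gen_ideal_sub.
have pi_sum (F : S -> kQQ) : pi (\sum_i F i) = \sum_i pi (F i) :> A.
  exact: (linear_sum (quotalg_pi (preproj_ideal k Q))).
have E1 : \sum_i pal i * pst i = pi (\sum_(a : arr Q) arrow k a * arrow_star k a).
  by rewrite [RHS]pi_sum; apply: eq_bigr => i _; exact: piM.
have E2 : \sum_i pst i * pal i = pi (\sum_(a : arr Q) arrow_star k a * arrow k a).
  by rewrite [RHS]pi_sum; apply: eq_bigr => i _; exact: piM.
rewrite E1 E2 -[RHS]rel0; exact: (esym (linearB (quotalg_pi (preproj_ideal k Q)) _ _)).
Qed.

Lemma pe_xV p i : pe i * px ^+ p = px ^+ p * pe (iter p cyc i).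
Proof.
elim: p i => [|p IHp] i; first by rewrite mulr1 mul1r.
rewrite exprS mulrA pe_px -px_pe -mulrA IHp mulrA iterSr cycE.
by [].
Qed.
Lemma pe_yV q i : pe i * py ^+ q = py ^+ q * pe (iter q cycV i).
Proof.
elim: q i => [|q IHq] i; first by rewrite mulr1 mul1r.
have E : i = ordS (cycV i) by rewrite -cycE permKV.
by rewrite exprS mulrA {1}E pe_py -py_pe -mulrA IHq mulrA iterSr.
Qed.

Lemma pmon_end t : pmon t = px ^+ t.1.2 * py ^+ t.2 * pe (mon_end t).
Proof.
by rewrite /pmon pe_xV -mulrA pe_yV mulrA -iter_cycC.
Qed.

Lemma pxyX p q : px ^+ p * py ^+ q = py ^+ q * px ^+ p.
Proof. exact/commrX/commr_sym/commrX/commr_sym/pxy. Qed.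

Lemma pmonM s p q s' p' q' : pmon (s, p, q) * pmon (s', p', q') =
  if s' == mon_end (s, p, q) then pmon (s, (p + p')%N, (q + q')%N) else 0.
Proof.
rewrite pmon_end [pmon (s', _, _)]/pmon /= !mulrA -(mulrA _ (pe _) (pe _)) pe_pe.
case: eqP => [_|_]; last by rewrite mulr0 !mul0r.
rewrite -[_ * pe _](pmon_end (s, p, q)) /pmon /= -!mulrA; congr (_ * _).
by rewrite [py ^+ q * _]mulrA -pxyX !exprD !mulrA.
Qed.

(** As x and y commute, only the start of a path and the number of its arrows of each kind matter in
    A. *)
Lemma pmon_path (p : qpath (Defs.double Q)) : pi (path_el k p) = pmon (word_mon p).
Proof.
case: p => [[v s] /= vs]; rewrite /pmon /word_mon /pstart /parrows /=.
elim: s v vs => [|[i b] s IHs] v vs.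
  by rewrite !mulr1; congr (pi (path_el k _)); apply: val_inj.
have /andP[/eqP vE vs'] := vs.
rewrite -(@path_mul (@parr (Defs.double Q) (i, b)) (exist _ (_, s) vs')) //.
rewrite IHs; clear vs vs'; case: b vE => /= <-; rewrite !mulrA add1n add0n.
  have -> : pi (path_el k (@parr (Defs.double Q) (i, true))) * pe i = pe (ordS i) * py.
    by rewrite pe_py -[LHS]/(pst i * pe i) pst_pe eqxx.
  have pyX p : py * px ^+ p = px ^+ p * py := esym (pxyX p 1).
  by rewrite exprS -!mulrA; congr (_ * _); rewrite mulrA pyX -mulrA.
have -> : pi (path_el k (@parr (Defs.double Q) (i, false))) * pe (ordS i) = pe i * px.
  by rewrite pe_px -[LHS]/(pal i * pe (ordS i)) pal_pe eqxx.
by rewrite exprS -!mulrA.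
Qed.

Lemma pmon_span (a : A) : lext pmon (pcoef a) = a.
Proof.
rewrite -[in RHS](preproj_surj a).
change (lext pmon (to_mon (qrepr a)) = pi (qrepr a)).
have piP c (f g : kQQ) : pi (c *: f + g) = c *: pi f + pi g.
  exact: (linearP (quotalg_pi (preproj_ideal k Q)) c f g).
have tP c (f g : kQQ) : to_mon (c *: f + g) = c *: to_mon f + to_mon g.
  exact: (linearP to_mon c f g).
elim/pathalg_ind: (qrepr a) => [|c f g IHf IHg|p].
- by rewrite pi0 (linear0 to_mon) (linear0 (lext pmon)).
- by rewrite piP tP -IHf -IHg; exact: lext_linear.
rewrite to_monE pmon_path /mbas pbasE; exact: lextU.
Qed.

Lemma pcoef_pmon t : pcoef (pmon t) = << t >>.
Proof.
have xE (s : S) p q : mbas (s, p, q) * (pcoef px : MA) = mbas (s, p.+1, q).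
  have -> : pcoef px = \sum_i mbas (i, 1%N, 0%N) :> MA.
    rewrite linear_sum; apply: eq_bigr => i _; rewrite [LHS]pcoef_pi.
    by have [] := arr_mon i.
  rewrite mulr_sumr (bigD1 (mon_end (s, p, q))) //= mbasM eqxx addn1 addn0.
  by rewrite big1 ?addr0 // => r /negPf rs; rewrite mbasM rs.
have yE (s : S) p q : mbas (s, p, q) * (pcoef py : MA) = mbas (s, p, q.+1).
  have -> : pcoef py = \sum_i mbas (ordS i, 0%N, 1%N) :> MA.
    rewrite linear_sum; apply: eq_bigr => i _; rewrite [LHS]pcoef_pi.
    by have [] := arr_mon i.
  rewrite -(reindex_inj (P := xpredT) (F := fun i => mbas (i, 0%N, 1%N)) ordS_injective).
  rewrite mulr_sumr (bigD1 (mon_end (s, p, q))) //= mbasM eqxx addn1 addn0.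
  by rewrite big1 ?addr0 // => r /negPf rs; rewrite mbasM rs.
case: t => [[s p] q]; rewrite -(@pbasE k mon_pmonoid) -[RHS]/(mbas (s, p, q)).
rewrite /pmon /=; elim: q => [|q IHq].
  rewrite mulr1; elim: p => [|p IHp].
    by rewrite mulr1 [LHS]pcoef_pi to_monE.
  by rewrite exprSr mulrA -[LHS]/(pcoef _) pcoefM [X in X * _]IHp xE.
by rewrite exprSr mulrA -[LHS]/(pcoef _) pcoefM [X in X * _]IHq yE.
Qed.

Lemma pmon1 : 1 = \sum_s pmon (s, 0%N, 0%N).
Proof.
have E : 1 = \sum_(p <- ptrivs (Defs.double Q)) path_el k p :> kQQ by [].
rewrite -[LHS](rmorph1 (quotalg_pi (preproj_ideal k Q))) E raddf_sum big_map.
rewrite big_enum; apply: eq_bigr => i _; rewrite /pmon !mulr1.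
by [].
Qed.

Definition preproj_monomial : monomial_algebra A :=
  MonomialAlgebra cycC pmon_span pcoef_pmon pmonM pmon1.

End Preprojective.

(** * Invariant monomials *)

Section Support.
Variables (k : fieldType) (A : algType k) (D : monomial_algebra A).
Notation S := (mS D).
Notation sig := (msig D).
Notation tau := (mtau D).
Notation b := (mb D).

Definition mcoef (a : A) (t : S * nat * nat) : k := (mcf D a)@_t.
Definition mend (t : S * nat * nat) : S := iter t.1.2 sig (iter t.2 tau t.1.1).

Lemma mcoefP c u v t : mcoef (c *: u + v) t = c * mcoef u t + mcoef v t.
Proof. by rewrite /mcoef linearP mcoeffD mcoeffZ. Qed.
Lemma mcoef0 t : mcoef 0 t = 0.
Proof. by rewrite /mcoef linear0 mcoeff0. Qed.
Lemma mcoef_b t t' : mcoef (b t) t' = (t == t')%:R.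
Proof. by rewrite /mcoef mbK mcoeffU. Qed.
Fact mcoef_linear t : linear (fun a => mcoef a t : k^o).
Proof. by move=> c u v; rewrite mcoefP. Qed.
Lemma mcoef_sum I (r : seq I) (P : pred I) (F : I -> A) t :
  mcoef (\sum_(i <- r | P i) F i) t = \sum_(i <- r | P i) mcoef (F i) t.
Proof. exact: (linear_sum (mklin (mcoef_linear t))). Qed.
Lemma mcoefZ c u t : mcoef (c *: u) t = c * mcoef u t.
Proof. by have := mcoefP c u 0 t; rewrite mcoef0 !addr0. Qed.

Lemma mcoef_span a : a = \sum_(t <- msupp (mcf D a)) mcoef a t *: b t.
Proof. exact: mb_span. Qed.

Lemma mcoef_ext a a' : (forall t, mcoef a t = mcoef a' t) -> a = a'.
Proof.
move=> aa'; rewrite -[a](mcfK D) -[a'](mcfK D); congr (lext _ _).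
by apply/malgP => t; exact: aa'.
Qed.

Lemma sum_neq0 I (r : seq I) (F : I -> k) : \sum_(i <- r) F i != 0 ->
  exists i, F i != 0.
Proof.
elim: r => [|i r IHr]; first by rewrite big_nil eqxx.
rewrite big_cons; have [Fi0|Fi] := eqVneq (F i) 0; last by exists i.
by rewrite Fi0 add0r.
Qed.

Lemma mbM_end t p' q' s' : b t * b (s', p', q') =
  if s' == mend t then b (t.1.1, (t.1.2 + p')%N, (t.2 + q')%N) else 0.
Proof. by case: t => [[s p] q]; exact: mbM. Qed.

Lemma mb_mul s p q s' p' q' : s' = mend (s, p, q) ->
  b (s, p, q) * b (s', p', q') = b (s, (p + p')%N, (q + q')%N).
Proof. by move=> s'E; rewrite mbM_end s'E eqxx. Qed.

Lemma mcoef_mul_neq0 a a' t : mcoef (a * a') t != 0 ->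
  exists t1 t2, [/\ mcoef a t1 != 0, mcoef a' t2 != 0, t2.1.1 = mend t1 &
    t = (t1.1.1, (t1.1.2 + t2.1.2)%N, (t1.2 + t2.2)%N)].
Proof.
rewrite {1}(mcoef_span a) {1}(mcoef_span a') mulr_suml mcoef_sum.
move=> /sum_neq0[t1]; rewrite mulr_sumr mcoef_sum => /sum_neq0[[[s p] q]].
rewrite -scalerAl -scalerAr !mcoefZ !mulf_eq0 !negb_or => /and3P[at1 at2].
rewrite mbM_end; case: (s =P mend t1) => [E|_]; last by rewrite mcoef0 eqxx.
rewrite mcoef_b; case: (_ =P t) => [<- _|_]; last by rewrite eqxx.
by exists t1, (s, p, q).
Qed.

(** Such a monomial kills the terms of [a] that end elsewhere and shifts the others injectively, so
    no coefficients merge. *)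
Lemma mcoef_mulr_b a t p q :
  mcoef (a * b (mend t, p, q)) (t.1.1, (t.1.2 + p)%N, (t.2 + q)%N) = mcoef a t.
Proof.
elim/(mb_ind (D := D)): a => [|c u v IHu IHv|t'].
- by rewrite mul0r !mcoef0.
- by rewrite mulrDl -scalerAl !mcoefP IHu IHv.
rewrite mbM_end !mcoef_b; case: eqP => [tt'|ntt'].
  rewrite mcoef_b; congr (nat_of_bool _)%:R.
  by case: t t' {tt'} => [[s i] j] [[s' i'] j']; rewrite !xpair_eqE !eqn_add2r.
by rewrite mcoef0; case: eqP => // E; case: ntt'; rewrite E.
Qed.

Lemma mcoef_mull_b a s p q s' i j : s' = mend (s, p, q) ->
  mcoef (b (s, p, q) * a) (s, (p + i)%N, (q + j)%N) = mcoef a (s', i, j).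
Proof.
move=> s'E; elim/(mb_ind (D := D)): a => [|c u v IHu IHv|[[r i'] j']].
- by rewrite mulr0 !mcoef0.
- by rewrite mulrDr -scalerAr !mcoefP IHu IHv.
rewrite mbM_end !mcoef_b -s'E; case: eqP => [->|nrs] /=.
  by rewrite mcoef_b !xpair_eqE !eqn_add2l !eqxx.
by rewrite mcoef0; case: eqP => // -[E]; case: nrs.
Qed.

Lemma iter_msigtau p q s : iter p sig (iter q tau s) = iter q tau (iter p sig s).
Proof.
elim: p => //= p ->; elim: q => //= q IHq.
by rewrite msigtau IHq.
Qed.

Lemma mendD s p q p' q' :
  mend (s, (p + p')%N, (q + q')%N) = mend (mend (s, p, q), p', q').
Proof.
rewrite /mend /= addnC iterD [(q + _)%N]addnC iterD.
by rewrite [iter p sig (iter q' _ _)]iter_msigtau.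
Qed.

Definition mswap_idx (t : S * nat * nat) : S * nat * nat := (t.1.1, t.2, t.1.2).
Lemma mswap_idxK : involutive mswap_idx. Proof. by case=> [[]]. Qed.
Definition mswap_cf := mlift D (fun t => << mswap_idx t >> : {malg k[(S * nat * nat)%type]}).

Fact mswap_cfK a : lext (b \o mswap_idx) (mswap_cf a) = a.
Proof.
apply: (mb_ext_id (D := D) (f := lext (b \o mswap_idx) \o mswap_cf : {linear _ -> _})).
move=> t; change (lext (b \o mswap_idx) (mswap_cf (b t)) = b t).
by rewrite [mswap_cf _]mliftE lextU /= mswap_idxK.
Qed.
Fact mswap_bK t : mswap_cf ((b \o mswap_idx) t) = << t >>.
Proof. by rewrite [LHS]mliftE mswap_idxK. Qed.
Fact mswap_M s p q s' p' q' :
  (b \o mswap_idx) (s, p, q) * (b \o mswap_idx) (s', p', q') =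
  if s' == iter p tau (iter q sig s)
  then (b \o mswap_idx) (s, (p + p')%N, (q + q')%N) else 0.
Proof. by rewrite /= mbM iter_msigtau. Qed.
(** The same algebra with x and y exchanged, so that statements about x also give those about y. *)
Definition mswap : monomial_algebra A :=
  @MonomialAlgebra _ _ S tau sig (fun s => esym (msigtau D s)) (b \o mswap_idx)
    mswap_cf mswap_cfK mswap_bK mswap_M (mb1 D).

End Support.

Arguments mcoef {k A} D a t.

Lemma mcoef_b_mul_neq0 (k : fieldType) (A : algType k) (D : monomial_algebra A)
    t (a : A) t' : mcoef D (mb D t * a) t' != 0 ->
  t'.1.1 = t.1.1 /\ (t.1.2 <= t'.1.2)%N.
Proof.
move=> /mcoef_mul_neq0[t1 [t2 [+ _ _ ->]]].
rewrite mcoef_b; case: (_ =P t1) => [<- _|_]; last by rewrite eqxx.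
by split=> //=; apply: leq_addr.
Qed.

(** * A criterion of non-projectivity *)

Section NotProjective.
Variables (k : fieldType) (A : algType k) (D : monomial_algebra A).
Notation S := (mS D).
Notation b := (mb D).
Variables (B : nzRingType) (f : {rmorphism B -> A}) (M : lmodType B^c).
Variables (iota : {linear M -> (right_restr f : lmodType B^c)}).
Variables (s r' : S) (P p N q : nat) (u w : M) (b1 b2 : B).
Hypothesis iota_supp : forall m t, mcoef D (iota m : A) t != 0 ->
  [/\ t.1.1 = s, (P <= t.1.2)%N & t <> (s, P, 0%N)].
Hypothesis iota_u : iota u = b (s, (P + p)%N, 0%N) :> A.
Hypothesis u_w : (b1 : B^c) *: u = (b2 : B^c) *: w.
Hypothesis f_b1 : f b1 = b (mend (s, (P + p)%N, 0%N), 0%N, N).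
Hypothesis f_b2 : f b2 = b (r', p, q).

(* In a dual basis [m, phi_m] of [M], the monomials of [phi_m u] ending where *)
(* [iota u] ends are divisible by [x^p], as [phi_m u * b1 = phi_m w * b2];    *)
(* hence [iota u] cannot occur in [\sum_m iota m * phi_m u].                  *)
Lemma not_projective : ~ projective M.
Proof.
move=> projM; have [h hE] := projM _ _ (std_cover M) (idfun : {linear M -> M})
  (@std_cover_surj _ M).
have uE : u = \sum_(m <- msupp (h u)) (h u)@_m *: m by rewrite -{1}[u]hE.
pose phi m v : B := (h v)@_m.
have iotaE : iota u = \sum_(m <- msupp (h u)) (iota m : A) * f (phi m u) :> A.
  by rewrite {1}uE linear_sum; apply: eq_bigr => m _; rewrite linearZZ.
have : mcoef D (iota u : A) (s, (P + p)%N, 0%N) != 0.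
  by rewrite iota_u mcoef_b eqxx oner_neq0.
rewrite iotaE mcoef_sum => /sum_neq0[m] /mcoef_mul_neq0[t1 [t2 [mt1 ut2 st E]]].
have [t1s leP t1N] := iota_supp mt1; case: E => sE pE qE.
have end2 : mend t2 = mend (s, (P + p)%N, 0%N).
  rewrite pE qE sE mendD /=; congr mend; rewrite -[t2]/(t2).
  by case: t2 st {ut2 pE qE} => [[? ?] ?] /= ->; case: t1 {mt1 sE t1s leP t1N} => [[]].
have phi_b : phi m u * b1 = phi m w * b2.
  have := congr1 (fun v => (h v)@_m) u_w; rewrite !linearZZ !mcoeffZ.
  by [].
have : mcoef D (f (phi m u * b1)) (t2.1.1, (t2.1.2 + 0)%N, (t2.2 + N)%N) != 0.
  by rewrite rmorphM f_b1 -end2 mcoef_mulr_b.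
rewrite phi_b rmorphM f_b2 => /mcoef_mul_neq0[t3 [t4 [_ t4E _ [_ E _]]]].
move: t4E; rewrite mcoef_b; case: (_ =P t4) => [t4E _|_]; last by rewrite eqxx.
(* The term t2 of phi_m(u) is divisible by x^p, and t1 by x^P; as their product is e_s x^(P + p), t1
   must be e_s x^P, which the support of [iota] excludes. *)
have lep : (p <= t2.1.2)%N by move: E; rewrite -t4E addn0 /= => ->; apply: leq_addl.
have t1P : t1.1.2 = P.
  by apply/eqP; rewrite eqn_leq leP andbT -(leq_add2r p) pE leq_add2l.
have t10 : t1.2 = 0%N by move/eqP: qE; rewrite eq_sym addn_eq0 => /andP[/eqP].
by apply: t1N; rewrite -t1s -t1P -t10; case: t1 {mt1 t1s leP sE pE qE st t1P t10} => [[]].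
Qed.

End NotProjective.

Section Syzygies.
Variable R : nzRingType.

Lemma pdim1_kernel (P M : lmodType R) (f : {linear P -> M}) :
  pdim_le M 1 -> projective P -> (forall y, exists x, f x = y) ->
  projective (kermod f).
Proof. by move=> /pdim_pd_le pdM projP f_surj; exact: pd_le_ker projP f_surj pdM. Qed.

(** The kernel of [d] is a second syzygy of its cokernel. *)
Lemma pdim2_kernel (P Q : lmodType R) (d : {linear P -> Q}) :
  (forall M : lmodType R, pdim_le M 2) -> projective P -> projective Q ->
  projective (kermod d).
Proof.
move=> pd2 projP projQ; pose I := [pred y : Q | `[< exists x, d x = y >]].
have I0 : 0 \in I by apply/asboolP; exists 0; rewrite linear0.
have IP a x y : x \in I -> y \in I -> a *: x + y \in I.
  by move=> /asboolP[u <-] /asboolP[v <-]; apply/asboolP; exists (a *: u + v); rewrite linearP.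
pose J := Submodule I0 IP; pose p : {linear Q -> quotmod J} := qpi J.
have p_surj y : exists x, p x = y by exists (qrepr y); exact: qreprK.
have pd0 x : p (d x) = 0.
  by rewrite -(linear0 p); apply/qpi_eq; rewrite subr0; apply/asboolP; exists x.
have d_surj y : exists x, to_ker pd0 x = y.
  have : p (val y) = p 0 by rewrite kermodP linear0.
  by move=> /qpi_eq; rewrite subr0 => /asboolP[x xE]; exists x; apply: val_inj.
have /pdim_pd_le pdC := pd2 (quotmod J).
have projK : projective (kermod (to_ker pd0)).
  exact: pd_le_ker projP d_surj (pd_le_ker projQ p_surj pdC).
have i_ker (x : kermod d) : to_ker pd0 (val x) = 0.
  by apply: val_inj; rewrite /= kermodP.
have r_ker (x : kermod (to_ker pd0)) : d (val x) = 0.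
  by have := congr1 val (kermodP x).
have iL : linear (fun x => mkker (i_ker x)) by move=> a x y; apply: val_inj.
have rL : linear (fun x => mkker (r_ker x)) by move=> a x y; apply: val_inj.
by apply: (projective_retract (i := mklin iL) (r := mklin rL)) projK => x; apply: val_inj.
Qed.

End Syzygies.

(** * Diagonal actions and their invariants *)

Section DiagonalAction.
Variables (k : fieldType) (A : algType k).
Variable G : set {lrmorphism A -> A}.
Notation B := (fixedring G).

Lemma fixed_valM (x y : B) : val (x * y) = val x * val y. Proof. by []. Qed.

Definition fixed_incl : {rmorphism B -> A} := (val : B -> A).

Definition diagonal_action (D : monomial_algebra A) : Prop :=
  forall g, G g -> forall t, exists2 c, c != 0 & g (mb D t) = c *: mb D t.

Definition fixed_mon (D : monomial_algebra A) (t : mS D * nat * nat) : Prop :=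
  forall g, G g -> g (mb D t) = mb D t.

(* [x^N] and [y^N] are central and fixed by the action. *)
Record central_period (D : monomial_algebra A) (N : nat) : Prop := CentralPeriod {
  cp_gt0 : (0 < N)%N;
  cp_sig : forall s, iter N (msig D) s = s;
  cp_tau : forall s, iter N (mtau D) s = s;
  cp_x : forall s, @fixed_mon D (s, N, 0%N);
  cp_y : forall s, @fixed_mon D (s, 0%N, N) }.

Section Fixed.
Variable D : monomial_algebra A.
Notation S := (mS D).
Notation b := (mb D).
Notation F := (@fixed_mon D).
Hypothesis G_diag : diagonal_action D.

(** The eigenvalue of [g] on the monomial [t]; for varying [g] it is the character of [t]. *)
Definition wt (g : A -> A) t : k := mcoef D (g (b t)) t.

Lemma wtE g t : G g -> g (b t) = wt g t *: b t.
Proof.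
move=> Gg; have [c _ gt] := G_diag Gg t.
by rewrite /wt {2}gt mcoefZ mcoef_b eqxx mulr1.
Qed.

Lemma b_neq0 t : b t != 0.
Proof.
apply/eqP => bt0; have := mcoef_b (D := D) t t.
by rewrite bt0 mcoef0 eqxx => /eqP; rewrite eq_sym oner_eq0.
Qed.

Lemma scale_b_inj t c d : c *: b t = d *: b t -> c = d.
Proof. by move/(congr1 (fun a => mcoef D a t)); rewrite !mcoefZ mcoef_b eqxx !mulr1. Qed.

Lemma wt_neq0 g t : G g -> wt g t != 0.
Proof.
move=> Gg; have [c c0 gt] := G_diag Gg t.
by rewrite (scale_b_inj (etrans (esym (wtE t Gg)) gt)).
Qed.

Lemma wtM g s p q s' p' q' : G g -> s' = mend (s, p, q) ->
  wt g (s, (p + p')%N, (q + q')%N) = wt g (s, p, q) * wt g (s', p', q').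
Proof.
move=> Gg s'E; apply: (@scale_b_inj (s, (p + p')%N, (q + q')%N)).
rewrite -wtE //; have := mbM D s p q s' p' q'; rewrite -[iter p _ _]/(mend (s, p, q)) -s'E eqxx => <-.
have gM u v : g (u * v) = g u * g v := rmorphM g u v.
by rewrite gM !wtE // -scalerAl -scalerAr scalerA.
Qed.

Lemma F_wt t : F t <-> forall g, G g -> wt g t = 1.
Proof.
split=> Ft g Gg; last by rewrite wtE // Ft // scale1r.
by apply: (@scale_b_inj t); rewrite -wtE // Ft // scale1r.
Qed.

Lemma F_mul s p q s' p' q' : s' = mend (s, p, q) ->
  F (s, p, q) -> F (s', p', q') -> F (s, (p + p')%N, (q + q')%N).
Proof.
move=> s'E /F_wt F1 /F_wt F2; apply/F_wt => g Gg.
by rewrite (wtM _ _ Gg s'E) F1 // F2 // mulr1.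
Qed.
Lemma F_divl s p q s' p' q' : s' = mend (s, p, q) ->
  F (s, p, q) -> F (s, (p + p')%N, (q + q')%N) -> F (s', p', q').
Proof.
move=> s'E /F_wt F1 /F_wt F2; apply/F_wt => g Gg.
by rewrite -(F2 g Gg) (wtM _ _ Gg s'E) F1 // mul1r.
Qed.
Lemma F_divr s p q s' p' q' : s' = mend (s, p, q) ->
  F (s', p', q') -> F (s, (p + p')%N, (q + q')%N) -> F (s, p, q).
Proof.
move=> s'E /F_wt F1 /F_wt F2; apply/F_wt => g Gg.
by rewrite -(F2 g Gg) (wtM _ _ Gg s'E) F1 // mulr1.
Qed.
Lemma F0 s : F (s, 0%N, 0%N).
Proof.
apply/F_wt => g Gg; apply: (mulfI (wt_neq0 (s, 0%N, 0%N) Gg)).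
by rewrite -wtM // mulr1.
Qed.

Lemma mcoef_act g a t : G g -> mcoef D (g a) t = wt g t * mcoef D a t.
Proof.
move=> Gg; elim/(mb_ind (D := D)): a => [|c u v IHu IHv|t'].
- by rewrite linear0 !mcoef0 mulr0.
- by rewrite linearP !mcoefP IHu IHv mulrDr mulrCA.
rewrite wtE // mcoefZ !mcoef_b; case: eqP => [->//|_].
by rewrite !mulr0.
Qed.

Lemma fixed_supp (x : B) t : mcoef D (val x) t != 0 -> F t.
Proof.
move=> xt; apply/F_wt => g Gg; apply: (mulIf xt); rewrite mul1r -mcoef_act //.
by have /asboolP -> := valP x.
Qed.

Lemma supp_fixed a : (forall t, mcoef D a t != 0 -> F t) -> a \in fixed_pred G.
Proof.
move=> aF; apply/asboolP => g Gg; apply: (mcoef_ext (D := D)) => t.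
apply: etrans (mcoef_act a t Gg) _.
have [->|/aF/F_wt ->//] := eqVneq (mcoef D a t) 0; first by rewrite mulr0.
by rewrite mul1r.
Qed.

(** It serves as the Reynolds operator: a projection onto the fixed ring that is linear over it by
    [proj_mulr]. *)
Definition proj_fun : {linear A -> A} :=
  mlift D (fun t => if `[< F t >] then b t else 0).
Lemma proj_funE t : proj_fun (b t) = if `[< F t >] then b t else 0.
Proof. exact: mliftE. Qed.
Lemma mcoef_proj a t : mcoef D (proj_fun a) t = if `[< F t >] then mcoef D a t else 0.
Proof.
elim/(mb_ind (D := D)): a => [|c u v IHu IHv|t'].
- by rewrite linear0 !mcoef0 if_same.
- by rewrite linearP !mcoefP IHu IHv; case: ifP => _ //; rewrite mulr0 addr0.
rewrite proj_funE mcoef_b; case: (t' =P t) => [->|tt'].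
  by case: ifP; rewrite ?mcoef_b ?eqxx ?mcoef0.
rewrite if_same; case: ifP; rewrite ?mcoef0 // mcoef_b.
by case: eqP.
Qed.

Lemma proj_fixed a : proj_fun a \in fixed_pred G.
Proof.
apply: supp_fixed => t; rewrite mcoef_proj; case: asboolP => //.
by rewrite eqxx.
Qed.

Definition fproj_fun (a : A) : B := exist _ (proj_fun a) (proj_fixed a).
Fact fproj_linear : linear fproj_fun.
Proof. by move=> c u v; apply: val_inj; exact: (linearP proj_fun c u v). Qed.
Definition fproj : {linear A -> B} := mklin fproj_linear.
Lemma fprojE a : val (fproj a) = proj_fun a. Proof. by []. Qed.
Definition fb t : B := fproj (b t).

Lemma fb_val t : F t -> val (fb t) = b t.
Proof. by move=> Ft; rewrite fprojE proj_funE asboolT. Qed.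
Lemma fb0 t : ~ F t -> fb t = 0.
Proof. by move=> Ft; apply: val_inj; rewrite fprojE proj_funE asboolF. Qed.

Lemma fproj_val (x : B) : fproj (val x) = x.
Proof.
apply: val_inj; apply: (mcoef_ext (D := D)) => t; rewrite fprojE mcoef_proj.
case: asboolP => // nFt; apply/eqP; rewrite eq_sym.
by apply/negP => /negP /fixed_supp.
Qed.

Lemma fixed_ind (P : B -> Prop) : P 0 ->
  (forall c u v, P u -> P v -> P (c *: u + v)) -> (forall t, F t -> P (fb t)) ->
  forall x, P x.
Proof.
move=> P0 PD Pb x; rewrite -[x]fproj_val.
elim/(mb_ind (D := D)): (val x) => [|c u v Pu Pv|t].
- by rewrite linear0.
- by rewrite linearP; apply: PD.
by have [Ft|nFt] := pselect (F t); [apply: Pb | rewrite -/(fb t) fb0].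
Qed.

Lemma fb_mul s p q s' p' q' : F (s, p, q) -> s' = mend (s, p, q) ->
  fb (s, p, q) * fb (s', p', q') = fb (s, (p + p')%N, (q + q')%N).
Proof.
move=> F1 s'E; have [F2|nF2] := pselect (F (s', p', q')).
  apply: val_inj; rewrite fixed_valM (fb_val F1) (fb_val F2) (fb_val (F_mul s'E F1 F2)).
  by rewrite mbM -[iter p _ _]/(mend (s, p, q)) s'E eqxx.
by rewrite (fb0 nF2) mulr0 fb0 // => /(F_divl s'E F1).
Qed.

Lemma fb_mul0 t t' : t'.1.1 != mend t -> fb t * fb t' = 0.
Proof.
have [F1|/fb0 ->] := pselect (F t); last by rewrite mul0r.
have [F2|/fb0 -> _] := pselect (F t'); last by rewrite mulr0.
move=> tt'; apply: val_inj; rewrite fixed_valM (fb_val F1) (fb_val F2).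
by case: t' tt' {F2} => [[s' p'] q'] /= /negPf tt'; rewrite mbM_end tt'.
Qed.

Lemma proj_mulr a (x : B) : proj_fun (a * val x) = proj_fun a * val x.
Proof.
elim/(mb_ind (D := D)): a => [|c u v IHu IHv|[[s p] q]].
- by rewrite mul0r linear0 mul0r.
- by rewrite mulrDl -scalerAl !linearP IHu IHv mulrDl -scalerAl.
elim/fixed_ind: x => [|c u v IHu IHv|[[s' p'] q'] F2].
- by rewrite mulr0 linear0 mulr0.
- have -> : val (c *: u + v) = c *: val u + val v by [].
  by rewrite !mulrDr -!scalerAr linearP IHu IHv.
rewrite fb_val // mbM proj_funE -[iter p _ _]/(mend (s, p, q)); case: eqP => [s'E|ns'].
  rewrite proj_funE; case: (asboolP (F (s, p, q))) => F1.
    by rewrite (asboolT (F_mul s'E F1 F2)) mbM -[iter p _ _]/(mend (s, p, q)) s'E eqxx.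
  by rewrite asboolF ?mul0r // => /(F_divr s'E F2).
rewrite linear0; case: ifP => _; rewrite ?mul0r // mbM -[iter p _ _]/(mend (s, p, q)).
by case: eqP.
Qed.

End Fixed.
End DiagonalAction.

(** * Necessity of rectangularity *)

Section RightModuleMaps.
Variables (B A : nzRingType) (f : {rmorphism B -> A}).
Local Notation V := ((B^c)^o : lmodType B^c).

Fact lcomb_linear (c1 c2 : B) :
  linear (fun z : (V * V)%type => c1 * (z.1 : B) - c2 * (z.2 : B) : V).
Proof.
move=> r x y; change (c1 * ((x.1 : B) * (r : B) + y.1) - c2 * ((x.2 : B) * (r : B) + y.2) =
  (c1 * (x.1 : B) - c2 * (x.2 : B)) * (r : B) + (c1 * (y.1 : B) - c2 * (y.2 : B))).
by rewrite !mulrDr mulrBl !mulrA opprD addrACA.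
Qed.
(** Its kernel, the relations between [c1] and [c2], is a second syzygy of right modules. *)
Definition lcomb c1 c2 : {linear (V * V)%type -> V} := mklin (lcomb_linear c1 c2).

Fact lmul_restr_linear (a : A) :
  linear (fun x : V => a * f (x : B) : right_restr f).
Proof.
move=> r x y; rewrite rmorphD rmorphM mulrDr mulrA.
by [].
Qed.
Definition lmul_restr a : {linear V -> (right_restr f : lmodType B^c)} :=
  mklin (lmul_restr_linear a).

Fact pair_fst_linear : linear (fun z : (V * V)%type => z.1). Proof. by []. Qed.
Definition pair_fst : {linear (V * V)%type -> V} := mklin pair_fst_linear.

Lemma lcomb_eq c1 c2 z1 z2 : c1 * z1 = c2 * z2 -> lcomb c1 c2 (z1, z2) = 0.
Proof. by move=> E; apply/eqP; rewrite subr_eq0; apply/eqP. Qed.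
Lemma lcomb_kerP c1 c2 (z : kermod (lcomb c1 c2)) :
  c1 * ((val z).1 : B) = c2 * ((val z).2 : B).
Proof. by apply/eqP; rewrite -subr_eq0; apply/eqP; exact: (kermodP z). Qed.
Lemma regcE (r x : B) : (r : B^c) *: (x : V) = x * r. Proof. by []. Qed.
Lemma regcE2 (r x y : B) : (r : B^c) *: ((x, y) : (V * V)%type) = (x * r, y * r).
Proof. by []. Qed.

Lemma gldim2_lcomb c1 c2 : gldim_le B 2 -> projective (kermod (lcomb c1 c2)).
Proof.
move=> gl2; have projV := @projective_regular B^c.
exact (pdim2_kernel gl2 (projective_prod projV projV) projV).
Qed.

End RightModuleMaps.

Section Obstructions.
Variables (k : fieldType) (A : algType k) (D : monomial_algebra A).
Notation S := (mS D).
Notation b := (mb D).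
Variables (B : nzRingType) (f : {rmorphism B -> A}).

(** The map to A is a -> pr (e_s x^p a), and the relation is x^p1 y^L = y^q (x^p1 y^q1), starting
    where e_s x^p ends. *)
Lemma not_projective_restr (pr : {linear A -> A}) (s s' : S) p p1 q q1 L (b1 b2 : B) :
  (forall a x, pr (a * f x) = pr a * f x) ->
  (forall a t, mcoef D (pr a) t != 0 -> mcoef D a t != 0 /\ t <> (s, p, 0%N)) ->
  pr (b (s, (p + p1)%N, 0%N)) = b (s, (p + p1)%N, 0%N) ->
  mend (s, (p + p1)%N, 0%N) = s -> (q + q1)%N = L -> s' = mend (s, p, q) ->
  f b1 = b (s, 0%N, L) -> f b2 = b (s', p1, q1) ->
  ~ projective (right_restr f : lmodType B^c).
Proof.
move=> prM prN prE sE qL s'E fb1 fb2; pose v := mend (D := D) (s, p, 0%N).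
have vx : mend (v, p1, 0%N) = s by rewrite -mendD addn0.
have vy : mend (v, 0%N, q) = s' by rewrite -mendD addn0 add0n.
have iL : linear (fun a : right_restr f => pr (b (s, p, 0%N) * (a : A)) : right_restr f).
  move=> x a a'; change (pr (b (s, p, 0%N) * ((a : A) * f x + (a' : A))) =
    pr (b (s, p, 0%N) * (a : A)) * f x + pr (b (s, p, 0%N) * (a' : A))).
  by rewrite mulrDr mulrA linearD prM.
pose io : {linear (right_restr f : lmodType B^c) -> (right_restr f : lmodType B^c)} := mklin iL.
apply: (@not_projective _ _ D B f _ io s s' p p1 L q1
  (b (v, p1, 0%N)) (b (v, 0%N, q)) b1 b2) => //.
- by move=> a t /prN[/mcoef_b_mul_neq0[]].
- change (pr (b (s, p, 0%N) * b (v, p1, 0%N)) = b (s, (p + p1)%N, 0%N)).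
  by rewrite mb_mul.
- change (b (v, p1, 0%N) * f b1 = b (v, 0%N, q) * f b2).
  by rewrite fb1 fb2 !mb_mul // addn0 !add0n qL.
by rewrite fb1 sE.
Qed.

(** The module is that of the pairs with c1 z1 = c2 z2, mapped to A by e_s z1. From e_s y^L z1 = e_s
    x^p y^q z2, every term of e_s z1 is divisible by x^p, and e_s x^p itself never occurs. *)
Lemma gldim_gt2 (s s' : S) p p1 q q1 L (e c1 c2 u1 u2 w1 w2 b1 b2 : B) :
  mend (s, 0%N, L) = s ->
  (forall x t, mcoef D (f x) t != 0 -> t <> (s, p, 0%N)) ->
  f e = b (s, 0%N, 0%N) -> f c1 = b (s, 0%N, L) -> f c2 = b (s, p, q) ->
  f u1 = b (s, (p + p1)%N, 0%N) ->
  f b1 = b (mend (s, (p + p1)%N, 0%N), 0%N, L) -> f b2 = b (s', p1, q1) ->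
  c1 * u1 = c2 * u2 -> c1 * w1 = c2 * w2 ->
  u1 * b1 = w1 * b2 -> u2 * b1 = w2 * b2 -> ~ gldim_le B 2.
Proof.
move=> sL tN fe fc1 fc2 fu1 fb1 fb2 du dw E1 E2 /(@gldim2_lcomb _ c1 c2).
set d := lcomb c1 c2.
pose io : {linear kermod d -> (right_restr f : lmodType B^c)} :=
  lmul_restr f (b (s, 0%N, 0%N)) \o (pair_fst B \o val).
apply: (@not_projective _ _ D B f _ io s s' p p1 L q1
  (mkker (lcomb_eq du)) (mkker (lcomb_eq dw)) b1 b2) => //.
- move=> z t zt; pose x : B := (val z).1.
  have {}zt : mcoef D (b (s, 0%N, 0%N) * f x) t != 0 := zt.
  have tN' : t <> (s, p, 0%N) by apply: (tN (e * x)); rewrite rmorphM fe.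
  have [/= ts _] := mcoef_b_mul_neq0 zt; split=> //.
  have E : b (s, 0%N, L) * f x = b (s, p, q) * f ((val z).2 : B).
    by rewrite -fc1 -fc2 -!rmorphM; congr (f _); exact: lcomb_kerP z.
  have := mcoef_b_mul_neq0 (D := D) (t := (s, p, q)) (a := f ((val z).2 : B))
    (t' := (s, t.1.2, (L + t.2)%N)).
  have M1 := @mcoef_mull_b _ _ D (f x) s 0%N L s t.1.2 t.2 (esym sL).
  have M2 := @mcoef_mull_b _ _ D (f x) s 0%N 0%N s t.1.2 t.2 erefl.
  rewrite -E => H; have [|_ //] := H _.
  rewrite !add0n in M1 M2; rewrite M1 -M2; move: zt; rewrite -ts.
  by case: t {tN' ts H M1 M2} => [[]].
- change (b (s, 0%N, 0%N) * f u1 = b (s, (p + p1)%N, 0%N)).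
  by rewrite fu1 mb_mul.
by apply: val_inj; rewrite /= !regcE2 E1 E2.
Qed.

(** The module is the right ideal of the elements without e_s term, a first syzygy. It contains [u]
    and [w] with u w = w u, while the monomial e_s that would generate [u] is missing. *)
Lemma gldim_gt1 (s : S) N (e u w : B) : (0 < N)%N -> mend (s, N, 0%N) = s ->
  f e = b (s, 0%N, 0%N) -> f u = b (s, N, 0%N) -> f w = b (s, 0%N, N) ->
  u * w = w * u -> ~ gldim_le B 1.
Proof.
move=> N0 sN fe fu fw uw gl1; pose V : lmodType B^c := (B^c)^o.
pose J := [pred x : V | mcoef D (f (x : B)) (s, 0%N, 0%N) == 0].
have J0 : 0 \in J by rewrite inE; apply/eqP; rewrite rmorph0 mcoef0.
have JP (r : B^c) x y : x \in J -> y \in J -> r *: x + y \in J.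
  rewrite !inE => /eqP x0 /eqP y0.
  change (mcoef D (f ((x : B) * (r : B) + (y : B))) (s, 0%N, 0%N) == 0).
  have := mcoefP (D := D) 1 (f (x : B) * f (r : B)) (f (y : B)) (s, 0%N, 0%N).
  rewrite scale1r mul1r rmorphD rmorphM => ->.
  rewrite y0 addr0; apply/negPn/negP => /mcoef_mul_neq0[t1 [t2 [xt1 _ _ [E]]]].
  move=> /esym/eqP; rewrite addn_eq0 => /andP[/eqP p0 _] /esym/eqP.
  rewrite addn_eq0 => /andP[/eqP q0 _]; case/eqP: xt1.
  by rewrite -x0; congr mcoef; case: t1 E p0 q0 => [[? ?] ?] /= -> -> ->.
pose I := Submodule J0 JP; pose p : {linear V -> quotmod I} := qpi I.
have p_surj y : exists x, p x = y by exists (qrepr y); exact: qreprK.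
have p0 x : p x = 0 <-> mcoef D (f (x : B)) (s, 0%N, 0%N) = 0.
  rewrite -(linear0 p); split=> [/qpi_eq|xJ].
    by rewrite subr0 => /eqP.
  by apply/qpi_eq; rewrite subr0; apply/eqP.
have ux : p u = 0.
  by apply/p0; rewrite fu mcoef_b; case: eqP => // -[E]; rewrite E in N0.
have wy : p w = 0.
  by apply/p0; rewrite fw mcoef_b; case: eqP => // -[E]; rewrite E in N0.
have projK := pdim1_kernel (gl1 _) (@projective_regular B^c) p_surj.
pose io : {linear kermod p -> (right_restr f : lmodType B^c)} :=
  lmul_restr f (b (s, 0%N, 0%N)) \o val.
apply: (@not_projective _ _ D B f _ io s s 0%N N N 0%N
  (mkker ux) (mkker wy) w u _ _ _ _ _ projK) => //.
- move=> z t zt; pose x : B := val z.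
  have {}zt : mcoef D (b (s, 0%N, 0%N) * f x) t != 0 := zt.
  have [/= ts _] := mcoef_b_mul_neq0 zt; split=> // tE.
  have /p0 := kermodP z; rewrite -/x; move: zt; rewrite tE.
  have := @mcoef_mull_b _ _ D (f x) s 0%N 0%N s 0%N 0%N erefl.
  by rewrite !addn0 => -> /eqP.
- change (b (s, 0%N, 0%N) * f u = b (s, (0 + N)%N, 0%N)).
  by rewrite fu mb_mul.
- by apply: val_inj; rewrite /= !regcE.
by rewrite add0n sN.
Qed.

End Obstructions.

Section Necessity.
Variables (k : fieldType) (A : algType k) (G : set {lrmorphism A -> A}).
Variable D : monomial_algebra A.
Hypothesis G_diag : diagonal_action G D.
Variable N : nat.
Hypothesis HN : central_period G D N.
Notation B := (fixedring G).
Notation S := (mS D).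
Notation b := (mb D).
Notation F := (@fixed_mon k A G D).
Notation fb := (fb G_diag).

Lemma mend_x c s : mend (s, (N * c)%N, 0%N) = s :> S.
Proof.
elim: c => [|c IHc]; first by rewrite muln0.
rewrite mulnS -[0%N]addn0 mendD -[X in mend (X, _, _)]/(iter N (msig D) s).
by rewrite (cp_sig HN).
Qed.
Lemma mend_y c s : mend (s, 0%N, (N * c)%N) = s :> S.
Proof.
elim: c => [|c IHc]; first by rewrite muln0.
rewrite mulnS -[0%N]addn0 mendD -[X in mend (X, _, _)]/(iter N (mtau D) s).
by rewrite (cp_tau HN).
Qed.
Lemma F_x c s : F (s, (N * c)%N, 0%N).
Proof.
elim: c => [|c IHc]; first by rewrite muln0; exact: F0.
rewrite mulnS -[0%N]addn0; apply: (F_mul G_diag (s' := s)) => //; last exact: (cp_x HN).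
by rewrite /mend /= (cp_sig HN).
Qed.
Lemma F_y c s : F (s, 0%N, (N * c)%N).
Proof.
elim: c => [|c IHc]; first by rewrite muln0; exact: F0.
rewrite mulnS -[0%N]addn0; apply: (F_mul G_diag (s' := s)) => //; last exact: (cp_y HN).
by rewrite /mend /= (cp_tau HN).
Qed.
Lemma mend_xy c s : mend (s, (N * c)%N, (N * c)%N) = s :> S.
Proof. by rewrite -[X in (_, X, _)]addn0 -[X in (_, _, X)]add0n mendD mend_x mend_y. Qed.
Lemma F_xy c s : F (s, (N * c)%N, (N * c)%N).
Proof.
have := F_mul G_diag (esym (mend_x c s)) (F_x c s) (F_y c s).
by rewrite addn0 add0n.
Qed.

Lemma large_period p q : exists c, (p <= N * c)%N /\ (q <= N * c)%N.
Proof.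
exists (p + q)%N; split.
  by apply: leq_trans (leq_addr q p) _; rewrite leq_pmull // (cp_gt0 HN).
by apply: leq_trans (leq_addl p q) _; rewrite leq_pmull // (cp_gt0 HN).
Qed.

Section Violation.
Variables (s : S) (p q c : nat).
Hypotheses (Fpq : F (s, p, q)) (nFp : ~ F (s, p, 0%N)).
Hypotheses (lepL : (p <= N * c)%N) (leqL : (q <= N * c)%N).
Let L := (N * c)%N.
Let p1 := (L - p)%N.
Let q1 := (L - q)%N.
Let s' := mend (s, p, q).

Lemma viol_p : (p + p1)%N = L. Proof. exact: subnKC. Qed.
Lemma viol_q : (q + q1)%N = L. Proof. exact: subnKC. Qed.
(** The complement of the invariant e_s x^p y^q in the invariant e_s x^L y^L. *)
Lemma viol_F : F (s', p1, q1).
Proof.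
apply: (F_divl G_diag (erefl s')) => //.
by rewrite viol_p viol_q; exact: F_xy.
Qed.
Lemma viol_mend : mend (s', p1, q1) = s.
Proof. by rewrite -mendD viol_p viol_q mend_xy. Qed.

Lemma viol_supp (x : B) t : mcoef D (val x) t != 0 -> t <> (s, p, 0%N).
Proof. by move=> /(fixed_supp G_diag) Ft tE; apply: nFp; rewrite -tE. Qed.

Lemma violation_not_projective : ~ projective (over_fixedring G).
Proof.
have prN a t : mcoef D (proj_fun G D a) t != 0 -> mcoef D a t != 0 /\ t <> (s, p, 0%N).
  move=> at0; split; last exact: (viol_supp (x := fproj G_diag a)).
  by move: at0; rewrite mcoef_proj; case: ifP; rewrite ?eqxx.
have H := @not_projective_restr _ _ D B (fixed_incl G) (proj_fun G D) s s' p p1 q q1 L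
  (fb (s, 0%N, L)) (fb (s', p1, q1)).
apply: H => //.
- by move=> a x; exact: (proj_mulr G_diag).
- by rewrite viol_p proj_funE asboolT //; exact: F_x.
- by rewrite viol_p mend_x.
- exact: viol_q.
- by apply: fb_val; exact: F_y.
by apply: fb_val; exact: viol_F.
Qed.

Lemma violation_gldim : ~ gldim_le B 2.
Proof.
have Fu2 : F (s', p1, q1) := viol_F.
have FsL : F (s', 0%N, L) := F_y _ _.
have FxL : F (s, L, 0%N) := F_x _ _.
have FyL : F (s, 0%N, L) := F_y _ _.
have end_y r : r = mend (r, 0%N, L) := esym (mend_y c r).
have end_x r : r = mend (r, L, 0%N) := esym (mend_x c r).
(* Between e_s y^L and e_s x^p y^q there are the relations u = (x^L, x^p1 y^q1) and w = (x^p y^q,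
   y^L), and u y^L = w x^p1 y^q1. *)
apply: (@gldim_gt2 _ _ D B (fixed_incl G) s s' p p1 q q1 L (fb (s, 0%N, 0%N))
  (fb (s, 0%N, L)) (fb (s, p, q)) (fb (s, L, 0%N)) (fb (s', p1, q1))
  (fb (s, p, q)) (fb (s', 0%N, L)) (fb (s, 0%N, L)) (fb (s', p1, q1))).
- exact: mend_y.
- by move=> x t; exact: viol_supp.
- by apply: fb_val; exact: F0.
- exact: fb_val.
- exact: fb_val.
- by rewrite viol_p; exact: fb_val.
- by rewrite viol_p -end_x; exact: fb_val.
- exact: fb_val.
- by rewrite !fb_mul // viol_p viol_q addn0 add0n.
- by rewrite !fb_mul // addn0 add0n addnC.
- by rewrite !fb_mul // viol_p viol_q addn0 add0n.
by rewrite !fb_mul ?viol_mend // addn0 add0n addnC.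
Qed.

End Violation.

Definition x_rectangular := forall s p q, F (s, p, q) -> F (s, p, 0%N).

Lemma projective_x_rectangular : projective (over_fixedring G) -> x_rectangular.
Proof.
move=> projA s p q Fpq; apply: contrapT => nFp.
have [c [lep leq]] := large_period p q.
exact: violation_not_projective Fpq nFp lep leq projA.
Qed.

Lemma gldim_x_rectangular : gldim_le B 2 -> x_rectangular.
Proof.
move=> gl2 s p q Fpq; apply: contrapT => nFp.
have [c [lep leq]] := large_period p q.
exact: violation_gldim Fpq nFp lep leq gl2.
Qed.

Lemma fixedring_gldim_gt1 (s : S) : ~ gldim_le B 1.
Proof.
have Fx := F_x 1 s; have Fy := F_y 1 s; rewrite muln1 in Fx Fy.
have mx : s = mend (s, N, 0%N) by have := mend_x 1 s; rewrite muln1 => ->.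
have my : s = mend (s, 0%N, N) by have := mend_y 1 s; rewrite muln1 => ->.
apply: (@gldim_gt1 _ _ D B (fixed_incl G) s N (fb (s, 0%N, 0%N))
  (fb (s, N, 0%N)) (fb (s, 0%N, N))) => //.
- exact: cp_gt0 HN.
- by apply: fb_val; exact: F0.
- exact: fb_val.
- exact: fb_val.
by rewrite !fb_mul // !addn0 !add0n.
Qed.

End Necessity.

(** * Casimir elements *)

Section Windows.
Variables (V : zmodType) (I : V -> Prop).
Hypotheses (I0 : I 0) (ID : forall x y, I x -> I y -> I (x + y)).

Lemma big_closed J (r : seq J) (P : pred J) (f : J -> V) :
  (forall i, P i -> I (f i)) -> I (\sum_(i <- r | P i) f i).
Proof. by move=> If; elim/big_rec: _ => // i x Pi Ix; apply: ID; auto. Qed.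

(** Each step of the window exchanges f c for f (c + N), and the two agree modulo [I]. *)
Lemma window_shift (f : nat -> V) N c : (forall i, (i < c)%N -> I (f (i + N)%N - f i)) ->
  I (\sum_(i < N) f (c + i)%N - \sum_(i < N) f i).
Proof.
elim: c => [|c IHc] If.
  by rewrite [X in X - _](eq_bigr (fun i : 'I_N => f i)) ?subrr.
have -> : \sum_(i < N) f (c.+1 + i)%N - \sum_(i < N) f i =
    (f (c + N)%N - f c) + (\sum_(i < N) f (c + i)%N - \sum_(i < N) f i).
  rewrite addrA; congr (_ - _).
  have := big_ord_recr N (fun i : 'I_N.+1 => f (c + i)%N) (idx := 0) (op := +%R).
  rewrite big_ord_recl /= addn0 => E.
  rewrite [RHS]addrC addrA -E [RHS]addrC addKr.
  by apply: eq_bigr => i _; rewrite addSnnS.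
by apply: ID; [apply: If | apply: IHc => i lti; apply: If; apply: leqW].
Qed.

End Windows.

Section Casimir.
Variables (k : fieldType) (B : algType k) (S : finType).
Variables (F : S -> nat -> nat -> Prop) (e : S -> nat -> nat -> S).
Variables (m : S -> nat -> nat -> B) (N : nat).
Local Notation E := (env B).
Hypothesis eD : forall s p q p' q', e s (p + p')%N (q + q')%N = e (e s p q) p' q'.
Hypotheses (exN : forall s, e s N 0%N = s) (eyN : forall s, e s 0%N N = s).
Hypotheses (FxN : forall s, F s N 0%N) (FyN : forall s, F s 0%N N).
Hypothesis mulF : forall s p q p' q', F s p q ->
  m s p q * m (e s p q) p' q' = m s (p + p')%N (q + q')%N.
Hypothesis mulF' : forall s p q p' q', F (e s p q) p' q' ->
  m s p q * m (e s p q) p' q' = m s (p + p')%N (q + q')%N.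
Hypothesis mul0 : forall s p q s' p' q', s' != e s p q -> m s p q * m s' p' q' = 0.
Hypothesis m_ind : forall P : B -> Prop, P 0 ->
  (forall c u v, P u -> P v -> P (c *: u + v)) -> (forall s p q, F s p q -> P (m s p q)) ->
  forall x, P x.
Hypothesis N_gt0 : (0 < N)%N.

Definition cz1 : B := \sum_s m s N 0%N.
Definition cz2 : B := \sum_s m s 0%N N.

Variables d1 d2 : {linear B -> B}.
Hypothesis d1_nil : forall a, exists J, iter J d1 a = 0.
Hypothesis d2_nil : forall a, exists J, iter J d2 a = 0.
Hypotheses (d1K : forall a, d1 (cz1 * a) = a) (d2K : forall a, d2 (cz2 * a) = a).
Hypothesis d12 : forall a, d1 (cz2 * a) = cz2 * d1 a.
Variables (chi : {linear B -> k^o}) (s0 : S).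
Hypothesis chi_m : forall s, chi (m s N N) = (s == s0)%:R.
Hypothesis F00 : forall s, F s 0%N 0%N.
Hypothesis m_total : forall s i j, (i <= N)%N -> (j <= N)%N ->
  m s i j * m (e s i j) (N - i)%N (N - j)%N = m s N N \/
  m s i j * m (e s i j) (N - i)%N (N - j)%N = 0.
Hypothesis char0 : [pchar k] =i pred0.

Lemma cz1_m s p q : cz1 * m s p q = m s (N + p)%N q.
Proof.
rewrite mulr_suml (bigD1 s) //= -{2}[s]exN mulF // big1 ?addr0 // => r rs.
by rewrite mul0 // exN eq_sym.
Qed.
Lemma cz2_m s p q : cz2 * m s p q = m s p (N + q)%N.
Proof.
rewrite mulr_suml (bigD1 s) //= -{2}[s]eyN mulF // big1 ?addr0 // => r rs.
by rewrite mul0 // eyN eq_sym.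
Qed.
Lemma m_cz1 s p q : m s p q * cz1 = m s (N + p)%N q.
Proof.
rewrite mulr_sumr (bigD1 (e s p q)) //= mulF' // big1 => [|r rs]; last by rewrite mul0.
by rewrite addr0 addn0 addnC.
Qed.
Lemma m_cz2 s p q : m s p q * cz2 = m s p (N + q)%N.
Proof.
rewrite mulr_sumr (bigD1 (e s p q)) //= mulF' // big1 => [|r rs]; last by rewrite mul0.
by rewrite addr0 addn0 addnC.
Qed.

Lemma central_m (z : B) : (forall s p q, z * m s p q = m s p q * z) ->
  forall a, z * a = a * z.
Proof.
move=> zm; apply: m_ind => [|c u v zu zv|//]; first by rewrite mulr0 mul0r.
by rewrite mulrDr mulrDl -scalerAr -scalerAl zu zv.
Qed.
Lemma cz1C a : cz1 * a = a * cz1.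
Proof. by apply: central_m => s p q; rewrite cz1_m m_cz1. Qed.
Lemma cz2C a : cz2 * a = a * cz2.
Proof. by apply: central_m => s p q; rewrite cz2_m m_cz2. Qed.

Lemma comm_tens_central (z : B) : (forall a, z * a = a * z) ->
  forall w : E, w * comm_tens z = comm_tens z * w.
Proof.
move=> zC; elim/env_ind => [|c w w' IH IH'|a c]; first by rewrite mulr0 mul0r.
  by rewrite [LHS]mulrDl [RHS]mulrDr -scalerAl -scalerAr IH IH'.
by rewrite comm_tens_mull comm_tens_mulr zC [in RHS]zC.
Qed.

Notation z1 := (comm_tens cz1 : E).
Notation z2 := (comm_tens cz2 : E).
Let z1C := comm_tens_central cz1C.
Let z2C := comm_tens_central cz2C.

Definition in_cz (w : E) := exists u v, w = z1 * u + z2 * v.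
Lemma in_cz0 : in_cz 0. Proof. by exists 0, 0; rewrite !mulr0 addr0. Qed.
Lemma in_czD w w' : in_cz w -> in_cz w' -> in_cz (w + w').
Proof.
move=> [u [v ->]] [u' [v' ->]]; exists (u + u'), (v + v').
by rewrite !mulrDr addrACA.
Qed.
Lemma in_czM r w : in_cz w -> in_cz (r * w).
Proof.
by move=> [u [v ->]]; exists (r * u), (r * v); rewrite mulrDr !mulrA z1C z2C.
Qed.

(** Modelled on the sum of the x^i y^j (x) x^(N - i) y^(N - j), which commutes with k[x, y] modulo
    the z (x) 1 - 1 (x) z for z = x^N, y^N. In the application [m] is 0 on the non-invariant
    monomials. *)
Definition casimir : E := \sum_s \sum_(i < N) \sum_(j < N)
  tens (m s i j) (m (e s i j) (N - i)%N (N - j)%N).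

Section Monomial.
Variables (r : S) (c d : nat).
Hypothesis Frcd : F r c d.
Let phi i j : E := tens (m r i j) (m (e r i j) (N + c - i)%N (N + d - j)%N).

Lemma phi_shift1 i j : (i < c)%N -> in_cz (phi (i + N)%N j - phi i j).
Proof.
move=> lti; exists (tens (m r i j) (m (e r i j) (c - i)%N (N + d - j)%N)), 0.
rewrite mulr0 addr0 comm_tens_mull cz1_m m_cz1 /phi.
rewrite [(i + N)%N]addnC subnDl addnBA ?(ltnW lti) //.
by rewrite -[j in e r (N + i)%N j]add0n eD exN.
Qed.
Lemma phi_shift2 i j : (j < d)%N -> in_cz (phi i (j + N)%N - phi i j).
Proof.
move=> ltj; exists 0, (tens (m r i j) (m (e r i j) (N + c - i)%N (d - j)%N)).
rewrite mulr0 add0r comm_tens_mull cz2_m m_cz2 /phi.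
rewrite [(j + N)%N]addnC subnDl addnBA ?(ltnW ltj) //.
by rewrite -[i in e r i (N + j)%N]add0n eD eyN.
Qed.

Lemma casimir_mull : tens (m r c d) 1 * casimir =
  \sum_(i < N) \sum_(j < N) phi (c + i)%N (d + j)%N.
Proof.
rewrite /casimir mulr_sumr (bigD1 (e r c d)) //= [X in _ + X]big1 ?addr0; last first.
  move=> s sr; rewrite mulr_sumr big1 // => i _; rewrite mulr_sumr big1 // => j _.
  by rewrite tensM mul0 // tens0l.
rewrite mulr_sumr; apply: eq_bigr => i _; rewrite mulr_sumr; apply: eq_bigr => j _.
rewrite tensM mulF // mulr1 /phi eD.
by rewrite [(N + c)%N]addnC [(N + d)%N]addnC !subnDl.
Qed.

Lemma casimir_mulr : tens 1 (m r c d) * casimir =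
  \sum_(i < N) \sum_(j < N) phi i j.
Proof.
have eN s i j : (i < N)%N -> (j < N)%N -> e (e s i j) (N - i)%N (N - j)%N = s.
  move=> lti ltj; rewrite -eD (subnKC (ltnW lti)) (subnKC (ltnW ltj)).
  by have := eD s N 0%N 0%N N; rewrite addn0 add0n exN eyN.
rewrite /casimir mulr_sumr (bigD1 r) //= [X in _ + X]big1 ?addr0; last first.
  move=> s sr; rewrite mulr_sumr big1 // => i _; rewrite mulr_sumr big1 // => j _.
  by rewrite tensM mul0 ?tens0r // eN // eq_sym.
rewrite mulr_sumr; apply: eq_bigr => i _; rewrite mulr_sumr; apply: eq_bigr => j _.
have := @mulF' (e r i j) (N - i)%N (N - j)%N c d; rewrite eN // => /(_ Frcd) mE.
rewrite tensM mul1r /phi mE.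
by rewrite !addnBAC ?(ltnW (ltn_ord _)).
Qed.

(** Multiplication in the left factor moves the window of exponents by (c, d), multiplication in the
    right factor leaves it in place, and two windows of side N agree modulo [z1] and [z2]. *)
Lemma casimir_commute_mon : in_cz ((tens (m r c d) 1 - tens 1 (m r c d)) * casimir).
Proof.
rewrite mulrBl casimir_mull casimir_mulr.
set s2 := \sum_(i < N) \sum_(j < N) phi i j.
pose s1 := \sum_(i < N) \sum_(j < N) phi i (d + j)%N.
rewrite -(subrK s1 (\sum_(i < N) _)) -addrA; apply: in_czD.
  apply: (window_shift in_cz0 in_czD (f := fun i => \sum_(j < N) phi i (d + j)%N)) => i lti.
  by rewrite -sumrB; apply: (big_closed in_cz0 in_czD) => j _; exact: phi_shift1.
rewrite -sumrB; apply: (big_closed in_cz0 in_czD) => i _.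
apply: (window_shift in_cz0 in_czD) => j ltj; exact: phi_shift2.
Qed.

End Monomial.

Lemma casimir_commute a : in_cz ((tens a 1 - tens 1 a) * casimir).
Proof.
elim/m_ind: a => [|c u v IHu IHv|s p q Fspq]; last exact: casimir_commute_mon.
  by rewrite tens0l tens0r subrr mul0r; exact: in_cz0.
have -> : (tens (c *: u + v) 1 - tens 1 (c *: u + v)) * casimir =
    (c *: 1) * ((tens u 1 - tens 1 u) * casimir) + (tens v 1 - tens 1 v) * casimir.
  rewrite tensPl tensPr -scalerAl mul1r scalerAl -mulrDl; congr (_ * _).
  by rewrite scalerBr opprD addrACA.
by apply: in_czD IHv; exact: in_czM.
Qed.

Lemma casimir_ann (r : E) : r *: (1 : regbim B) = 0 -> in_cz (r * casimir).
Proof.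
move=> r0; have : in_cz ((r - tens 1 ((r *: (1 : regbim B)) : B)) * casimir).
  elim/env_ind: r {r0} => [|c w w' IH IH'|u v].
  - by rewrite scale0r tens0r subrr mul0r; exact: in_cz0.
  - have -> : (c *: w + w') *: (1 : regbim B) =
        c *: (w *: (1 : regbim B) : B) + (w' *: (1 : regbim B)) :> B.
      rewrite scalerDl; congr (_ + _).
      have -> : c *: w = tens c%:A 1 * w by rewrite tens_in_algl tens11 mulr1 -scalerAl mul1r.
      by rewrite -scalerA regbim_tens mulr1 -scalerAl mul1r.
    rewrite tensPr opprD addrACA -scalerBr mulrDl -scalerAl.
    by apply: in_czD IH'; rewrite -[_ * casimir]mul1r scalerAl; exact: in_czM.
  rewrite regbim_tens mulr1.
  have -> : tens u v - tens 1 (u * v) = tens 1 v * (tens u 1 - tens 1 u).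
    by rewrite mulrBr !tensM !mulr1 !mul1r.
  by rewrite -mulrA; apply: in_czM; exact: casimir_commute.
by rewrite r0 tens0r subr0.
Qed.

Lemma comm_tens_kill (z : B) : (forall a, z * a = a * z) ->
  forall x : regbim B, comm_tens z *: x = 0.
Proof.
by move=> zC x; rewrite scalerBl !regbim_tens !mulr1 mul1r zC subrr.
Qed.

(** [z1] and [z2] act as 0 on B, but in the image of the Casimir element under multiplication [chi]
    counts the pairs (i, j) with a nonzero product at [s0]. The pair (0, 0) is one of them, so the
    count is nonzero in characteristic 0. *)
Lemma casimir_notin : ~ in_cz casimir.
Proof.
move=> [u [v E]]; have E1 : (casimir *: (1 : regbim B) : B) = 0.
  by rewrite E scalerDl -!scalerA !comm_tens_kill ?addr0; [|exact: cz2C|exact: cz1C].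
have mE : casimir *: (1 : regbim B) =
    \sum_s \sum_(i < N) \sum_(j < N) m s i j * m (e s i j) (N - i)%N (N - j)%N :> B.
  rewrite /casimir scaler_suml; apply: eq_bigr => s _; rewrite scaler_suml.
  apply: eq_bigr => i _; rewrite scaler_suml; apply: eq_bigr => j _.
  by rewrite regbim_tens mulr1.
have [n chiE] : exists n, chi (casimir *: (1 : regbim B) : B) = n.+1%:R.
  rewrite mE (bigD1 s0) //= linearD [X in _ + X](_ : _ = 0) ?addr0; last first.
    rewrite linear_sum big1 // => s /negPf ss0; rewrite linear_sum big1 // => i _.
    rewrite linear_sum big1 // => j _.
    have [||->|->] := @m_total s i j; rewrite ?(ltnW (ltn_ord _)) ?linear0 //.
    by rewrite chi_m ss0.
  pose nn i j : nat := if pselect (m s0 i j * m (e s0 i j) (N - i)%N (N - j)%N = m s0 N N)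
    is left _ then 1%N else 0%N.
  have nnE (i j : 'I_N) : chi (m s0 i j * m (e s0 i j) (N - i)%N (N - j)%N) = (nn i j)%:R.
    rewrite /nn; case: pselect => [->|ne]; first by rewrite chi_m eqxx.
    have [||//|->] := @m_total s0 i j; rewrite ?(ltnW (ltn_ord _)) ?linear0 //.
  have sumE : chi (\sum_(i < N) \sum_(j < N) m s0 i j * m (e s0 i j) (N - i)%N (N - j)%N) =
      (\sum_(i < N) \sum_(j < N) nn i j)%:R.
    rewrite linear_sum natr_sum; apply: eq_bigr => i _.
    by rewrite linear_sum natr_sum; apply: eq_bigr => j _; exact: nnE.
  rewrite sumE; have nn00 : nn 0%N 0%N = 1%N.
    rewrite /nn; case: pselect => // -[].
    by rewrite !subn0 mulF ?add0n.
  pose j0 := Ordinal N_gt0; exists (\sum_(i < N) \sum_(j < N) nn i j).-1.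
  by rewrite prednK // (bigD1 j0) //= (bigD1 j0) //= nn00.
have /pcharf0P char0' := char0.
by move/eqP: chiE; rewrite E1 linear0 eq_sym char0'.
Qed.

Lemma casimir_obstruction : ~ (hom_exact (std_res (regbim B : lmodType E)) 1 /\
  hom_exact (std_res (regbim B : lmodType E)) 2).
Proof.
move=> [ex1 ex2]; apply: casimir_notin.
have [reg1 reg2 reg12] := regular_pair_left (cz1C cz2) d1_nil d2_nil d1K d2K d12.
apply: (@hom_exact_regular_sequence _ (regbim B : lmodType E) z1 z2 casimir 1
  _ _ reg1 reg2 reg12 _ _ _ ex1 ex2).
- by move=> r; rewrite z1C.
- by move=> r; rewrite z2C.
- by apply: comm_tens_kill; exact: cz1C.
- by move=> a; exists (tens (a : B) 1); rewrite regbim_tens !mulr1.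
exact: casimir_ann.
Qed.

(** If d > 2, Ext^1 and Ext^2 would vanish against [casimir_obstruction]; if d <= 2, Ext vanishes
    above degree 2, which bounds the projective dimension of the bimodule B. *)
Lemma twistedCY_gldim : twistedCY B -> gldim_le B 2.
Proof.
move=> [d [[P [fgP [M PM]]] [U _ [Ext0 _]]]]; apply: gldim_le_pd.
have [lt2d|led2] := ltnP 2 d.
  by case: casimir_obstruction; split; apply/Ext_eq0; apply: Ext0 => E; rewrite -E in lt2d.
apply: (fg_resolution_pd fgP PM) => i lt2i.
apply: (hom_exact_transfer (P := std_res _)).
- exact: std_res_projective.
- by move=> j; have [] := fgP j.
apply/Ext_eq0; apply: Ext0 => E; rewrite E in lt2i.
by rewrite leqNgt lt2i in led2.
Qed.

End Casimir.

(** * Twisted Calabi-Yau fixed rings have global dimension at most two *)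

Section FixedCasimir.
Variables (k : fieldType) (A : algType k) (G : set {lrmorphism A -> A}).
Variable D : monomial_algebra A.
Hypothesis G_diag : diagonal_action G D.
Variable N : nat.
Hypothesis HN : central_period G D N.
Local Notation B := (fixedring G).
Local Notation S := (mS D).
Local Notation b := (mb D).
Local Notation F := (@fixed_mon k A G D).
Local Notation fb := (fb G_diag).

Section Division.
Variables P Q : nat.
Hypothesis PQ : (0 < P + Q)%N.
Hypothesis ePQ : forall s : S, mend (s, P, Q) = s.
Hypothesis FPQ : forall s : S, F (s, P, Q).

Definition mdiv : {linear A -> A} := mlift D (fun t : S * nat * nat =>
  if (P <= t.1.2)%N && (Q <= t.2)%N then b (t.1.1, (t.1.2 - P)%N, (t.2 - Q)%N) else 0).
Fact fdiv_linear : linear (fun x : B => fproj G_diag (mdiv (val x))).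
Proof.
move=> c u v; have -> : val (c *: u + v) = c *: val u + val v by [].
by rewrite !linearP.
Qed.
Definition fdiv : {linear B -> B} := mklin fdiv_linear.

Lemma fdivE s p q : F (s, p, q) -> fdiv (fb (s, p, q)) =
  if (P <= p)%N && (Q <= q)%N then fb (s, (p - P)%N, (q - Q)%N) else 0.
Proof.
move=> Ft; rewrite [LHS](_ : _ = fproj G_diag (mdiv (val (fb (s, p, q))))) // fb_val //.
by rewrite [mdiv _]mliftE /=; case: ifP => _ //; exact: (linear0 (fproj G_diag)).
Qed.

Lemma F_div s p q : F (s, p, q) -> (P <= p)%N -> (Q <= q)%N ->
  F (s, (p - P)%N, (q - Q)%N).
Proof.
move=> Ft leP leQ; apply: (F_divl G_diag (esym (ePQ s)) (FPQ s)).
by rewrite !subnKC.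
Qed.

Lemma fdiv_nil a : exists J, iter J fdiv a = 0.
Proof.
elim/(@fixed_ind _ _ _ _ G_diag): a => [|c u v [J uJ] [J' vJ]|[[s p] q]].
- by exists 0%N.
- exists (maxn J J'); rewrite [LHS](iter_linear fdiv (maxn J J')).
  rewrite (iter_delta0 uJ) ?leq_maxl // (iter_delta0 vJ) ?leq_maxr //.
  by rewrite scaler0 addr0.
have [m] := ubnP (p + q)%N; elim: m => // m IHm in p q * => ltm Ft.
case: (boolP ((P <= p)%N && (Q <= q)%N)) => [/andP[leP leQ]|nle]; last first.
  by exists 1%N; rewrite [LHS](fdivE Ft) (negPf nle).
have [|J EJ] := IHm (p - P)%N (q - Q)%N _ (F_div Ft leP leQ).
  rewrite addnBA // addnBAC // -subnDA; apply: (leq_trans (n := p + q)%N) => //.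
  by rewrite ltn_subrL PQ (leq_trans PQ) ?leq_add.
by exists J.+1; rewrite iterSr fdivE // leP leQ.
Qed.

Definition fper : B := \sum_s fb (s, P, Q).
Lemma fper_mul s p q : fper * fb (s, p, q) = fb (s, (P + p)%N, (Q + q)%N).
Proof.
rewrite mulr_suml (bigD1 s) //= (fb_mul G_diag) // big1 ?addr0 // => r rs.
by rewrite (fb_mul0 G_diag) // ePQ eq_sym.
Qed.

Lemma F_per s p q : F (s, p, q) -> F (s, (P + p)%N, (Q + q)%N).
Proof. exact: (F_mul G_diag (esym (ePQ s))). Qed.

Lemma fdiv_per a : fdiv (fper * a) = a.
Proof.
elim/(@fixed_ind _ _ _ _ G_diag): a => [|c u v IHu IHv|[[s p] q] Ft].
- by rewrite mulr0 linear0.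
- by rewrite mulrDr -scalerAr linearP IHu IHv.
by rewrite fper_mul fdivE ?leq_addr ?addKn //; exact: F_per.
Qed.

End Division.

Lemma fdiv_per_comm P Q P' Q' : (forall s : S, mend (s, P, Q) = s) ->
  (forall s : S, mend (s, P', Q') = s) -> (forall s : S, F (s, P, Q)) ->
  (forall s : S, F (s, P', Q')) -> (P * P' = 0)%N -> (Q * Q' = 0)%N ->
  forall a, fdiv P Q (fper P' Q' * a) = fper P' Q' * fdiv P Q a.
Proof.
move=> e1 e2 F1 F2 PP' QQ'; elim/(@fixed_ind _ _ _ _ G_diag) => [|c u v IHu IHv|[[s p] q] Ft].
- by rewrite mulr0 !linear0 mulr0.
- by rewrite mulrDr -scalerAr !linearP IHu IHv mulrDr -scalerAr.
have le0 x x' y : (x * x' = 0)%N -> (x <= x' + y)%N = (x <= y)%N.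
  by case: x => // x; rewrite mulSn; case: x'.
have sub0 x x' y : (x * x' = 0)%N -> (x <= y)%N -> (x' + y - x = x' + (y - x))%N.
  by move=> _ le; rewrite addnBA.
rewrite fper_mul // !fdivE //; last exact: F_per.
rewrite !le0 //; case: ifP => [/andP[leP leQ]|_]; last by rewrite mulr0.
by rewrite fper_mul // !sub0.
Qed.

Lemma fixedring_twistedCY_gldim (s0 : S) : [pchar k] =i pred0 -> twistedCY (B : algType k) ->
  gldim_le B 2.
Proof.
move=> char0.
have ex s : mend (s, N, 0%N) = s :> S by have := mend_x HN 1 s; rewrite muln1.
have ey s : mend (s, 0%N, N) = s :> S by have := mend_y HN 1 s; rewrite muln1.
have Fx s : F (s, N, 0%N) by exact: (cp_x HN).
have Fy s : F (s, 0%N, N) by exact: (cp_y HN).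
have Fxy s : F (s, N, N) by have := F_xy G_diag HN 1 s; rewrite muln1.
have chiL : linear (fun x : B => mcoef D (val x) (s0, N, N) : k^o).
  by move=> c u v; exact: mcoefP.
have N0 := cp_gt0 HN.
have Nx : (0 < N + 0)%N by rewrite addn0.
have Ny : (0 < 0 + N)%N by rewrite add0n.
apply: (@twistedCY_gldim k (B : algType k) S (fun s p q => F (s, p, q))
  (fun s p q => mend (s, p, q)) (fun s p q => fb (s, p, q)) N _ ex ey Fx Fy _ _ _ _ N0
  (fdiv N 0) (fdiv 0 N) (fdiv_nil Nx ex Fx) (fdiv_nil Ny ey Fy)
  (fdiv_per ex Fx) (fdiv_per ey Fy)
  (fdiv_per_comm ex ey Fx Fy (muln0 _) (mul0n _)) (mklin chiL) s0) => //.
- by move=> s p q p' q'; exact: mendD.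
- by move=> s p q p' q' Ft; exact: (fb_mul G_diag).
- move=> s p q p' q' Ft'; have [Ft|nFt] := pselect (F (s, p, q)).
    exact: (fb_mul G_diag).
  rewrite (fb0 G_diag nFt) mul0r fb0 // => Ft.
  exact: nFt (F_divr G_diag erefl Ft' Ft).
- by move=> s p q s' p' q' ne; exact: (fb_mul0 G_diag).
- move=> P P0 PD Pm; apply: (fixed_ind (G_diag := G_diag) P0 PD) => -[[s p] q]; exact: Pm.
- move=> s; change (mcoef D (val (fb (s, N, N))) (s0, N, N) = (s == s0)%:R).
  by rewrite fb_val // mcoef_b !xpair_eqE !eqxx !andbT.
- by move=> s; exact: (F0 G_diag).
move=> s i j lei lej; have [Ft|nFt] := pselect (F (s, i, j)); last first.
  by right; rewrite (fb0 G_diag nFt) mul0r.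
by left; rewrite (fb_mul G_diag) // !subnKC.
Qed.

End FixedCasimir.

(** * Sufficiency of rectangularity *)

Section FirstReturn.
Variables (S : finType) (sig : {perm S}) (X : S -> nat -> Prop) (N : nat).
Hypotheses (N_gt0 : (0 < N)%N) (XN : forall s, X s N) (X0 : forall s, X s 0%N).
Hypothesis XD : forall s p p', X s p -> X (iter p sig s) p' -> X s (p + p')%N.
Hypothesis Xl : forall s p p', X s p -> X s (p + p')%N -> X (iter p sig s) p'.
Hypothesis Xr : forall s p p', X (iter p sig s) p' -> X s (p + p')%N -> X s p.

Fact ret_ex s : exists p, (0 < p)%N && `[< X s p >].
Proof. by exists N; rewrite N_gt0; apply/asboolP. Qed.
(** With X s p standing for the invariance of e_s x^p, the first return to the invariants when
    walking from [s] along x. *)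
Definition ret s : nat := ex_minn (ret_ex s).
Lemma ret_gt0 s : (0 < ret s)%N.
Proof. by rewrite /ret; case: ex_minnP => p /andP[]. Qed.
Lemma retX s : X s (ret s).
Proof. by rewrite /ret; case: ex_minnP => p /andP[_ /asboolP]. Qed.
Lemma ret_min s p : (0 < p)%N -> X s p -> (ret s <= p)%N.
Proof.
by move=> p0 /asboolP Xp; rewrite /ret; case: ex_minnP => r _; apply; rewrite p0.
Qed.

Lemma iter_sigD p p' s : iter (p + p') sig s = iter p' sig (iter p sig s).
Proof. by rewrite addnC iterD. Qed.
Lemma iter_sig_inj p : injective (iter p sig).
Proof. by elim: p => [|p IHp] s s' //= /perm_inj /IHp. Qed.

(** If [s] and [r] return to the same vertex and [r] takes longer, then [s] lies on the way from
    [r]; cancelling the return of [s] leaves an earlier return of [r]. *)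
Fact ret_sig_inj : injective (fun s => iter (ret s) sig s).
Proof.
move=> s r; wlog le : s r / (ret s <= ret r)%N => [H E|/= E].
  by have [/H/(_ E)|/ltnW/H/(_ (esym E))] := leqP (ret s) (ret r).
have rE : (ret r - ret s + ret s)%N = ret r by rewrite subnK.
have sE : iter (ret r - ret s) sig r = s.
  by apply: (@iter_sig_inj (ret s)); rewrite -iter_sigD rE.
have Xrs : X r (ret r - ret s)%N.
  by apply: (@Xr _ _ (ret s)); rewrite ?rE ?sE; exact: retX.
have [E0|gt0] := posnP (ret r - ret s)%N; first by rewrite E0 /= in sE.
by have := ret_min gt0 Xrs; rewrite leqNgt ltn_subrL !ret_gt0.
Qed.
Definition ret_perm : {perm S} := perm ret_sig_inj.
Lemma ret_permE s : ret_perm s = iter (ret s) sig s. Proof. exact: permE. Qed.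

Fixpoint rtime s c : nat := if c is c'.+1 then (ret s + rtime (ret_perm s) c')%N else 0%N.

Lemma iter_ret_perm c s : iter c ret_perm s = iter (rtime s c) sig s.
Proof. by elim: c s => //= c IHc s; rewrite -iterS iterSr IHc iter_sigD ret_permE. Qed.
Lemma rtimeX s c : X s (rtime s c).
Proof.
by elim: c s => //= c IHc s; apply: XD; [exact: retX | rewrite -ret_permE].
Qed.
Lemma rtimeD s c c' : rtime s (c + c') = (rtime s c + rtime (iter c ret_perm s) c')%N.
Proof. by elim: c s => //= c IHc s; rewrite IHc addnA -iterSr. Qed.

Lemma rtime_inj s : injective (rtime s).
Proof.
move=> c c'; wlog /subnKC <- : c c' / (c <= c')%N => [H E|].
  by have [/H/(_ E)|/ltnW/H/(_ (esym E))] := leqP c c'.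
rewrite rtimeD => /eqP; rewrite -{1}[rtime s c]addn0 eqn_add2l.
case: (c' - c)%N => [|d /=]; first by rewrite addn0.
by rewrite eq_sym addn_eq0 eqn0Ngt ret_gt0.
Qed.

(** An element of [X] can be cut at the first return by [Xl], so the successive returns exhaust
    [X]. *)
Lemma rtime_surj s p : X s p -> exists c, rtime s c = p.
Proof.
have [m] := ubnP p; elim: m => // m IHm in s p * => ltm Xp.
have [->|p0] := posnP p; first by exists 0%N.
have le := ret_min p0 Xp; have pE : (ret s + (p - ret s))%N = p by rewrite subnKC.
have [||c cE] := IHm (ret_perm s) (p - ret s)%N.
- by apply: (leq_trans (n := p)) => //; rewrite ltn_subrL ret_gt0.
- by rewrite ret_permE; apply: Xl; [exact: retX | rewrite pE].
by exists c.+1; rewrite /= cE.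
Qed.

Definition rindex s p : nat := xget 0%N [set c | rtime s c = p].
Lemma rindexK s p : X s p -> rtime s (rindex s p) = p.
Proof. by move=> /rtime_surj cE; have := xgetPex 0%N cE. Qed.
Lemma rtimeK s c : rindex s (rtime s c) = c.
Proof. by apply: (@rtime_inj s); apply: rindexK; exact: rtimeX. Qed.

Lemma ret_ext s s' : (forall p, X s p <-> X s' p) -> ret s = ret s'.
Proof.
move=> ss'; apply/eqP; rewrite eqn_leq; apply/andP.
by split; apply: ret_min; rewrite ?ret_gt0 //; apply/ss'; exact: retX.
Qed.

Lemma rtime_invariant (P : S -> S) : (forall s p, X (P s) p <-> X s p) ->
  (forall s, ret_perm (P s) = P (ret_perm s)) -> forall s c, rtime (P s) c = rtime s c.
Proof.
move=> PX PC s c; elim: c s => //= c IHc s.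
by rewrite PC IHc (ret_ext (PX s)).
Qed.

End FirstReturn.

Section Sufficiency.
Variables (k : fieldType) (A : algType k) (G : set {lrmorphism A -> A}).
Variable D : monomial_algebra A.
Hypothesis G_diag : diagonal_action G D.
Variable N : nat.
Hypothesis HN : central_period G D N.
Local Notation B := (fixedring G).
Local Notation S := (mS D).
Local Notation b := (mb D).
Local Notation sig := (msig D).
Local Notation tau := (mtau D).
Local Notation F := (@fixed_mon k A G D).
Local Notation fb := (fb G_diag).
Local Notation X := (fun s p => F (s, p, 0%N)).
Local Notation Y := (fun s q => F (s, 0%N, q)).

Lemma X_ops : [/\ forall s, X s N, forall s, X s 0%N,
  forall s p p', X s p -> X (iter p sig s) p' -> X s (p + p')%N,
  forall s p p', X s p -> X s (p + p')%N -> X (iter p sig s) p' &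
  forall s p p', X (iter p sig s) p' -> X s (p + p')%N -> X s p].
Proof.
split=> [||s p p'|s p p'|s p p']; [exact: (cp_x HN)|exact: (F0 G_diag)|..].
- exact: (@F_mul _ _ _ _ G_diag s p 0%N (iter p sig s) p' 0%N).
- exact: (@F_divl _ _ _ _ G_diag s p 0%N (iter p sig s) p' 0%N).
exact: (@F_divr _ _ _ _ G_diag s p 0%N (iter p sig s) p' 0%N).
Qed.
Lemma Y_ops : [/\ forall s, Y s N, forall s, Y s 0%N,
  forall s p p', Y s p -> Y (iter p tau s) p' -> Y s (p + p')%N,
  forall s p p', Y s p -> Y s (p + p')%N -> Y (iter p tau s) p' &
  forall s p p', Y (iter p tau s) p' -> Y s (p + p')%N -> Y s p].
Proof.
split=> [||s p p'|s p p'|s p p']; [exact: (cp_y HN)|exact: (F0 G_diag)|..].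
- exact: (@F_mul _ _ _ _ G_diag s 0%N p (iter p tau s) 0%N p').
- exact: (@F_divl _ _ _ _ G_diag s 0%N p (iter p tau s) 0%N p').
exact: (@F_divr _ _ _ _ G_diag s 0%N p (iter p tau s) 0%N p').
Qed.

Hypothesis Rx : forall s p q, F (s, p, q) -> F (s, p, 0%N).
Hypothesis Ry : forall s p q, F (s, p, q) -> F (s, 0%N, q).

(** In both directions a product is formed and rectangularity extracts y^q from it; for the
    converse, x^p is first completed to a period, which leads back to [s]. *)
Lemma Y_shift s p q : X s p -> Y (mend (s, p, 0%N)) q <-> Y s q.
Proof.
move=> Xp; split=> [Yq|Yq].
  by have := F_mul G_diag erefl Xp Yq; rewrite addn0 add0n => /Ry.
have [c [lep _]] := large_period HN p 0%N.
have sE : mend (mend (s, p, 0%N), (N * c - p)%N, 0%N) = s.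
  by rewrite -mendD subnKC // (mend_x HN).
have X1 : X (mend (s, p, 0%N)) (N * c - p)%N.
  by apply: (F_divl G_diag erefl Xp); rewrite subnKC //; exact: (F_x G_diag HN).
by have := F_mul G_diag (esym sE) X1 Yq; rewrite addn0 add0n => /Ry.
Qed.

Lemma X_shift s p q : Y s q -> X (mend (s, 0%N, q)) p <-> X s p.
Proof.
move=> Yq; split=> [Xp|Xp].
  by have := F_mul G_diag erefl Yq Xp; rewrite addn0 add0n => /Rx.
have := F_mul G_diag erefl Xp (proj2 (Y_shift q Xp) Yq).
rewrite addn0 add0n => Fpq.
by apply: (F_divl G_diag erefl Yq); rewrite addn0 add0n.
Qed.

Lemma F_XY s p q : F (s, p, q) <-> X s p /\ Y s q.
Proof.
split=> [Fpq|[Xp Yq]]; first by split; [exact: Rx Fpq | exact: Ry Fpq].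
by have := F_mul G_diag erefl Xp (proj2 (Y_shift q Xp) Yq); rewrite addn0 add0n.
Qed.

Let N0 := cp_gt0 HN.
Let XN : forall s, X s N := let: And5 h _ _ _ _ := X_ops in h.
Let X0 : forall s, X s 0%N := let: And5 _ h _ _ _ := X_ops in h.
Let XD := let: And5 _ _ h _ _ := X_ops in h.
Let Xl := let: And5 _ _ _ h _ := X_ops in h.
Let Xr := let: And5 _ _ _ _ h := X_ops in h.
Let YN : forall s, Y s N := let: And5 h _ _ _ _ := Y_ops in h.
Let Y0 : forall s, Y s 0%N := let: And5 _ h _ _ _ := Y_ops in h.
Let YD := let: And5 _ _ h _ _ := Y_ops in h.
Let Yl := let: And5 _ _ _ h _ := Y_ops in h.
Let Yr := let: And5 _ _ _ _ h := Y_ops in h.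

Definition fsig := ret_perm N0 XN Xr.
Definition ftau := ret_perm N0 YN Yr.
Definition xtime := rtime N0 XN Xr.
Definition ytime := rtime N0 YN Yr.

Lemma X_ftau s p : X (ftau s) p <-> X s p.
Proof. by rewrite /ftau ret_permE; exact: (X_shift p (retX N0 YN s)). Qed.
Lemma Y_fsig s q : Y (fsig s) q <-> Y s q.
Proof. by rewrite /fsig ret_permE; exact: (Y_shift q (retX N0 XN s)). Qed.

Lemma fsigtau s : fsig (ftau s) = ftau (fsig s).
Proof.
rewrite [LHS](ret_permE N0 XN Xr (ftau s)) [RHS](ret_permE N0 YN Yr (fsig s)).
rewrite (ret_ext N0 XN (X_ftau s)) (ret_ext N0 YN (Y_fsig s)).
rewrite [ftau s](ret_permE N0 YN Yr s) [fsig s](ret_permE N0 XN Xr s).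
exact: iter_msigtau.
Qed.

Lemma xtime_ftau d s c : xtime (iter d ftau s) c = xtime s c.
Proof.
elim: d => //= d <-; apply: rtime_invariant => [r p|r]; first exact: X_ftau.
exact: fsigtau.
Qed.
Lemma ytime_fsig c s d : ytime (iter c fsig s) d = ytime s d.
Proof.
elim: c => //= c <-; apply: rtime_invariant => [r p|r]; first exact: Y_fsig.
by rewrite -/ftau fsigtau.
Qed.

Definition fidx (t : S * nat * nat) : S * nat * nat :=
  (t.1.1, rindex N0 XN Xr t.1.1 t.1.2, rindex N0 YN Yr t.1.1 t.2).
Definition fmon (t : S * nat * nat) : B :=
  fb (t.1.1, xtime t.1.1 t.1.2, ytime t.1.1 t.2).

Lemma F_time s c d : F (s, xtime s c, ytime s d).
Proof. apply/F_XY; split; first exact: (rtimeX N0 XN X0 XD Xr s c).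
exact: (rtimeX N0 YN Y0 YD Yr s d).
Qed.
Lemma fmon_fidx t : F t -> fmon (fidx t) = fb t.
Proof.
case: t => [[s p] q] /F_XY[Xp Yq]; rewrite /fmon /=; congr (fb (s, _, _)).
  exact: (rindexK N0 XN Xl Xr Xp).
exact: (rindexK N0 YN Yl Yr Yq).
Qed.
Lemma fidx_time s c d : fidx (s, xtime s c, ytime s d) = (s, c, d).
Proof.
congr (_, _, _) => /=; first exact: (rtimeK N0 XN X0 XD Xl Xr).
exact: (rtimeK N0 YN Y0 YD Yl Yr).
Qed.

Definition fcf_fun : {linear A -> {malg k[(S * nat * nat)%type]}} :=
  mlift D (fun t => if `[< F t >] then << fidx t >> else 0).
Fact fcf_linear : linear (fun x : B => fcf_fun (val x)).
Proof. by move=> c u v; exact: (linearP fcf_fun c (val u) (val v)). Qed.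
Definition fcf : {linear B -> {malg k[(S * nat * nat)%type]}} := mklin fcf_linear.
Lemma fcfE t : F t -> fcf (fb t) = << fidx t >>.
Proof.
move=> Ft; rewrite [LHS](_ : _ = fcf_fun (val (fb t))) // fb_val //.
by rewrite [LHS]mliftE asboolT.
Qed.

Fact fcfK x : lext fmon (fcf x) = x.
Proof.
elim/(@fixed_ind _ _ _ _ G_diag): x => [|c u v IHu IHv|t Ft].
- by rewrite !linear0.
- have -> : fcf (c *: u + v) = c *: fcf u + fcf v by exact: (linearP fcf c u v).
  by rewrite lext_linear; congr (_ *: _ + _).
by rewrite fcfE // lextU fmon_fidx.
Qed.
Fact fmonK t : fcf (fmon t) = << t >>.
Proof.
case: t => [[s c] d]; rewrite fcfE ?fidx_time //; exact: F_time.
Qed.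

Fact fmonM s p q s' p' q' : fmon (s, p, q) * fmon (s', p', q') =
  if s' == iter p fsig (iter q ftau s) then fmon (s, (p + p')%N, (q + q')%N) else 0.
Proof.
have eE : mend (s, xtime s p, ytime s q) = iter p fsig (iter q ftau s).
  rewrite /fsig iter_ret_perm -/xtime -/fsig [xtime (iter q ftau s) p]xtime_ftau.
  by rewrite /ftau iter_ret_perm.
case: eqP => [s'E|ne]; last first.
  by apply: (fb_mul0 G_diag); rewrite /= eE; apply/eqP.
rewrite /fmon /= (fb_mul G_diag) ?eE //; last exact: F_time.
congr (fb (s, _, _)); rewrite s'E.
  have -> : iter p fsig (iter q ftau s) = iter q ftau (iter p fsig s).
    by elim: p {eE s'E} => //= p ->; elim: q => //= q <-; rewrite fsigtau.
  by rewrite xtime_ftau; symmetry; exact: rtimeD.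
by rewrite ytime_fsig; symmetry; exact: rtimeD.
Qed.

Fact fmon1 : 1 = \sum_s fmon (s, 0%N, 0%N).
Proof.
apply: val_inj; rewrite [LHS](mb1 D).
have vS : {morph (val : B -> A) : u v / u + v >-> u + v} by [].
rewrite (big_morph (val : B -> A) vS (erefl : val (0 : B) = 0)).
by apply: eq_bigr => s _; rewrite fb_val //; exact: (F0 G_diag).
Qed.

(** By [F_XY] invariance is tested on the x-part and the y-part separately, and the return times
    along x do not change along y; so products of first-return monomials form a basis with the
    required table. *)
Definition fixedring_monomial : monomial_algebra B :=
  MonomialAlgebra fsigtau fcfK fmonK fmonM fmon1.

End Sufficiency.

(** * Projectivity over the fixed ring *)

Lemma dual_basis_projective (R : nzRingType) (M : lmodType R) (K : finType)
    (e : K -> M) (phi : K -> {linear M -> R^o}) :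
  (forall x, x = \sum_m (phi m x : R) *: e m) -> projective M.
Proof.
move=> eE; have hL : linear (fun x => \sum_m (phi m x : R) *: (<< m >> : {malg R[K]})).
  move=> a x y; rewrite scaler_sumr -big_split; apply: eq_bigr => m _ /=.
  by rewrite linearP scalerDl scalerA.
apply: (projective_retract (i := mklin hL) (r := @lext R K M e)) => [x|].
  rewrite [RHS]eE linear_sum; apply: eq_bigr => m _.
  by rewrite linearZ /= lextU.
exact: projective_malg.
Qed.

Section Freeness.
Variables (k : fieldType) (A : algType k) (G : set {lrmorphism A -> A}).
Variable D : monomial_algebra A.
Hypothesis G_diag : diagonal_action G D.
Variable N : nat.
Hypothesis HN : central_period G D N.
Local Notation B := (fixedring G).
Local Notation S := (mS D).
Local Notation b := (mb D).
Local Notation F := (@fixed_mon k A G D).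
Local Notation fb := (fb G_diag).
Hypothesis Ry : forall s p q, F (s, p, q) -> F (s, 0%N, q).

Definition same_wt (t t' : S * nat * nat) : Prop := forall g, G g -> wt g t = wt g t'.

Lemma same_wt_F s p q p' q' :
  F (mend (s, p, q), p', q') <-> same_wt (s, p, q) (s, (p + p')%N, (q + q')%N).
Proof.
split=> [/(F_wt G_diag) Ft g Gg|st]; last apply/(F_wt G_diag) => g Gg.
  by rewrite (wtM G_diag _ _ Gg erefl) Ft // mulr1.
apply: (mulfI (wt_neq0 G_diag (s, p, q) Gg)).
by rewrite -(wtM G_diag _ _ Gg erefl) mulr1 st.
Qed.

Lemma same_wt_sym t t' : same_wt t t' -> same_wt t' t.
Proof. by move=> tt' g Gg; rewrite tt'. Qed.
Lemma same_wt_trans t2 t1 t3 : same_wt t1 t2 -> same_wt t2 t3 -> same_wt t1 t3.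
Proof. by move=> E E' g Gg; rewrite E // E'. Qed.

Lemma same_wt_x s p q c : same_wt (s, p, q) (s, (p + N * c)%N, q).
Proof. by rewrite -[q in X in same_wt _ X]addn0; apply/same_wt_F; exact: (F_x G_diag HN). Qed.
Lemma same_wt_y s p q c : same_wt (s, p, q) (s, p, (q + N * c)%N).
Proof. by rewrite -[p in X in same_wt _ X]addn0; apply/same_wt_F; exact: (F_y G_diag HN). Qed.

Fact xmin_ex (t : S * nat * nat) : exists a, `[< exists q, same_wt t (t.1.1, a, q) >].
Proof. by exists t.1.2; apply/asboolP; exists t.2; case: t => [[]]. Qed.
Fact ymin_ex (t : S * nat * nat) : exists a, `[< exists p, same_wt t (t.1.1, p, a) >].
Proof. by exists t.2; apply/asboolP; exists t.1.2; case: t => [[]]. Qed.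
Definition xmin t := ex_minn (xmin_ex t).
Definition ymin t := ex_minn (ymin_ex t).

Lemma xmin_P t : exists q, same_wt t (t.1.1, xmin t, q).
Proof. by rewrite /xmin; case: ex_minnP => a /asboolP. Qed.
Lemma ymin_P t : exists p, same_wt t (t.1.1, p, ymin t).
Proof. by rewrite /ymin; case: ex_minnP => a /asboolP. Qed.
Lemma xmin_le t a q : same_wt t (t.1.1, a, q) -> (xmin t <= a)%N.
Proof.
move=> ta; rewrite /xmin; case: ex_minnP => r _; apply; apply/asboolP.
by exists q.
Qed.
Lemma ymin_le t p a : same_wt t (t.1.1, p, a) -> (ymin t <= a)%N.
Proof.
move=> ta; rewrite /ymin; case: ex_minnP => r _; apply; apply/asboolP.
by exists p.
Qed.
Lemma xmin_ltN t : (xmin t < N)%N.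
Proof.
rewrite ltnNge; apply/negP => leN; have [q tq] := xmin_P t.
have : same_wt t (t.1.1, (xmin t - N)%N, q).
  apply: same_wt_trans tq (same_wt_sym _).
  by have := same_wt_x t.1.1 (xmin t - N) q 1; rewrite muln1 subnK.
move=> /xmin_le; rewrite leqNgt ltn_subrL (cp_gt0 HN) /=.
by rewrite (leq_trans (cp_gt0 HN) leN).
Qed.
Lemma ymin_ltN t : (ymin t < N)%N.
Proof.
rewrite ltnNge; apply/negP => leN; have [p tp] := ymin_P t.
have : same_wt t (t.1.1, p, (ymin t - N)%N).
  apply: same_wt_trans tp (same_wt_sym _).
  by have := same_wt_y t.1.1 p (ymin t - N) 1; rewrite muln1 subnK.
move=> /ymin_le; rewrite leqNgt ltn_subrL (cp_gt0 HN) /=.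
by rewrite (leq_trans (cp_gt0 HN) leN).
Qed.

(** [t] has the character of some x^a y^q and of some x^p y^d, with a and d minimal. Adding periods
    to d makes the second a multiple of the first; the quotient is invariant, and so is its y-part
    by rectangularity, which leads from x^a y^q to x^a y^d up to periods. *)
Lemma same_wt_min t : same_wt t (t.1.1, xmin t, ymin t).
Proof.
have [q tq] := xmin_P t; have [p tp] := ymin_P t.
have lep := xmin_le tp; have leq := ymin_le tq.
have [c [leqc _]] := large_period HN q 0%N.
have ltc : (q <= ymin t + N * c)%N by apply: leq_trans leqc (leq_addl _ _).
apply: (same_wt_trans tq); apply: same_wt_sym.
apply: (same_wt_trans (same_wt_y _ _ _ c)); apply: same_wt_sym.
have : same_wt (t.1.1, xmin t, q)
    (t.1.1, (xmin t + (p - xmin t))%N, (q + (ymin t + N * c - q))%N).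
  rewrite !subnKC //; apply: (same_wt_trans (same_wt_sym tq)).
  exact: same_wt_trans tp (same_wt_y _ _ _ _).
move=> /same_wt_F /Ry /same_wt_F.
by rewrite addn0 subnKC.
Qed.

Notation box := (S * 'I_N * 'I_N)%type.
(** The least monomial with the start and the character of [t]; periodicity confines it to a finite
    box. *)
Definition gen (t : S * nat * nat) : box :=
  (t.1.1, Ordinal (xmin_ltN t), Ordinal (ymin_ltN t)).
Definition gmon (m : box) : S * nat * nat := (m.1.1, nat_of_ord m.1.2, nat_of_ord m.2).

Lemma gen_ext t t' : t.1.1 = t'.1.1 -> same_wt t t' -> gen t = gen t'.
Proof.
move=> ss st; have xE : xmin t = xmin t'.
  apply/eqP; rewrite eqn_leq; apply/andP; split.
    have [q tq] := xmin_P t'; apply: (@xmin_le t _ q); rewrite ss.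
    exact: same_wt_trans st tq.
  have [q tq] := xmin_P t; apply: (@xmin_le t' _ q); rewrite -ss.
  exact: same_wt_trans (same_wt_sym st) tq.
have yE : ymin t = ymin t'.
  apply/eqP; rewrite eqn_leq; apply/andP; split.
    have [p tp] := ymin_P t'; apply: (@ymin_le t p); rewrite ss.
    exact: same_wt_trans st tp.
  have [p tp] := ymin_P t; apply: (@ymin_le t' p); rewrite -ss.
  exact: same_wt_trans (same_wt_sym st) tp.
by rewrite /gen ss; congr (_, _, _); apply: val_inj.
Qed.

Definition quot (t : S * nat * nat) : S * nat * nat :=
  (mend (gmon (gen t)), (t.1.2 - xmin t)%N, (t.2 - ymin t)%N).

Lemma xmin_leq t : (xmin t <= t.1.2)%N.
Proof. by apply: (@xmin_le t _ t.2); case: t => [[]]. Qed.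
Lemma ymin_leq t : (ymin t <= t.2)%N.
Proof. by apply: (@ymin_le t t.1.2); case: t => [[]]. Qed.

Lemma F_quot t : F (quot t).
Proof.
apply/same_wt_F; rewrite /= !subnKC ?xmin_leq ?ymin_leq //.
by have := same_wt_sym (same_wt_min t); case: t => [[]].
Qed.
Lemma mend_quot t : mend (quot t) = mend t.
Proof.
rewrite -mendD /= !subnKC ?xmin_leq ?ymin_leq //.
Qed.

Lemma gmon_quot t : b (gmon (gen t)) * val (fb (quot t)) = b t.
Proof.
rewrite fb_val; last exact: F_quot.
rewrite mb_mul // !subnKC ?xmin_leq ?ymin_leq //.
by case: t => [[]].
Qed.

Definition gcoord_fun (m : box) : {linear A -> B} :=
  mlift D (fun t => if gen t == m then fb (quot t) else 0).

(** Multiplying a monomial by an invariant one changes neither start nor character, hence not the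
    generator. *)
Lemma gcoord_mul m a (x : B) : gcoord_fun m (a * val x) = gcoord_fun m a * x.
Proof.
elim/(mb_ind (D := D)): a => [|c u v IHu IHv|t].
- by rewrite mul0r !linear0 mul0r.
- by rewrite mulrDl -scalerAl !linearP IHu IHv mulrDl -scalerAl.
elim/(@fixed_ind _ _ _ _ G_diag): x => [|c u v IHu IHv|[[s p] q] Ft].
- by rewrite !mulr0 linear0.
- have -> : val (c *: u + v) = c *: val u + val v by [].
  by rewrite !mulrDr -!scalerAr linearP IHu IHv.
rewrite fb_val // mbM_end [gcoord_fun m (b t)]mliftE.
case: eqP => [sE|ns]; last first.
  rewrite linear0; case: ifP => _; last by rewrite mul0r.
  by rewrite (fb_mul0 G_diag) // mend_quot; apply/eqP.
rewrite [LHS]mliftE; set t' := (_, _, _).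
have tt' : same_wt t t'.
  rewrite /t'; case: t sE {t'} => [[s0 p0] q0] /= sE.
  by apply/same_wt_F; rewrite -sE.
have genE : gen t = gen t' by exact: gen_ext.
have xE : xmin t' = xmin t by have := congr1 (fun m : box => m.1.2 : nat) genE.
have yE : ymin t' = ymin t by have := congr1 (fun m : box => m.2 : nat) genE.
rewrite -genE; case: eqP => _; last by rewrite mul0r.
rewrite (fb_mul G_diag _ _ (F_quot t)) ?mend_quot //; congr fb.
rewrite /quot -genE xE yE /=; congr (_, _, _).
  by rewrite addnBAC // xmin_leq.
by rewrite addnBAC // ymin_leq.
Qed.

Lemma gcoord_sum a : a = \sum_m b (gmon m) * val (gcoord_fun m a).
Proof.
elim/(mb_ind (D := D)): a => [|c u v IHu IHv|t].
- by rewrite big1 // => m _; rewrite linear0 mulr0.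
- rewrite {1}IHu {1}IHv scaler_sumr -big_split; apply: eq_bigr => m _ /=.
  have -> : val (gcoord_fun m (c *: u + v)) =
      c *: val (gcoord_fun m u) + val (gcoord_fun m v) by rewrite linearP.
  by rewrite mulrDr scalerAr.
have gE m : gcoord_fun m (b t) = if gen t == m then fb (quot t) else 0 by exact: mliftE.
rewrite (bigD1 (gen t)) // gE eqxx gmon_quot big1 => [|m mt]; first by rewrite [RHS]addr0.
by rewrite gE eq_sym (negPf mt) mulr0.
Qed.

Lemma over_fixedring_projective : projective (over_fixedring G).
Proof.
have pL m : linear (fun a : over_fixedring G => gcoord_fun m (a : A) : (B^c)^o).
  move=> x u v; change (gcoord_fun m ((u : A) * val (x : B) + v) =
    gcoord_fun m (u : A) * (x : B) + gcoord_fun m (v : A) :> B).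
  by rewrite linearD gcoord_mul.
apply: (@dual_basis_projective _ (over_fixedring G) box (fun m => b (gmon m))
  (fun m => mklin (pL m))) => a.
exact: gcoord_sum.
Qed.

End Freeness.

(** * The equivalences for a diagonal action *)

Section Equivalence.
Variables (k : fieldType) (A : algType k) (G : set {lrmorphism A -> A}).
Variable D : monomial_algebra A.
Hypothesis G_diag : diagonal_action G D.
Variable N : nat.
Hypothesis HN : central_period G D N.
Local Notation B := (fixedring G).
Local Notation F := (@fixed_mon k A G D).

Lemma diagonal_mswap : diagonal_action G (mswap D).
Proof. by move=> g Gg t; exact: (G_diag Gg (mswap_idx t)). Qed.
Lemma central_period_mswap : central_period G (mswap D) N.
Proof.
by case: HN => N0 Hsig Htau Hx Hy; split.
Qed.

Definition y_rectangular := forall s p q, F (s, p, q) -> F (s, 0%N, q).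

Lemma x_rectangular_mswap : x_rectangular G (mswap D) -> y_rectangular.
Proof. by move=> R s p q; exact: (R s q p). Qed.

Lemma gldim_rectangular : gldim_le B 2 -> x_rectangular G D /\ y_rectangular.
Proof.
move=> gl2; split; first exact: (gldim_x_rectangular G_diag HN gl2).
apply: x_rectangular_mswap.
exact: (gldim_x_rectangular diagonal_mswap central_period_mswap gl2).
Qed.

Lemma projective_rectangular :
  projective (over_fixedring G) -> x_rectangular G D /\ y_rectangular.
Proof.
move=> projA; split; first exact: (projective_x_rectangular G_diag HN projA).
apply: x_rectangular_mswap.
exact: (projective_x_rectangular diagonal_mswap central_period_mswap projA).
Qed.

Lemma rectangular_twistedCY : x_rectangular G D /\ y_rectangular ->
  twistedCY (B : algType k).
Proof. by case=> Rx Ry; exact: monomial_algebra_twistedCY (fixedring_monomial G_diag HN Rx Ry). Qed.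
Lemma rectangular_gldim : x_rectangular G D /\ y_rectangular -> gldim_le B 2.
Proof. by case=> Rx Ry; exact: monomial_algebra_gldim (fixedring_monomial G_diag HN Rx Ry). Qed.
Lemma rectangular_projective : x_rectangular G D /\ y_rectangular ->
  projective (over_fixedring G).
Proof. by case=> _ Ry; exact: (over_fixedring_projective G_diag HN Ry). Qed.

End Equivalence.

Lemma pdim_leS (R : nzRingType) (M : lmodType R) d d' :
  (d <= d')%N -> pdim_le M d -> pdim_le M d'.
Proof.
by move=> dd' [P projP P0]; exists P => // i lti; apply: P0; apply: leq_ltn_trans lti.
Qed.

Lemma gldim_eq2 (R : nzRingType) : gldim R = Some 2%N <-> gldim_le R 2 /\ ~ gldim_le R 1.
Proof.
rewrite /gldim; case: pselect => [ex|nex]; last first.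
  by split=> // -[gl2 _]; case: nex; exists 2%N; apply/asboolP.
case: ex_minnP => d /asboolP gld dmin; split=> [[dE]|[gl2 ngl1]].
  rewrite dE in gld dmin; split=> // gl1.
  by have := dmin 1%N; rewrite asboolT // => /(_ isT).
congr Some; apply/eqP; rewrite eqn_leq dmin ?ltnNge; last exact/asboolP.
by apply/negP => led1; apply: ngl1 => M; exact: pdim_leS led1 (gld M).
Qed.

(** * Graded automorphisms of the preprojective algebra *)

Definition eigenvector (k : fieldType) (A : algType k) (g : A -> A) (a : A) : Prop :=
  exists2 c, c != 0 & g a = c *: a.

Lemma eigenvectorM (k : fieldType) (A : algType k) (g : {lrmorphism A -> A}) (a a' : A) :
  eigenvector g a -> eigenvector g a' -> eigenvector g (a * a').
Proof.
move=> [c c0 cE] [d d0 dE]; exists (c * d); first exact: mulf_neq0.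
have gM : g (a * a') = g a * g a' := rmorphM g a a'.
by rewrite gM cE dE -scalerAl -scalerAr scalerA.
Qed.

Section GradedAction.
Variables (k : fieldType) (m : nat).
Hypothesis m_ge2 : (2 <= m)%N.
Notation Q := (Atilde m).
Notation S := 'I_m.+1.
Notation A := (preproj k Q).
Local Notation pi := (@preproj_pi k Q).
Local Notation kQQ := (pathalg k (Defs.double Q)).
Local Notation D := (preproj_monomial k m).
Local Notation b := (mb D).
Local Notation mon := (@pmon k m).
Local Notation pe := (@pe k m).
Local Notation cyc := (cyc m).
Local Notation cycV := (cycV m).

Lemma iter_cyc p (i : S) : iter p cyc i = ((i + p) %% m.+1)%N :> nat.
Proof.
elim: p => [|p IHp]; first by rewrite addn0 modn_small.
by rewrite iterS cycE /= IHp addnS -addn1 modnDml addn1.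
Qed.
Lemma cyc_period i : iter m.+1 cyc i = i.
Proof. by apply: val_inj; rewrite /= -iterS iter_cyc modnDr modn_small. Qed.
Lemma cycV_period i : iter m.+1 cycV i = i.
Proof.
have H p j : iter p cycV (iter p cyc j) = j.
  by elim: p j => // p IHp j; rewrite iterSr iterS /cycV permK IHp.
by rewrite -{1}(cyc_period i) H.
Qed.
(** The two neighbours of a vertex differ once there are three vertices; with only two, an arrow and
    a starred arrow would be parallel. *)
Lemma cycV_neq_cyc i : cycV i != cyc i.
Proof.
apply/eqP => E0; have : iter 2 cyc i = i by rewrite /= -E0 /cycV permKV.
move=> /(congr1 (@nat_of_ord _)); rewrite iter_cyc => E.
have lt := ltn_ord i; have [lti|gei] := ltnP (i + 2)%N m.+1.
  by rewrite modn_small // in E; lia.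
rewrite -(subnK gei) modnDr modn_small in E; lia.
Qed.

Lemma graded_supp j a t : @graded_part k Q j a -> mcoef D a t != 0 -> (t.1.2 + t.2)%N = j.
Proof.
move=> [f fj <-].
have -> : pi f = \sum_(p <- msupp f) f@_p *: mon (word_mon p).
  have lin := linear_sum (quotalg_pi (preproj_ideal k Q)).
  rewrite {1}[f]malg_span; rewrite [LHS]lin; apply: eq_bigr => p _.
  rewrite -pmon_path /path_el pbasE.
  exact: (linearZZ (quotalg_pi (preproj_ideal k Q))  (f@_p) << p >>).
rewrite mcoef_sum => /sum_neq0[p]; rewrite mcoefZ mulf_eq0 negb_or => /andP[fp].
rewrite mcoef_b; case: (_ =P t) => [<- _|_]; last by rewrite eqxx.
rewrite -(fj p) -?mcoeff_neq0 // /word_mon /=.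
by rewrite -(count_predC (fun a : S * bool => ~~ a.2)); congr addn; apply: eq_count => x /=; rewrite negbK.
Qed.

Lemma graded_mon1 i p q : (p + q = 1)%N -> @graded_part k Q 1 (mon (i, p, q)).
Proof.
have arrP a : @graded_part k Q 1 (pi (path_el k (@parr (Defs.double Q) a))).
  exists (path_el k (@parr (Defs.double Q) a)) => // r.
  by rewrite /path_el pbasE msuppU oner_eq0 inE => /eqP ->.
case: p => [|[|p]] //= => [|/eqP]; last by rewrite addSn eqSS addn_eq0 => /andP[_ /eqP ->]; rewrite /pmon /= mulr1 expr1 pe_px; exact: (arrP (i, false)).
rewrite add0n => ->; rewrite /pmon /= mulr1 expr1.
have <- : cyc (cycV i) = i by rewrite /cycV permKV.
by rewrite cycE pe_py; exact: (arrP (cycV i, true)).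
Qed.

Lemma mcoef_corner i j a t : mcoef D (pe i * a * pe j) t != 0 ->
  t.1.1 = i /\ mend t = j.
Proof.
have peE r : pe r = b (r, 0%N, 0%N) by rewrite /= /pmon !mulr1.
rewrite !peE => /mcoef_mul_neq0[t1 [t2 [H]]]; rewrite mcoef_b.
case: (_ =P t2) => [<- _|_]; last by rewrite eqxx.
move=> /= jE ->; have [/= E _] := mcoef_b_mul_neq0 H; split=> //=.
by rewrite jE; case: t1 {H jE E} => [[u v] w] /=; rewrite !addn0.
Qed.

Variable G : set {lrmorphism A -> A}.
Hypothesis finG : finite_graded_aut_group G.
Hypothesis fixG : forall g, G g -> forall i, g (pe i) = pe i.

Lemma act_neq0 g a : G g -> a != 0 -> g a != 0.
Proof.
move=> Gg; apply: contra_neq => ga0.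
have [/bij_inj g_inj _] := gag_graded finG Gg.
by apply: g_inj; rewrite ga0 linear0.
Qed.

(** The degree-one part between two fixed vertices is at most a line, and an automorphism fixing
    both preserves it. *)
Lemma act_mon1 g i p q : G g -> (p + q = 1)%N ->
  eigenvector g (mon (i, p, q)).
Proof.
move=> Gg pq1; set t := (i, p, q); set a := mon t.
have aE : a = pe i * a * pe (mend (D := D) t).
  have peE r : pe r = b (r, 0%N, 0%N) by rewrite /= /pmon !mulr1.
  by rewrite !peE [a]/(b t) !mb_mul // ?addn0.
have ga t' : mcoef D (g a) t' != 0 -> t' = t.
  have gM u v : g (u * v) = g u * g v := rmorphM g u v.
  move=> gat'; have deg : (t'.1.2 + t'.2 = 1)%N.
    apply: graded_supp gat'; have [_ /(_ 1%N) <-] := gag_graded finG Gg.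
    by exists a => //; exact: graded_mon1.
  move: gat'; rewrite aE !gM !fixG // => /mcoef_corner[].
  rewrite /t; case: t' deg => [[i' p'] q'] /= deg -> E.
  have cN r : cyc r = cycV r -> False by move/esym/eqP; apply/negP; exact: cycV_neq_cyc.
  case: p p' q q' pq1 deg {t a aE} E => [|[|p]] [|[|p']] [|[|q]] [|[|q']] //= _ _.
    by move/cN.
  by move/esym/cN.
have gaE : g a = mcoef D (g a) t *: a.
  apply: (mcoef_ext (D := D)) => t'; rewrite mcoefZ [a in RHS]/(b t) mcoef_b.
  have [<-|tt'] := eqVneq t t'; first by rewrite mulr1.
  rewrite mulr0; apply/eqP/negP => /negP /ga E.
  by rewrite E eqxx in tt'.
exists (mcoef D (g a) t) => //; apply/negP => /eqP c0.
have := act_neq0 Gg (b_neq0 (D := D) t).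
by rewrite -[b t]/a gaE c0 scale0r eqxx.
Qed.

Lemma graded_diagonal : diagonal_action G D.
Proof.
move=> g Gg; have y_pow q s : eigenvector g (b (s, 0%N, q)).
  elim: q s => [|q IHq] s.
    exists 1; rewrite ?oner_neq0 // scale1r.
    by have := fixG Gg s; rewrite [b _]/(mon _) /pmon !mulr1.
  have <- := mb_mul (D := D) 0 q (erefl (mend (D := D) (s, 0%N, 1%N))).
  by apply: eigenvectorM; [exact: act_mon1 | exact: IHq].
case=> [[s p] q]; elim: p s => [|p IHp] s; first exact: y_pow.
have <- := mb_mul (D := D) p q (erefl (mend (D := D) (s, 1%N, 0%N))).
by apply: eigenvectorM; [exact: act_mon1 | exact: IHp].
Qed.

End GradedAction.

(** * A common period for a finite group *)

Section CentralPeriod.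
Variables (k : fieldType) (A : algType k) (G : set {lrmorphism A -> A}).
Hypothesis finG : finite_set G.
Hypothesis G1 : G (idfun : {lrmorphism A -> A}).
Hypothesis GM : forall g h, G g -> G h -> G (g \o h : {lrmorphism A -> A}).
Variable D : monomial_algebra A.
Hypothesis G_diag : diagonal_action G D.
Local Notation S := (mS D).
Local Notation b := (mb D).

Lemma wt_pow g j : G g -> exists2 h, G h & forall t, wt (D := D) h t = wt (D := D) g t ^+ j.
Proof.
move=> Gg; elim: j => [|j [h Gh hE]].
  by exists idfun => // t; rewrite /wt mcoef_b eqxx.
exists (g \o h : {lrmorphism A -> A}); first exact: GM.
move=> t; rewrite /wt -[mcoef _ _ _]/(mcoef D (g (h (b t))) t) (wtE G_diag t Gh) hE.
by rewrite linearZ mcoefZ exprSr.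
Qed.

(** Pigeonhole: the tuples of eigenvalues of elements of G fill a finite list, so among the powers
    of exponent 0 to its length two coincide. The difference of the exponents divides the factorial
    of the length. *)
Lemma finite_exponent (T : finType) (t : T -> S * nat * nat) :
  exists2 e, (0 < e)%N & forall g, G g -> forall i, wt (D := D) g (t i) ^+ e = 1.
Proof.
pose w (g : {lrmorphism A -> A}) := [ffun i => wt (D := D) g (t i)].
have /finite_seqP[L LE] : finite_set (w @` G)%classic by exact: finite_image.
exists (size L)`!; first exact: fact_gt0.
move=> g Gg i; pose s := [seq [ffun i => wt (D := D) g (t i) ^+ j] | j <- iota 0 (size L).+1].
have sL : {subset s <= L}.
  move=> f /mapP[j _ ->]; have [h Gh hE] := wt_pow j Gg.
  have : (w @` G)%classic (w h) by exists h.
  rewrite LE /= => whL; suff <- : w h = [ffun i => wt (D := D) g (t i) ^+ j] by [].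
  by apply/ffunP => l; rewrite !ffunE hE.
have : ~~ uniq s.
  by apply/negP => us; have := uniq_leq_size us sL; rewrite size_map size_iota ltnn.
case/(uniqPn [ffun i => 0]) => j1 [j2 [lt12 lt2]].
have lt2' : (j2 < (size L).+1)%N by rewrite size_map size_iota in lt2.
have lt1' : (j1 < (size L).+1)%N by exact: ltn_trans lt12 lt2'.
rewrite !(nth_map 0%N) ?size_iota // !nth_iota // !add0n => /ffunP /(_ i).
rewrite !ffunE -(subnKC (ltnW lt12)) exprD -{1}[_ ^+ j1]mulr1.
have x0 : wt (D := D) g (t i) ^+ j1 != 0 by apply: expf_neq0; exact: (wt_neq0 G_diag (t i) Gg).
move/(mulfI x0) => E.
have /dvdnP[c ->] : (j2 - j1 %| (size L)`!)%N.
  by apply: dvdn_fact; rewrite subn_gt0 lt12 leq_subLR; apply: leq_trans (leq_addl _ _).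
by rewrite mulnC exprM -E expr1n.
Qed.

Variable n : nat.
Hypotheses (n_gt0 : (0 < n)%N) (n_sig : forall s, iter n (msig D) s = s).
Hypothesis n_tau : forall s, iter n (mtau D) s = s.

Lemma iter_periodic (f : S -> S) c : (forall s, iter n f s = s) ->
  forall s, iter (n * c) f s = s.
Proof.
by move=> fn s; elim: c => [|c IHc]; rewrite ?muln0 // mulnS iterD IHc.
Qed.

(** N = n e: after n steps the walks along x and y close up, and the exponent e kills the
    eigenvalues of these closed walks. *)
Lemma central_period_exists : exists N, central_period G D N.
Proof.
have [e e0 eE] := finite_exponent (fun z : S * bool =>
  if z.2 then (z.1, n, 0%N) else (z.1, 0%N, n)).
have wx g s c : G g -> wt (D := D) g (s, (n * c)%N, 0%N) = wt (D := D) g (s, n, 0%N) ^+ c.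
  move=> Gg; elim: c => [|c IHc].
    by rewrite muln0; have /F_wt := F0 G_diag s; apply.
  rewrite mulnS -{1}[0%N]addn0 (wtM G_diag (s' := s)) // ?IHc ?exprS //.
  by rewrite /mend /= n_sig.
have wy g s c : G g -> wt (D := D) g (s, 0%N, (n * c)%N) = wt (D := D) g (s, 0%N, n) ^+ c.
  move=> Gg; elim: c => [|c IHc].
    by rewrite muln0; have /F_wt := F0 G_diag s; apply.
  rewrite mulnS -{1}[0%N]addn0 (wtM G_diag (s' := s)) // ?IHc ?exprS //.
  by rewrite /mend /= n_tau.
exists (n * e)%N; split.
- by rewrite muln_gt0 n_gt0.
- exact: iter_periodic.
- exact: iter_periodic.
- move=> s; apply/(F_wt G_diag) => g Gg; rewrite wx //; exact: (eE g Gg (s, true)).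
- move=> s; apply/(F_wt G_diag) => g Gg; rewrite wy //; exact: (eE g Gg (s, false)).
Qed.

End CentralPeriod.

Lemma monomial_algebra_gldim2 (k : fieldType) (A : algType k) (D : monomial_algebra A)
    (s : mS D) (N : nat) : (0 < N)%N -> mend (s, N, 0%N) = s ->
  mend (s, 0%N, N) = s -> gldim A = Some 2%N.
Proof.
move=> N0 xN yN; apply/gldim_eq2; split; first exact: monomial_algebra_gldim D.
apply: (@gldim_gt1 _ _ D A idfun s N (mb D (s, 0%N, 0%N)) (mb D (s, N, 0%N))
  (mb D (s, 0%N, N))) => //.
by rewrite !mb_mul // !addn0.
Qed.

Theorem mainTheorem2 (k : closedFieldType) (char0 : [pchar k] =i pred0)
    (n : nat) (n_ge3 : (3 <= n)%N)
    (G : set {lrmorphism preproj k (Atilde n.-1) -> preproj k (Atilde n.-1)})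
    (finG : finite_graded_aut_group G)
    (fixG : forall g, G g -> forall i : vert (Atilde n.-1),
      g (vertex_el k i) = vertex_el k i) :
  [<-> gldim (fixedring G) = gldim (preproj k (Atilde n.-1));
       gldim (fixedring G) = Some 2%N;
       twistedCY (fixedring G : algType k);
       projective (over_fixedring G)].
Proof.
have m_ge2 : (2 <= n.-1)%N by case: n n_ge3 {G finG fixG} => [|[|[|]]].
pose D := preproj_monomial k n.-1.
have G_diag : diagonal_action G D := graded_diagonal m_ge2 finG fixG.
have [N HN] : exists N, central_period G D N.
  exact (central_period_exists (gag_finite finG) (gag_id finG)
    (fun g h => @gag_comp _ _ _ finG g h) G_diag (ltn0Sn n.-1)
    (@cyc_period n.-1) (@cycV_period n.-1)).
pose s0 : mS D := ord0.
have gldimA : gldim (preproj k (Atilde n.-1)) = Some 2%N.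
  exact: (@monomial_algebra_gldim2 k _ D s0 n.-1.+1 (ltn0Sn _)
    (cyc_period ord0) (cycV_period ord0)).
have gl2 : gldim_le (fixedring G) 2 -> gldim (fixedring G) = Some 2%N.
  by move=> gl2; apply/gldim_eq2; split=> //; exact (fixedring_gldim_gt1 G_diag HN s0).
(* All implications of the cycle but the first pass through rectangularity; the first only needs
   that A has global dimension 2. *)
tfae.
- by rewrite gldimA.
- case/gldim_eq2 => [+ _] => /(gldim_rectangular G_diag HN) R.
  exact (rectangular_twistedCY G_diag HN R).
- move/(fixedring_twistedCY_gldim G_diag HN s0 char0) => /(gldim_rectangular G_diag HN) R.
  exact (rectangular_projective G_diag HN R).
move/(projective_rectangular G_diag HN) => /(rectangular_gldim G_diag HN) /gl2 ->.
by rewrite gldimA.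
Qed.
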